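(* Let $E$ be a field with a valuation $v$ (with arbitrary value group). Let $f(X)\in E[X]$ be a square-free polynomial of degree $n\geq 2$, and assume that the residue characteristic satisfies $\mathrm{char}(Ev)=0$ or $\mathrm{char}(Ev)>n$. Let $F=E(X)[\sqrt{f(X)}]$ be the function field over $E$ of the hyperelliptic curve $Y^2=f(X)$. Then there are only finitely many residually transcendental extensions $w$ of $v$ to $F$ such that $Fw/Ev$ is non-ruled.
   Context: For a valuation $v$ on a field $K$, $\mathcal{O}_v$ denotes the valuation ring, $\mathfrak{m}_v$ its maximal ideal, $Kv=\mathcal{O}_v/\mathfrak{m}_v$ the residue field and $vK$ the value group, written additively (an arbitrary ordered abelian group). For a field extension $L/K$, an extension of $v$ to $L$ is a valuation $w$ on $L$ with $w|_K=v$ (so $vK$ is an ordered subgroup of $wL$). Two valuations on $L$ are distinct if their valuation rings are different; valuations are counted accordingly. Here $X$ is transcendental over $E$. An extension $w$ of $v$ to $F$ is residually transcendental if the residue field extension $Fw/Ev$ is transcendental. A function field in one variable $K/k$ (finitely generated, of transcendence degree one) is ruled if $K=k'(x)$ for some finite extension $k'/k$ and some $x\in K$, and non-ruled otherwise. *)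

(* Defs.v *)
From HB Require Import structures.
From mathcomp Require Import all_boot all_order all_algebra all_field.
Set Implicit Arguments.
Unset Strict Implicit.
Unset Printing Implicit Defensive.

Import Order.TTheory GRing.Theory.
Local Open Scope ring_scope.
Local Open Scope quotient_scope.

(* Totality is a field here: inheriting from Order.Total would require joins
   that the hierarchy of number structures lacks. *)
HB.mixin Record isOrderedGroup G of Num.POrderedZmodule G := {
  ogroup_leD2l : forall z x y : G, x <= y -> z + x <= z + y;
  ogroup_total : total (<=%R : rel G)
}.

#[short(type="orderedGroupType")]
HB.structure Definition OrderedGroup :=
  {G of Num.POrderedZmodule G & isOrderedGroup G}.

(* A (Krull) valuation is a map on the nonzero elements; v 0, which stands for
   +oo, is a junk value that nothing depends on.  By surjectivity [vgroup v] is
   the value group vK itself. *)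
Record valuation (K : fieldType) := Valuation {
  vgroup : orderedGroupType;
  vfun :> K -> vgroup;
  valuationM : forall x y, x != 0 -> y != 0 -> vfun (x * y) = vfun x + vfun y;
  valuationD : forall x y, x != 0 -> y != 0 -> x + y != 0 ->
    (Order.min (vfun x) (vfun y) <= vfun (x + y));
  valuation_surj : forall g, exists2 x, x != 0 & vfun x = g
}.

Section ResidueField.
Variables (K : fieldType) (v : valuation K).

Lemma vgroup_leD2l (c a b : vgroup v) : a <= b -> c + a <= c + b.
Proof. exact: ogroup_leD2l. Qed.

Lemma vgroup_leNgt (a b : vgroup v) : (a <= b) = ~~ (b < a).
Proof. exact/comparable_leNgt/ogroup_total. Qed.

Definition vring : {pred K} := [pred x | (x == 0) || (0 <= v x)].

Lemma valuation1 : v 1 = 0.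
Proof.
have := valuationM v (oner_neq0 K) (oner_neq0 K).
by rewrite mulr1 => /eqP; rewrite -subr_eq0 opprD addNKr oppr_eq0 => /eqP.
Qed.

Lemma valuationN1 : v (- 1) = 0.
Proof.
have N1 : - 1 != 0 :> K by rewrite oppr_eq0 oner_eq0.
have := valuationM v N1 N1; rewrite mulrNN mulr1 valuation1 => e.
have /orP[h|h] := ogroup_total 0 (v (- 1)); apply/le_anti; rewrite h ?andbT //=.
  by have := vgroup_leD2l (v (-1)) h; rewrite addr0 -e.
by have := vgroup_leD2l (v (-1)) h; rewrite addr0 -e.
Qed.

Lemma valuationN x : x != 0 -> v (- x) = v x.
Proof.
move=> x0; rewrite -mulN1r valuationM ?valuationN1 ?add0r //.
by rewrite oppr_eq0 oner_eq0.
Qed.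

Lemma valuationV x : x != 0 -> v x^-1 = - v x.
Proof.
move=> x0; apply/eqP; rewrite -addr_eq0 -valuationM ?invr_eq0 // mulVf //.
by rewrite valuation1.
Qed.

Lemma vgroup_addr_ge0 (a b : vgroup v) :
  (0 <= a) -> (0 <= b) -> (0 <= a + b).
Proof.
by move=> a0 b0; apply: (le_trans a0); rewrite -{1}[a]addr0 vgroup_leD2l.
Qed.

Lemma vgroup_addr_gt0 (a b : vgroup v) :
  (0 <= a) -> (0 < b) -> (0 < a + b).
Proof.
move=> a0 b0; rewrite lt_neqAle (vgroup_addr_ge0 a0 (ltW b0)) andbT eq_sym.
rewrite addr_eq0; apply/eqP => ab; have := vgroup_leD2l b a0; rewrite addr0 ab subrr.
by rewrite vgroup_leNgt b0.
Qed.

Lemma vgroup_oppr_ge0 (a : vgroup v) : (0 <= - a) = (a <= 0).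
Proof.
apply/idP/idP => h; first by have := vgroup_leD2l a h; rewrite addr0 subrr.
by have := vgroup_leD2l (- a) h; rewrite addr0 addNr.
Qed.

Lemma vring_subring_closed : subring_closed vring.
Proof.
split=> [|x y|x y]; rewrite !inE.
- by rewrite valuation1 lexx orbT.
- have [->|x0] := eqVneq x 0.
    rewrite sub0r oppr_eq0; have [//|y0 _] := eqVneq y 0.
    by rewrite valuationN.
  have [->|y0] := eqVneq y 0; first by rewrite subr0 (negPf x0).
  have [//|xy0 /= vx vy] := eqVneq (x - y) 0.
  have Ny0 : - y != 0 by rewrite oppr_eq0.
  apply: le_trans (valuationD v x0 Ny0 xy0); rewrite valuationN //.
  by rewrite comparable_le_min ?vx //; exact: ogroup_total.
- have [->|x0] := eqVneq x 0; first by rewrite mul0r eqxx.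
  have [->|y0] := eqVneq y 0; first by rewrite mulr0 eqxx.
  rewrite mulf_eq0 (negPf x0) (negPf y0) /= valuationM //.
  exact: vgroup_addr_ge0.
Qed.

HB.instance Definition _ := GRing.isSubringClosed.Build K vring
  vring_subring_closed.

Record vring_of := VringOf { vring_val :> K; _ : vring_val \in vring }.

HB.instance Definition _ := [isSub for vring_val].
HB.instance Definition _ := [Choice of vring_of by <:].
HB.instance Definition _ := [SubChoice_isSubComNzRing of vring_of by <:].

Definition vmax : {pred vring_of} :=
  [pred x | (val x == 0) || (0 < v (val x))].

Lemma vmax_idealr_closed : idealr_closed vmax.
Proof.
split=> [||a x y]; rewrite !inE.
- by rewrite rmorph0 eqxx.
- by rewrite rmorph1 oner_eq0 valuation1 ltxx.
rewrite rmorphD rmorphM /=; set b := val x; set c := val y.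
have /orP[/eqP->|/= va] : val a \in vring by exact: valP.
  by rewrite mul0r add0r.
have [a0|a0] := eqVneq (val a) 0; first by rewrite a0 mul0r add0r.
have [->|b0 /= vb] := eqVneq b 0; first by rewrite mulr0 add0r.
have vab : (0 < v (val a * b)) by rewrite valuationM // vgroup_addr_gt0.
have [->|c0 /= vc] := eqVneq c 0; first by rewrite addr0 vab orbT.
have [//|s0 /=] := eqVneq (val a * b + c) 0.
apply: lt_le_trans (valuationD v _ c0 s0); last by rewrite mulf_neq0.
by rewrite comparable_lt_min ?vab //; exact: ogroup_total.
Qed.

HB.instance Definition _ := isIdealr.Build vring_of vmax vmax_idealr_closed.

Definition residue : Type := {ideal_quot vmax}.
HB.instance Definition _ := GRing.ComNzRing.on residue.
HB.instance Definition _ := EqQuotient.on residue.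

Definition residue_pi : vring_of -> residue := \pi_residue.

Lemma residue_pi_eq (x y : vring_of) :
  (residue_pi x == residue_pi y) = (x - y \in vmax).
Proof. by rewrite /residue_pi eqmodE. Qed.

Lemma residue_piD : {morph residue_pi : x y / x + y}.
Proof. by move=> x y; exact: (raddfD (\pi_{ideal_quot vmax})). Qed.

Lemma residue_piB : {morph residue_pi : x y / x - y}.
Proof. by move=> x y; exact: (raddfB (\pi_{ideal_quot vmax})). Qed.

Lemma residue_piM : {morph residue_pi : x y / x * y}.
Proof. by move=> x y; exact: (rmorphM (\pi_{ideal_quot vmax})). Qed.

Lemma residue_pi0 : residue_pi 0 = 0.
Proof. exact: (raddf0 (\pi_{ideal_quot vmax})). Qed.

Lemma residue_pi1 : residue_pi 1 = 1.
Proof. exact: (rmorph1 (\pi_{ideal_quot vmax})). Qed.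

Lemma residue_reprK (x : residue) : residue_pi (repr x) = x.
Proof. exact: reprK. Qed.

(* If x is in the maximal ideal and nonzero, its inverse is not in the
   valuation ring and insubd returns the default value 0. *)
Definition residue_inv (x : residue) : residue :=
  residue_pi (insubd (0 : vring_of) (vring_val (repr x))^-1).

Lemma residue_mulVf (x : residue) : x != 0 -> residue_inv x * x = 1.
Proof.
rewrite -[x in x != 0]residue_reprK -[x in _ * x]residue_reprK /residue_inv.
rewrite -residue_pi0 residue_pi_eq subr0 -residue_piM -residue_pi1.
set r := repr x; rewrite !inE negb_or -vgroup_leNgt => /andP[r0 vr].
have -> : insubd (0 : vring_of) (vring_val r)^-1 * r = 1; last by [].
apply: val_inj; rewrite [LHS]rmorphM [RHS]rmorph1 /= val_insubd.
rewrite inE valuationV // vgroup_oppr_ge0 vr orbT /=.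
by rewrite mulVf.
Qed.

Lemma residue_inv0 : residue_inv 0 = 0.
Proof.
rewrite /residue_inv -residue_pi0; set r := repr _.
have : r \in vmax.
  by rewrite -[r]subr0 -residue_pi_eq residue_reprK.
rewrite inE => h; congr residue_pi; apply: val_inj; rewrite val_insubd.
have [r0|r0] := eqVneq (val r) 0.
  by rewrite [vring_val r]r0 invr0 rmorph0; case: ifP.
move: h; rewrite (negPf r0) /= => h.
by rewrite inE invr_eq0 (negPf r0) valuationV // vgroup_oppr_ge0 vgroup_leNgt h.
Qed.

HB.instance Definition _ := GRing.ComNzRing_isField.Build residue
  residue_mulVf residue_inv0.

End ResidueField.

Arguments vmax {K} v.

Section Extension.
Variables (K L : fieldType) (iota : {rmorphism K -> L}).

(* w restricts to v along iota, vK being identified with an ordered subgroup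
   of wL through e. *)
Definition extends (v : valuation K) (w : valuation L) :=
  exists e : {additive vgroup v -> vgroup w},
    {mono e : g h / (g <= h)} /\
    (forall x, x != 0 -> w (iota x) = e (v x)).

Record extension (v : valuation K) := Extension {
  ext_val :> valuation L;
  extensionP : extends v ext_val
}.

Variables (v : valuation K) (w : extension v).

Lemma extension_vring x : (iota x \in vring w) = (x \in vring v).
Proof.
have [e [eM ew]] := extensionP w; rewrite !inE fmorph_eq0.
by have [//|x0 /=] := eqVneq x 0; rewrite ew // -(raddf0 e) eM.
Qed.

Definition vring_map (x : vring_of v) : vring_of w :=
  VringOf (etrans (extension_vring (vring_val x)) (valP x)).

Lemma vring_map_vmax (x : vring_of v) :
  (vring_map x \in vmax w) = (x \in vmax v).
Proof.
have [e [eM ew]] := extensionP w; rewrite !inE /= fmorph_eq0.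
have [//|x0 /=] := eqVneq (vring_val x) 0; rewrite ew // -(raddf0 e).
exact: (leW_mono eM).
Qed.

Definition residue_map (x : residue v) : residue w :=
  residue_pi (vring_map (repr x)).

Lemma residue_map_pi (x : vring_of v) :
  residue_map (residue_pi x) = residue_pi (vring_map x).
Proof.
apply/eqP; rewrite /residue_map residue_pi_eq.
have -> : vring_map (repr (residue_pi x)) - vring_map x =
          vring_map (repr (residue_pi x) - x).
  by apply: val_inj; rewrite /= rmorphB.
by rewrite vring_map_vmax -residue_pi_eq residue_reprK.
Qed.

Fact residue_map_is_zmod_morphism : zmod_morphism residue_map.
Proof.
move=> x y; apply/eqP; rewrite eq_sym subr_eq eq_sym.
rewrite -[x]residue_reprK -[y]residue_reprK -residue_piB !residue_map_pi.
rewrite -residue_piD; apply/eqP; congr residue_pi.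
by apply: val_inj; rewrite /= rmorphB subrK.
Qed.

Fact residue_map_is_monoid_morphism : monoid_morphism residue_map.
Proof.
split=> [|x y].
  rewrite -residue_pi1 residue_map_pi -residue_pi1; congr residue_pi.
  by apply: val_inj; rewrite /= rmorph1.
rewrite -[x]residue_reprK -[y]residue_reprK -residue_piM !residue_map_pi.
by rewrite -residue_piM; congr residue_pi; apply: val_inj; rewrite /= rmorphM.
Qed.

HB.instance Definition _ := GRing.isZmodMorphism.Build (residue v) (residue w)
  residue_map residue_map_is_zmod_morphism.
HB.instance Definition _ := GRing.isMonoidMorphism.Build (residue v) (residue w)
  residue_map residue_map_is_monoid_morphism.

End Extension.

Section FieldExtensions.
Variables (k K : fieldType) (iota : {rmorphism k -> K}).

Definition transcendental_ext := exists x : K, ~ algebraicOver iota x.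

(* K = k'(x) for a field k' between k and K that is finite over k; as soon as
   K/k is transcendental, x is transcendental over k' and K/k is a function
   field in one variable. *)
Definition ruled :=
  exists (k' : fieldExtType k) (j : {rmorphism k' -> K}) (x : K),
    (forall a : k, j a%:A = iota a) /\
    (forall z : K, exists p q : {poly k'},
       (map_poly j q).[x] != 0 /\ z = (map_poly j p).[x] / (map_poly j q).[x]).

End FieldExtensions.

Definition residually_transcendental (K L : fieldType)
    (iota : {rmorphism K -> L}) (v : valuation K) (w : extension iota v) :=
  transcendental_ext (residue_map w).

Definition square_free (E : fieldType) (f : {poly E}) :=
  forall g : {poly E}, size g != 1%N -> ~~ (g ^+ 2 %| f).

Definition const_embedding (E : fieldType)
    (F : fieldExtType {fraction {poly E}}) : {rmorphism E -> F} :=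
  GRing.in_alg F \o @tofrac {poly E} \o polyC.

(* Main.v *)
From HB Require Import structures.
Require Import Defs.
From mathcomp Require Import all_boot all_order all_algebra all_field zify ring.
From mathcomp Require Import boolp classical_sets functions cardinality.
Set Implicit Arguments.
Unset Strict Implicit.
Unset Printing Implicit Defensive.

Import Order.TTheory GRing.Theory.
Local Open Scope ring_scope.

(* Over an algebraic closure a residually transcendental extension of v to E(X)
   is the Gauss valuation of a disc, and w on F is non-ruled only if the roots
   of f inside the disc lie in at least two residue classes; such a disc has
   center a root a and radius v (a - b) for another root b, so there are
   finitely many.

   Call an element good if its value is torsion modulo vE and the residue
   attached to it is algebraic over Ev.  If P is a polynomial of least degree
   that is not good, P-adic expansions compute w, and the residue field of E(X)
   is obtained from a finite extension of Ev by adjoining one element t (the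
   ruled residue theorem).  In the remaining cases f is, over a splitting field,
   equivalent to c (X - a)^m.  Since m! is a unit, rho = f^(m) is equivalent to
   m! c and h = f^(m-1) to m! c (X - a), so that m! f is equivalent to
   rho (h / rho)^m.  Up to a square f is then either good or the polynomial h,
   which is linear in P; the square root adjoined to the residue field of E(X)
   is that of a constant or of c t^l or of a linear function of t, and the
   result is ruled. *)

(** * Divisibility and residues of a valuation *)

(** Ruledness does not descend along an extension of the base: a conic without a rational point
    becomes rational over a quadratic extension. The picture of discs is available only over a
    splitting field L of f, so ruledness has to be proved over E itself, with P in E[X]. This is why
    a and c, which lie in L, are traded for derivatives of f, whose coefficients lie in E. The two
    levels communicate through E(X): w on F and an extension w' to L(X) of its restriction to E(X)
    agree on which elements of E(X) are good and which are equivalent.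

    Finiteness is counted on valuation rings. A disc valuation is determined by a, b and its
    restriction to L, and both L over E and F over E(X) are finite extensions, in which a valuation
    ring has only finitely many extensions. That 2 is a unit serves twice, in this count and in the
    conjugation y -> - y of F over E(X). *)

Section Divisibility.
Variables (K : fieldType) (w : valuation K).
Implicit Types x y z a b c d : K.

Lemma vring_total x : (x \in vring w) || (x^-1 \in vring w).
Proof.
rewrite !inE invr_eq0; have [//|x0 /=] := eqVneq x 0.
by rewrite valuationV // vgroup_oppr_ge0; exact: ogroup_total.
Qed.

(* With w 0 = +oo, [dv], [sdv] and [eqv] compare w x and w y by <=, < and =,
   and [sim x y] means w (x - y) > w x. *)
Definition dv x y := (y == 0) || ((x != 0) && (y / x \in vring w)).
Definition sdv x y := ~~ dv y x.
Definition eqv x y := dv x y && dv y x.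
Definition sim x y := sdv x (x - y).

Lemma dvE x y : dv x y = (y == 0) || ((x != 0) && (y / x \in vring w)).
Proof. by []. Qed.
Lemma eqvE x y : eqv x y = dv x y && dv y x. Proof. by []. Qed.
Lemma sdvE x y : sdv x y = ~~ dv y x. Proof. by []. Qed.
Lemma simE x y : sim x y = sdv x (x - y). Proof. by []. Qed.

Lemma dvP x y : reflect (exists2 r, r \in vring w & y = x * r) (dv x y).
Proof.
apply: (iffP orP) => [[/eqP->|/andP[x0 h]]|[r hr ->]].
- by exists 0; rewrite ?rpred0 ?mulr0.
- by exists (y / x) => //; rewrite mulrC divfK.
have [->|x0] := eqVneq x 0; first by left; rewrite mul0r.
by right; rewrite mulrAC mulfV // mul1r.
Qed.

Lemma dv0 x : dv x 0. Proof. by rewrite /dv eqxx. Qed.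
Lemma dv0l y : dv 0 y = (y == 0).
Proof. by rewrite /dv eqxx orbF. Qed.
Lemma dv_refl x : dv x x.
Proof. by apply/dvP; exists 1; rewrite ?rpred1 ?mulr1. Qed.
Lemma dv_trans y x z : dv x y -> dv y z -> dv x z.
Proof.
move=> /dvP[r hr ->] /dvP[s hs ->]; apply/dvP; exists (r * s).
  exact: rpredM.
by rewrite mulrA.
Qed.
Lemma dv_total x y : dv x y || dv y x.
Proof.
rewrite /dv; have [->|y0] := eqVneq y 0; first by [].
have [->|x0] := eqVneq x 0; first by [].
by have /= := vring_total (y / x); rewrite invf_div.
Qed.
Lemma dv1 x : dv 1 x = (x \in vring w).
Proof.
by rewrite /dv oner_neq0 divr1 /=; case: eqP => // ->; rewrite rpred0.
Qed.
Lemma dvD z x y : dv z x -> dv z y -> dv z (x + y).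
Proof.
move=> /dvP[r hr ->] /dvP[s hs ->]; apply/dvP; exists (r + s).
  exact: rpredD.
by rewrite mulrDr.
Qed.
Lemma dvNr x y : dv x (- y) = dv x y.
Proof. by rewrite /dv oppr_eq0 mulNr rpredN. Qed.
Lemma dvNl x y : dv (- x) y = dv x y.
Proof. by rewrite /dv oppr_eq0 invrN mulrN rpredN. Qed.
Lemma dvB z x y : dv z x -> dv z y -> dv z (x - y).
Proof. by move=> hx hy; rewrite dvD ?dvNr. Qed.
Lemma dv_sum (I : Type) (r : seq I) (P : pred I) (F : I -> K) z :
  (forall i, P i -> dv z (F i)) -> dv z (\sum_(i <- r | P i) F i).
Proof.
by move=> h; elim/big_ind: _ => //; [exact: dv0|exact: dvD].
Qed.
Lemma dvM a b c d : dv a b -> dv c d -> dv (a * c) (b * d).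
Proof.
move=> /dvP[r hr ->] /dvP[s hs ->]; apply/dvP; exists (r * s).
  exact: rpredM.
by rewrite mulrACA.
Qed.
Lemma dvM2l z x y : z != 0 -> dv (z * x) (z * y) = dv x y.
Proof.
move=> z0; apply/idP/idP => h; last exact: dvM (dv_refl z) h.
by have := dvM (dv_refl z^-1) h; rewrite !mulKf.
Qed.
Lemma dvM2r z x y : z != 0 -> dv (x * z) (y * z) = dv x y.
Proof. by move=> z0; rewrite ![_ * z]mulrC dvM2l. Qed.
Lemma dvV x y : x != 0 -> y != 0 -> dv x^-1 y^-1 = dv y x.
Proof.
by move=> x0 y0; rewrite /dv invr_eq0 (negPf x0) (negPf y0) invrK mulrC invr_eq0 x0.
Qed.
Lemma dvX x y n : dv x y -> dv (x ^+ n) (y ^+ n).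
Proof.
by move=> h; elim: n => [|n IHn]; rewrite ?expr0 ?dv_refl // !exprS dvM.
Qed.
Lemma dv_neq0 x y : dv x y -> y != 0 -> x != 0.
Proof. by move=> h; apply: contraNN => /eqP x0; rewrite -dv0l -x0. Qed.

Lemma sdvW x y : sdv x y -> dv x y.
Proof. by rewrite /sdv => h; have := dv_total x y; rewrite (negPf h) orbF. Qed.
Lemma sdv_neq0 x y : sdv x y -> x != 0.
Proof. by apply: contraNN => /eqP->; rewrite dv0. Qed.
Lemma sdvr0 x : sdv x 0 = (x != 0).
Proof. by rewrite /sdv dv0l. Qed.
Lemma sdvN x y : ~~ sdv x y -> dv y x. Proof. by rewrite negbK. Qed.
Lemma dv_sdv_trans y x z : dv x y -> sdv y z -> sdv x z.
Proof. by move=> xy; apply: contraNN => zx; exact: dv_trans zx xy. Qed.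
Lemma sdv_dv_trans y x z : sdv x y -> dv y z -> sdv x z.
Proof. by move=> xy yz; apply: contraNN xy => zx; exact: dv_trans yz zx. Qed.
Lemma sdvNr x y : sdv x (- y) = sdv x y. Proof. by rewrite /sdv dvNl. Qed.
Lemma sdvNl x y : sdv (- x) y = sdv x y. Proof. by rewrite /sdv dvNr. Qed.
Lemma sdvM2r z x y : z != 0 -> sdv (x * z) (y * z) = sdv x y.
Proof. by move=> z0; rewrite /sdv dvM2r. Qed.
Lemma sdvM a b c d : sdv a b -> dv c d -> c != 0 -> sdv (a * c) (b * d).
Proof.
move=> ab cd c0; apply: (@sdv_dv_trans (b * c)); first by rewrite sdvM2r.
by rewrite dvM ?dv_refl.
Qed.
Lemma sdvD z x y : sdv z x -> sdv z y -> sdv z (x + y).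
Proof.
move=> zx zy; have /orP[h|h] := dv_total x y.
  by apply: sdv_dv_trans zx _; rewrite dvD ?dv_refl.
by apply: sdv_dv_trans zy _; rewrite dvD ?dv_refl.
Qed.
Lemma sdvB z x y : sdv z x -> sdv z y -> sdv z (x - y).
Proof. by move=> hx hy; rewrite sdvD ?sdvNr. Qed.
Lemma sdv_sum (I : Type) (r : seq I) (P : pred I) (F : I -> K) z :
  z != 0 -> (forall i, P i -> sdv z (F i)) -> sdv z (\sum_(i <- r | P i) F i).
Proof.
by move=> z0 h; elim/big_ind: _ => //; [rewrite sdvr0|exact: sdvD].
Qed.
Lemma sdv1M a b : sdv 1 a -> dv 1 b -> sdv 1 (a * b).
Proof. by move=> ha hb; rewrite -[X in sdv X _]mulr1 sdvM ?oner_neq0. Qed.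

Lemma eqv_dv x y : eqv x y -> dv x y. Proof. by case/andP. Qed.
Lemma eqv_dvr x y : eqv x y -> dv y x. Proof. by case/andP. Qed.
Lemma eqv_refl x : eqv x x. Proof. by rewrite /eqv dv_refl. Qed.
Lemma eqv_sym x y : eqv x y = eqv y x. Proof. by rewrite /eqv andbC. Qed.
Lemma eqv_trans y x z : eqv x y -> eqv y z -> eqv x z.
Proof.
move=> /andP[a b] /andP[c d]; apply/andP; split.
  exact: dv_trans a c.
exact: dv_trans d b.
Qed.
Lemma eqvM a b c d : eqv a b -> eqv c d -> eqv (a * c) (b * d).
Proof. by move=> /andP[? ?] /andP[? ?]; rewrite /eqv !dvM. Qed.
Lemma eqvX x y n : eqv x y -> eqv (x ^+ n) (y ^+ n).
Proof. by move=> /andP[? ?]; rewrite /eqv !dvX. Qed.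
Lemma eqv_neq0 x y : eqv x y -> (x == 0) = (y == 0).
Proof.
move=> /andP[xy yx]; apply/idP/idP => /eqP h.
  by rewrite -dv0l -h.
by rewrite -dv0l -h.
Qed.
Lemma eqvV x y : eqv x y -> eqv x^-1 y^-1.
Proof.
move=> h; have := eqv_neq0 h; have [->|y0] := eqVneq y 0.
  by move=> /eqP ->; rewrite eqv_refl.
move=> /negbT x0; case/andP: h => a b.
by rewrite /eqv !dvV ?a ?b.
Qed.
Lemma eqvM2l z x y : z != 0 -> eqv (z * x) (z * y) = eqv x y.
Proof. by move=> z0; rewrite /eqv !dvM2l. Qed.
Lemma eqv1_div x y : y != 0 -> eqv 1 (x / y) = eqv x y.
Proof.
move=> y0; rewrite -(eqvM2l 1 _ y0) mulr1 [_ * (_ / _)]mulrC divfK //.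
exact: eqv_sym.
Qed.
Lemma eqvN x y : ~~ eqv x y -> sdv x y || sdv y x.
Proof. by rewrite /sdv /eqv negb_and orbC. Qed.

Lemma sim_neq0 x y : sim x y -> x != 0. Proof. exact: sdv_neq0. Qed.
Lemma sim_eqv x y : sim x y -> eqv x y.
Proof.
move=> h; apply/andP; split.
  by rewrite -[y](subKr x) dvB ?dv_refl ?sdvW.
apply: contraT => nh; have := sdvD h nh.
by rewrite subrK /sdv dv_refl.
Qed.
Lemma sim_neq0r x y : sim x y -> y != 0.
Proof. by move=> h; rewrite -(eqv_neq0 (sim_eqv h)) (sim_neq0 h). Qed.
Lemma sim_refl x : x != 0 -> sim x x.
Proof. by rewrite /sim subrr sdvr0. Qed.
Lemma sim_sym x y : sim x y -> sim y x.
Proof.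
move=> h; have /andP[xy yx] := sim_eqv h.
by rewrite /sim -opprB sdvNr; exact: dv_sdv_trans yx h.
Qed.
Lemma sim_trans y x z : sim x y -> sim y z -> sim x z.
Proof.
move=> xy yz; have /andP[h _] := sim_eqv xy.
by rewrite /sim -(subrKA y) sdvD //; exact: dv_sdv_trans h yz.
Qed.
Lemma simM a b c d : sim a b -> sim c d -> sim (a * c) (b * d).
Proof.
move=> ab cd; have /andP[h _] := sim_eqv ab.
have -> : sim (a * c) (b * d) = sdv (a * c) ((a - b) * c + b * (c - d)).
  by rewrite /sim; congr sdv; rewrite mulrBl mulrBr addrA subrK.
apply: sdvD; first by rewrite sdvM ?dv_refl // (sim_neq0 cd).
by rewrite [a * c]mulrC [b * _]mulrC sdvM // (sim_neq0 ab).
Qed.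
Lemma simX x y n : sim x y -> sim (x ^+ n) (y ^+ n).
Proof.
move=> h; elim: n => [|n IHn]; first by rewrite !expr0 sim_refl ?oner_neq0.
by rewrite !exprS simM.
Qed.
Lemma simV x y : sim x y -> sim x^-1 y^-1.
Proof.
move=> h; have x0 := sim_neq0 h; have y0 := sim_neq0r h.
have z0 : x^-1 * y^-1 != 0 by rewrite mulf_neq0 ?invr_eq0.
have := simM (sim_sym h) (sim_refl z0).
by rewrite mulrCA mulfV // mulr1 mulrA mulfV // mul1r.
Qed.
Lemma sim_add x y : sdv x y -> sim (x + y) x.
Proof.
by move=> h; apply: sim_sym; rewrite /sim opprD addrA subrr sub0r sdvNr.
Qed.
Lemma sim_dvr x y z : sim x y -> dv z x = dv z y.
Proof.
move=> /sim_eqv/andP[a b]; apply/idP/idP => h; first exact: dv_trans h a.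
exact: dv_trans h b.
Qed.

Lemma dv_min (n : nat) (F : 'I_n -> K) :
  (exists i, F i != 0) -> exists2 i, F i != 0 & forall j, dv (F i) (F j).
Proof.
elim: n F => [|n IHn] F; first by case=> [[]].
move=> [i0 Fi0].
have [/existsP[i hi]|/existsPn h] := boolP [exists i : 'I_n, F (lift ord0 i) != 0].
  have [j Fj hj] := IHn (fun i => F (lift ord0 i)) (ex_intro _ i hi).
  have [h|h] := boolP (dv (F (lift ord0 j)) (F ord0)).
    exists (lift ord0 j) => // k; case: (unliftP ord0 k) => [k' ->|->//].
    exact: hj.
  exists ord0 => [|k]; first exact: sdv_neq0 h.
  case: (unliftP ord0 k) => [k' ->|->]; last exact: dv_refl.
  exact: dv_trans (sdvW h) (hj _).
have h' k : F (lift ord0 k) = 0 by apply/eqP/negPn/h.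
exists ord0 => [|k].
  by move: Fi0; case: (unliftP ord0 i0) => [k ->|->//]; rewrite h' eqxx.
case: (unliftP ord0 k) => [k' ->|->]; last exact: dv_refl.
by rewrite h' dv0.
Qed.

Definition resfield : fieldType := residue w.
Local Notation kw := resfield.

(** Extended by 0 outside the valuation ring, so that [res x != 0] alone already says that x is a
    unit. *)
Definition res x : kw := residue_pi (insubd (0 : vring_of w) x).

Lemma resE (x : vring_of w) : res (val x) = residue_pi x :> residue w.
Proof. by rewrite /res valKd. Qed.
Lemma res_surj (z : kw) : exists2 x, dv 1 x & z = res x.
Proof.
exists (val (repr z)); first by rewrite dv1; exact: valP.
by rewrite resE residue_reprK.
Qed.
Lemma resD x y : dv 1 x -> dv 1 y -> res (x + y) = res x + res y.
Proof.
rewrite !dv1 => hx hy; pose X := VringOf hx; pose Y := VringOf hy.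
by rewrite -[x]/(val X) -[y]/(val Y) -rmorphD !resE residue_piD.
Qed.
Lemma resM x y : dv 1 x -> dv 1 y -> res (x * y) = res x * res y.
Proof.
rewrite !dv1 => hx hy; pose X := VringOf hx; pose Y := VringOf hy.
by rewrite -[x]/(val X) -[y]/(val Y) -rmorphM !resE residue_piM.
Qed.
Lemma res0 : res 0 = 0.
Proof. by rewrite -(rmorph0 (val : vring_of w -> K)) resE residue_pi0. Qed.
Lemma res1 : res 1 = 1.
Proof. by rewrite -(rmorph1 (val : vring_of w -> K)) resE residue_pi1. Qed.
Lemma resN x : dv 1 x -> res (- x) = - res x.
Proof.
by move=> h; apply/eqP; rewrite -addr_eq0 -resD ?dvNr // addNr res0.
Qed.
Lemma resB x y : dv 1 x -> dv 1 y -> res (x - y) = res x - res y.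
Proof. by move=> hx hy; rewrite resD ?dvNr ?resN. Qed.
Lemma res_eq0 x : dv 1 x -> (res x == 0) = sdv 1 x.
Proof.
rewrite dv1 => hx; pose X := VringOf hx.
rewrite -[x]/(val X) resE -residue_pi0 residue_pi_eq subr0 /sdv /dv oner_eq0 /=.
rewrite !inE /=; have [->|x0 /=] := eqVneq x 0; first by [].
by rewrite div1r invr_eq0 (negPf x0) /= valuationV // vgroup_oppr_ge0 vgroup_leNgt negbK.
Qed.
Lemma eqv1_res x : eqv 1 x -> res x != 0.
Proof. by move=> /andP[h1 h2]; rewrite res_eq0 // /sdv h2. Qed.
Lemma res_neq0 x : res x != 0 -> eqv 1 x.
Proof.
have [h|h] := boolP (dv 1 x).
  by rewrite res_eq0 // /eqv h => /negPn.
rewrite /res /insubd insubN ?residue_pi0 ?eqxx //; by rewrite -dv1.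
Qed.
Lemma resX x n : dv 1 x -> res (x ^+ n) = res x ^+ n.
Proof.
move=> h; elim: n => [|n IHn]; first by rewrite !expr0 res1.
by rewrite !exprS resM ?IHn // -[X in dv X _](expr1n _ n) dvX.
Qed.
Lemma resV x : eqv 1 x -> res x^-1 = (res x)^-1.
Proof.
move=> h; have rx := eqv1_res h; apply: (mulfI rx).
have x0 : x != 0 by rewrite -(eqv_neq0 h) oner_neq0.
rewrite mulfV // -resM ?mulfV ?res1 //; first by case/andP: h.
by have /andP[] := eqvV h; rewrite invr1.
Qed.
Lemma res_div x y : dv 1 x -> eqv 1 y -> res (x / y) = res x / res y.
Proof.
move=> hx hy; rewrite resM ?resV //.
by have /andP[] := eqvV hy; rewrite invr1.
Qed.
Lemma res_sum (I : Type) (r : seq I) (P : pred I) (F : I -> K) :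
  (forall i, P i -> dv 1 (F i)) ->
  res (\sum_(i <- r | P i) F i) = \sum_(i <- r | P i) res (F i).
Proof.
move=> h; elim: r => [|i r IHr]; first by rewrite !big_nil res0.
rewrite !big_cons; case: ifP => // Pi; rewrite resD ?IHr ?h //.
exact: dv_sum.
Qed.
Lemma res_sim x y : sim x y -> dv 1 x -> res x = res y.
Proof.
move=> xy hx; have hy : dv 1 y by rewrite -(sim_dvr _ xy).
apply/eqP; rewrite -subr_eq0 -resB // res_eq0 ?dvB //.
exact: dv_sdv_trans hx xy.
Qed.

Lemma eqv1M x y : eqv 1 x -> eqv 1 y -> eqv 1 (x * y).
Proof. by move=> hx hy; rewrite -[X in eqv X _]mulr1 eqvM. Qed.
Lemma eqv1V x : eqv 1 x -> eqv 1 x^-1.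
Proof. by move=> hx; rewrite -[X in eqv X _]invr1 eqvV. Qed.
Lemma eqv1X x n : eqv 1 x -> eqv 1 (x ^+ n).
Proof. by move=> hx; rewrite -[X in eqv X _](expr1n _ n) eqvX. Qed.
Lemma eqv1_neq0 x : eqv 1 x -> x != 0.
Proof. by move=> h; rewrite -(eqv_neq0 h) oner_neq0. Qed.

End Divisibility.

Definition resmap (E K : fieldType) (iota : {rmorphism E -> K})
  (v : valuation E) (w : extension iota v) :
  {rmorphism resfield v -> resfield w} := residue_map w.

Lemma resmap_res (E K : fieldType) (iota : {rmorphism E -> K})
  (v : valuation E) (w : extension iota v) a :
  dv v 1 a -> res w (iota a) = resmap w (res v a).
Proof.
rewrite dv1 => ha; pose A := VringOf ha.
by rewrite -[a in RHS]/(val A) resE [RHS]residue_map_pi -resE.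
Qed.

Lemma ruled_resmap (E K : fieldType) (iota : {rmorphism E -> K})
  (v : valuation E) (w : extension iota v) :
  ruled (resmap w) -> ruled (residue_map w).
Proof. by []. Qed.

Lemma transcendental_resmap (E K : fieldType) (iota : {rmorphism E -> K})
  (v : valuation E) (w : extension iota v) :
  transcendental_ext (residue_map w) -> transcendental_ext (resmap w).
Proof. by []. Qed.

Lemma residue_natr (K : fieldType) (w : valuation K) n :
  (n%:R == 0 :> residue w) = sdv w 1 n%:R.
Proof.
have dn m : dv w 1 m%:R by rewrite dv1; exact: rpred_nat.
rewrite -res_eq0 //; congr (_ == _).
by elim: n => [|n IHn]; rewrite ?res0 // -[n.+1]addn1 !natrD IHn resD ?res1 // -(mulr1n 1).
Qed.

Global Opaque dv sdv eqv sim res resfield resmap.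

(** * Good elements *)

HB.lock Definition algov (k K : fieldType) (rho : {rmorphism k -> K}) (u : K)
  : Prop := algebraicOver rho u.

Section Algebraic.
Variables (k K : fieldType) (rho : {rmorphism k -> K}).
Local Notation alg := (algov rho).

Lemma algP u : alg u <-> algebraicOver rho u.
Proof. by rewrite algov.unlock. Qed.

Lemma alg_id a : alg (rho a). Proof. exact/algP/algebraic_id. Qed.
Lemma alg0 : alg 0. Proof. exact/algP/algebraic0. Qed.
Lemma alg1 : alg 1. Proof. exact/algP/algebraic1. Qed.
Lemma algD x y : alg x -> alg y -> alg (x + y).
Proof. by move=> /algP hx /algP hy; exact/algP/algebraic_add. Qed.
Lemma algB x y : alg x -> alg y -> alg (x - y).
Proof. by move=> /algP hx /algP hy; exact/algP/algebraic_sub. Qed.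
Lemma algM x y : alg x -> alg y -> alg (x * y).
Proof. by move=> /algP hx /algP hy; exact/algP/algebraic_mul. Qed.
Lemma algV x : alg x -> alg x^-1.
Proof. by move=> /algP hx; exact/algP/algebraic_inv. Qed.

Lemma algX x n : alg x -> alg (x ^+ n).
Proof.
move=> h; elim: n => [|n IHn]; first by rewrite expr0; exact: alg1.
by rewrite exprS; exact: algM.
Qed.

Lemma alg_root_poly (p : {poly K}) u : p != 0 -> root p u ->
  (forall i, alg p`_i) -> alg u.
Proof.
move=> p0 pu h; apply/algP/integral_algebraic; apply: integral_root p0 pu _.
by move=> x /(nthP 0)[i _ <-]; apply/integral_algebraic/algP.
Qed.

Lemma alg_unX x n : (0 < n)%N -> alg (x ^+ n) -> alg x.
Proof.
move=> n0 h; apply: (@alg_root_poly ('X^n - (x ^+ n)%:P)).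
- by rewrite -size_poly_gt0 size_XnsubC.
- by rewrite rootE !hornerE subrr.
move=> i; rewrite coefB coefXn coefC; apply: algB.
  by case: (_ == _); [exact: alg1|exact: alg0].
by case: ifP => // _; exact: alg0.
Qed.

End Algebraic.

Section ValueIndex.
Variables (K : fieldType) (w : valuation K).
Variables (M : K -> Prop) (M1 : M 1).
Hypothesis MM : forall x y, M x -> M y -> M (x * y).
Hypothesis MV : forall x, M x -> M x^-1.
Hypothesis M_neq0 : forall x, M x -> x != 0.

Lemma closed_exprz x (i : int) : M x -> M (x ^ i).
Proof.
move=> Mx; have h n : M (x ^+ n).
  by elim: n => [|n IHn]; rewrite ?expr0 // exprS; exact: MM.
by case: i => n; [exact: h|exact/MV/h].
Qed.

(* e generates the group of the exponents i for which w (Z ^ i) lies in w M; it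
   is 0 if that group is trivial. *)
Lemma value_index (Z : K) : Z != 0 -> exists (e : nat) (g : K),
  [/\ M g, eqv w g (Z ^+ e) &
      forall (i : int) m, M m -> eqv w 1 (m * Z ^ i) -> (e %| i)%Z].
Proof.
move=> Z0.
have pos (i : int) m : M m -> eqv w 1 (m * Z ^ i) ->
    exists2 g, M g & eqv w g (Z ^+ `|i|).
  move=> Mm; have m0 := M_neq0 Mm; case: i => n h.
    exists m^-1; first exact: MV.
    by rewrite -(eqvM2l w _ _ m0) mulfV.
  exists m => //; have Zn0 : Z ^- n.+1 != 0 by rewrite invr_eq0 expf_neq0.
  rewrite -(eqvM2l w _ _ Zn0) mulVf ?expf_neq0 //.
  by rewrite mulrC eqv_sym.
have [ex|none] :=
    EM (exists e, (0 < e)%N && `[< exists2 g, M g & eqv w g (Z ^+ e) >]).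
  have [e /andP[e_gt0 /asboolP[g Mg hg]] min_e] := ex_minnP ex.
  exists e, g; split=> // i m Mm him.
  have e0' : e%:Z != 0 by rewrite eqz_nat -lt0n.
  have r_ge0 := modz_ge0 i e0'.
  have r_lt : ((i %% e)%Z < e%:Z) by rewrite ltz_pmod.
  case er : (i %% e)%Z r_ge0 r_lt => [r|//] _ r_lt.
  have [g' Mg' hg'] : exists2 g', M g' & eqv w g' (Z ^+ r).
    apply: (pos r (m * g ^ (i %/ e)%Z)); first exact/MM/closed_exprz.
    apply: eqv_trans him _; rewrite {1}(divz_eq i e) er expfzDr // -mulrA.
    rewrite eqvM2l ?M_neq0 // mulrC [X in eqv _ _ X]mulrC eqvM2l ?expfz_neq0 //.
    rewrite mulrC -exprz_exp; rewrite eqv_sym in hg.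
    case: (i %/ e)%Z => q; first by rewrite -!exprnP eqvX.
    by rewrite !NegzE -!exprnN eqvV ?eqvX.
  have [r0|r0] := posnP r; first by apply/dvdz_mod0P; rewrite er r0.
  have : (e <= r)%N by apply: min_e; rewrite r0; apply/asboolP; exists g'.
  by rewrite leqNgt; have -> : (r < e)%N by [].
exists 0%N, 1; split=> // [|i m Mm him]; first by rewrite expr0 eqv_refl.
rewrite dvd0z; apply/negPn/negP => i0; apply: none; exists `|i|%N.
by rewrite absz_gt0 i0; apply/asboolP; exact: pos him.
Qed.

End ValueIndex.

Section Good.
Variables (E K : fieldType) (iota : {rmorphism E -> K}) (v : valuation E).
Variable w : extension iota v.
Implicit Types x y z : K.

Lemma dv_iota a b : dv w (iota a) (iota b) = dv v a b.
Proof. by rewrite !dvE !fmorph_eq0 -fmorph_div extension_vring. Qed.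

Lemma alg_res_iota a : algov (resmap w) (res w (iota a)).
Proof.
have [h|h] := boolP (dv v 1 a); first by rewrite resmap_res //; exact: alg_id.
have [->|/res_neq0/eqv_dv] := eqVneq (res w (iota a)) 0; first exact: alg0.
by rewrite -{1}(rmorph1 iota) dv_iota (negPf h).
Qed.

Local Notation dv := (dv w).
Local Notation sdv := (sdv w).
Local Notation eqv := (eqv w).
Local Notation sim := (sim w).
Local Notation res := (res w).
Local Notation rho := (resmap w).
Local Notation alg := (algov rho).

(* [good x]: w x is torsion modulo vE and the residue attached to x is
   algebraic over Ev. *)
Definition good x := x != 0 /\ exists N a,
  [/\ (0 < N)%N, a != 0, eqv 1 (x ^+ N / iota a) & alg (res (x ^+ N / iota a))].

Lemma good_neq0 x : good x -> x != 0. Proof. by case. Qed.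

Lemma good_iota a : a != 0 -> good (iota a).
Proof.
move=> a0; split; first by rewrite fmorph_eq0.
exists 1%N, a; rewrite expr1 mulfV ?fmorph_eq0 // eqv_refl res1.
by split=> //; exact: alg1.
Qed.

Lemma good1 : good 1.
Proof. by rewrite -(rmorph1 iota); apply: good_iota; exact: oner_neq0. Qed.

Lemma goodM x y : good x -> good y -> good (x * y).
Proof.
move=> [x0 [N [a [N0 a0 xa hx]]]] [y0 [N' [b [N'0 b0 yb hy]]]].
split; first exact: mulf_neq0.
exists (N * N')%N, (a ^+ N' * b ^+ N).
have -> : (x * y) ^+ (N * N') / iota (a ^+ N' * b ^+ N) =
    (x ^+ N / iota a) ^+ N' * (y ^+ N' / iota b) ^+ N.
  by rewrite !expr_div_n -!exprM [(N' * N)%N]mulnC rmorphM !rmorphXn exprMn mulf_div.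
split.
- by rewrite muln_gt0 N0.
- by rewrite mulf_neq0 ?expf_neq0.
- by rewrite eqv1M ?eqv1X.
have /andP[xa' _] := eqv1X N' xa; have /andP[yb' _] := eqv1X N yb.
rewrite resM // !resX; [|by case/andP: yb|by case/andP: xa].
by apply: algM; exact: algX.
Qed.

Lemma goodV x : good x -> good x^-1.
Proof.
move=> [x0 [N [a [N0 a0 xa hx]]]]; split; first by rewrite invr_eq0.
exists N, a^-1; have -> : x^-1 ^+ N / iota a^-1 = (x ^+ N / iota a)^-1.
  by rewrite invf_div fmorphV invrK exprVn mulrC.
by rewrite invr_eq0 a0 eqv1V // resV //; split=> //; exact: algV.
Qed.

Lemma good_div x y : good x -> good y -> good (x / y).
Proof. by move=> gx gy; apply: goodM => //; exact: goodV. Qed.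

Lemma goodX x n : good x -> good (x ^+ n).
Proof.
move=> h; elim: n => [|n IHn]; first by rewrite expr0; exact: good1.
by rewrite exprS; exact: goodM.
Qed.

Lemma good_unX x n : (0 < n)%N -> good (x ^+ n) -> good x.
Proof.
move=> n0 [xn0 [N [a [N0 a0 xa hx]]]].
split; first by move: xn0; rewrite expf_eq0 n0.
by exists (n * N)%N, a; rewrite exprM muln_gt0 n0 N0.
Qed.

Lemma good_alg x : good x -> dv 1 x -> alg (res x).
Proof.
move=> [x0 [N [a [N0 a0 xa hx]]]] h.
have [->|/res_neq0 ux] := eqVneq (res x) 0; first exact: alg0.
have ia0 : iota a != 0 by rewrite fmorph_eq0.
have ua : eqv 1 (iota a).
  have -> : iota a = x ^+ N / (x ^+ N / iota a).
    by rewrite invf_div mulrC divfK ?expf_neq0.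
  by apply: eqv1M; [exact: eqv1X|exact: eqv1V].
apply: (alg_unX N0); rewrite -resX //.
have -> : x ^+ N = (x ^+ N / iota a) * iota a by rewrite divfK.
rewrite resM; first exact: algM (alg_res_iota a).
  by case/andP: xa.
by case/andP: ua.
Qed.

Lemma alg_good x : eqv 1 x -> alg (res x) -> good x.
Proof.
move=> ux h; split; first exact: eqv1_neq0 ux.
by exists 1%N, 1; rewrite rmorph1 divr1 expr1 oner_neq0.
Qed.

Lemma sim_good x y : sim x y -> good x -> good y.
Proof.
move=> xy gx; have x0 := good_neq0 gx; have y0 := sim_neq0r xy.
have h : sim 1 (y / x).
  have := simM xy (sim_refl w (_ : x^-1 != 0)); rewrite mulfV // invr_eq0; exact.
rewrite -[y](divfK x0); apply: goodM => //; apply: alg_good; first exact: sim_eqv.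
by rewrite -(res_sim h (dv_refl _ _)) res1; exact: alg1.
Qed.

Lemma goodN x : good x -> good (- x).
Proof.
move=> h; rewrite -mulN1r; apply: goodM => //.
by rewrite -(rmorphN1 iota); apply: good_iota; rewrite oppr_eq0 oner_eq0.
Qed.

(** Good elements are not closed under subtraction: when the leading terms cancel, nothing is known
    about the difference. That is the third alternative. Otherwise x - y is equivalent to x or - y,
    or is x times 1 - y / x, whose residue is algebraic and nonzero. *)
Lemma good_sub x y : good x -> good y -> [\/ good (x - y), x = y | sim x y].
Proof.
move=> gx gy; have x0 := good_neq0 gx; have y0 := good_neq0 gy.
have [h|h] := boolP (eqv x y); last first.
  constructor 1; case/orP: (eqvN h) => h'.
    by apply: sim_good gx; apply/sim_sym/sim_add; rewrite sdvNr.
  apply: sim_good (goodN gy); apply: sim_sym; rewrite addrC.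
  by apply: sim_add; rewrite sdvNl.
have [e|ne] := eqVneq x y; first by constructor 2.
have [h'|h'] := boolP (sdv x (x - y)); first by constructor 3; rewrite simE.
constructor 1; move/sdvN: h' => h'.
have xyx : eqv x (x - y).
  by rewrite eqvE h' dvB ?dv_refl //; case/andP: h.
rewrite -[x - y](divfK x0); apply: (goodM _ gx); apply: alg_good.
  by rewrite eqv1_div // eqv_sym.
have uyx : eqv 1 (y / x) by rewrite eqv1_div // eqv_sym.
rewrite mulrBl mulfV // resB ?dv_refl //; last by case/andP: uyx.
rewrite res1; apply: algB; first exact: alg1.
by apply: (good_alg (good_div gy gx)); case/andP: uyx.
Qed.

(** The terms of least value cannot cancel. Divided by one of them, they become algebraic multiples
    of powers of t = Z ^ e / g, where e is the index of the value of Z modulo the values of good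
    elements. A cancellation would be an algebraic equation for the residue of t; then Z ^ e, hence
    Z, would be good. *)
Lemma gauss Z n (c : 'I_n -> K) : Z != 0 -> ~ good Z ->
    (forall i, c i = 0 \/ good (c i)) ->
  forall k, dv (\sum_(i < n) c i * Z ^+ i) (c k * Z ^+ k).
Proof.
move=> Z0 nZ hc; set F := fun i : 'I_n => c i * Z ^+ i; set s := \sum_i _.
have [[i0 Fi0]|none] := EM (exists i, F i != 0); last first.
  by move=> k; have [->|h] := eqVneq (c k * Z ^+ k) 0; [exact: dv0|case: none; exists k].
have [k1 Fk1 min1] := dv_min w (ex_intro (fun i => F i != 0) i0 Fi0).
suff : dv s (F k1) by move=> h k; exact: dv_trans h (min1 k).
apply/negPn/negP => hs; have {}hs : sdv (F k1) s by [].
(* The least index among the terms of least value: all exponents relative to it are nonnegative, and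
   the equation for t gets constant coefficient 1. *)
pose k0 := [arg min_(i < k1 | eqv (F k1) (F i)) (i : nat)]%N.
have [Pk0 mink0] : eqv (F k1) (F k0) /\
    forall i, eqv (F k1) (F i) -> (k0 <= i)%N.
  by rewrite /k0; case: arg_minnP => [|i Pi hi]; rewrite ?eqv_refl.
have Fk0 : F k0 != 0 by rewrite -(eqv_neq0 Pk0).
have ck0 : good (c k0).
  by case: (hc k0) => // e; move: Fk0; rewrite /F e mul0r eqxx.
pose u i := F i / F k0.
have u1 i : dv 1 (u i).
  rewrite -(dvM2r w _ _ Fk0) mul1r divfK //.
  by case/andP: Pk0 => _ h; exact: dv_trans h (min1 i).
have su : \sum_i res (u i) = 0.
  apply/eqP; rewrite -res_sum //; rewrite res_eq0; last exact: dv_sum.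
  rewrite -mulr_suml -(sdvM2r w _ _ Fk0) mul1r divfK //.
  by apply: dv_sdv_trans hs; case/andP: Pk0.
have [e [g [gg hg hi]]] := value_index w good1 goodM goodV good_neq0 Z0.
have g0 := good_neq0 gg.
pose t := Z ^+ e / g; pose q (i : 'I_n) := ((i - k0) %/ e)%N.
pose a i := c i / c k0 * g ^+ q i.
have ut : eqv 1 t by rewrite eqv1_div // eqv_sym.
have key i : eqv 1 (u i) -> [/\ u i = a i * t ^+ q i,
    (k0 <= i)%N & (i - k0 = q i * e)%N].
  move=> ui; have le_k0i : (k0 <= i)%N.
    by apply: mink0; apply: eqv_trans Pk0 _; rewrite eqv_sym -eqv1_div.
  have uE : u i = c i / c k0 * Z ^+ (i - k0).
    rewrite /u /F invfM mulrACA; congr (_ * _).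
    by rewrite -{1}(subnK le_k0i) exprD mulfK // expf_neq0.
  have eE : (i - k0 = q i * e)%N.
    have [e0|ci0] := eqVneq (c i) 0.
      by move: (eqv1_neq0 ui); rewrite uE e0 !mul0r eqxx.
    have : (e %| (i - k0)%N%:Z)%Z.
      apply: (hi _ (c i / c k0)); last by rewrite -exprnP -uE.
      case: (hc i) => [e0|gi]; first by rewrite e0 eqxx in ci0.
      exact: good_div.
    by rewrite dvdzE /= => /divnK.
  split=> //; rewrite uE {1}eE /a /t -[RHS]mulrA; congr (_ * _).
  by rewrite expr_div_n mulrC divfK ?expf_neq0 // mulnC exprM.
(* Terms of larger value have residue 0 and get coefficient 0; for them [q i], formed by truncated
   subtraction and division, has no meaning. *)
pose al i := if eqv 1 (u i) then res (a i) else 0.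
have t1 n' : dv 1 (t ^+ n') by case/andP: (eqv1X n' ut).
have uai i : eqv 1 (u i) -> eqv 1 (a i).
  move=> ui; have [uE _ _] := key i ui.
  have t0 : t ^+ q i != 0 := eqv1_neq0 (eqv1X _ ut).
  by rewrite -[a i](mulfK t0) -uE eqv1M // eqv1V // eqv1X.
have al_alg i : alg (al i).
  rewrite /al; case: ifP => ui; last exact: alg0.
  have := uai i ui => uai'; apply: good_alg; last by case/andP: uai'.
  case: (hc i) => [e0|gi].
    by move: (eqv1_neq0 uai'); rewrite /a e0 !mul0r eqxx.
  by apply: goodM; [exact: good_div|exact: goodX].
have resu i : res (u i) = al i * res t ^+ q i.
  rewrite /al; case: ifP => [ui|ui].
    have [-> _ _] := key i ui; rewrite resM ?resX //.
      by case/andP: ut.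
    by case/andP: (uai i ui).
  by rewrite mul0r; apply/eqP; apply: contraFT ui => /res_neq0.
pose p : {poly resfield w} := \sum_i (al i)%:P * 'X^(q i).
have pt : p.[res t] = 0.
  rewrite -[RHS]su horner_sum; apply: eq_bigr => i _.
  by rewrite resu !hornerE.
have coefp j : p`_j = \sum_i al i * (j == q i)%:R.
  by rewrite coef_sum; apply: eq_bigr => i _; rewrite coefCM coefXn.
have uk0 : u k0 = 1 by rewrite /u mulfV.
have p0 : p`_0 = 1.
  rewrite coefp (bigD1 k0) //= /al uk0 eqv_refl /a /q subnn div0n eqxx mulr1.
  rewrite expr0 mulr1 mulfV ?good_neq0 // res1 big1 ?addr0 // => i ik0.
  case: ifP => [ui|]; last by rewrite mul0r.
  have [_ le_k0i eE] := key i ui; case: eqP => [qi|]; last by rewrite mulr0.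
  move: eE; rewrite /q -qi mul0n => /eqP; rewrite subn_eq0 => le_ik0.
  by case/eqP: ik0; apply/val_inj/anti_leq; rewrite le_k0i le_ik0.
have pn0 : p != 0 by apply/eqP => e0; move: p0; rewrite e0 coef0 => /esym/eqP; rewrite oner_eq0.
(* If e = 0, division by zero makes every [q i] equal to 0, and p is the constant 1, which has no
   root. *)
have [e0|e_gt0] := posnP e.
  have : p = 1.
    apply/polyP => -[|j]; rewrite coef1 ?p0 // coefp big1 // => i _.
    by rewrite /q e0 divn0 mulr0.
  by move=> p1; move: pt; rewrite p1 hornerC => /eqP; rewrite oner_eq0.
apply: nZ; apply: (good_unX e_gt0).
rewrite -[Z ^+ e](divfK g0); apply: goodM gg; apply: alg_good => //.
apply: alg_root_poly pn0 _ _; first by rewrite rootE pt.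
move=> j; rewrite coefp; elim/big_ind: _ => [|x y hx hy|i _].
- exact: alg0.
- exact: algD.
by case: (_ == _); rewrite ?mulr1 // mulr0; exact: alg0.
Qed.

(** Replacing c_0 by c_0 - s turns the sum into 0; if c_0 - s is again zero or good, [gauss] forces
    c_0 = s. The only other case of [good_sub] is the conclusion. *)
Lemma gauss_good Z n (c : 'I_n.+1 -> K) : Z != 0 -> ~ good Z ->
    (forall i, c i = 0 \/ good (c i)) ->
  good (\sum_i c i * Z ^+ i) -> sim (\sum_i c i * Z ^+ i) (c ord0).
Proof.
move=> Z0 nZ hc gs; set s := \sum_i _ in gs *; have s0 := good_neq0 gs.
have cancel : c ord0 - s = 0 \/ good (c ord0 - s) -> sim s (c ord0).
  move=> h0; pose c' i := if i == ord0 then c ord0 - s else c i.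
  have s'0 : \sum_i c' i * Z ^+ i = 0.
    rewrite big_ord_recl /c' eqxx expr0 mulr1 /=.
    rewrite /s big_ord_recl expr0 mulr1 opprD addNKr; apply/eqP.
    by rewrite addrC subr_eq0; apply/eqP.
  have := gauss Z0 nZ (_ : forall i, c' i = 0 \/ good (c' i)) ord0.
  rewrite s'0 dv0l /c' eqxx expr0 mulr1 subr_eq0 => h.
  have /eqP-> : c ord0 == s by apply: h => i; case: ifP.
  exact: sim_refl.
case: (hc ord0) => [e|g0]; first by apply: cancel; right; rewrite e sub0r; exact: goodN.
case: (good_sub g0 gs) => [g|e|h]; last exact: sim_sym.
  by apply: cancel; right.
by apply: cancel; left; rewrite e subrr.
Qed.

End Good.

(** * Key polynomials *)

(** Subfields as predicates. Quantifying over all such [D] says that an element lies in the subfield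
    generated by given ones, without constructing it. *)
Definition fld (K : fieldType) (D : K -> Prop) :=
  [/\ D 1, forall x y, D x -> D y -> D (x - y)
         & forall x y, D x -> D y -> D (x / y)].

Section Fld.
Variables (K : fieldType) (D : K -> Prop).
Hypothesis fD : fld D.

Lemma fld1 : D 1. Proof. by case: fD. Qed.
Lemma fldB x y : D x -> D y -> D (x - y). Proof. by case: fD => _ h _; exact: h. Qed.
Lemma fld_div x y : D x -> D y -> D (x / y). Proof. by case: fD => _ _; exact. Qed.
Lemma fld0 : D 0. Proof. by rewrite -(subrr 1); apply: fldB; exact: fld1. Qed.
Lemma fldN x : D x -> D (- x).
Proof. by move=> h; rewrite -sub0r; apply: fldB => //; exact: fld0. Qed.
Lemma fldD x y : D x -> D y -> D (x + y).
Proof. by move=> hx hy; rewrite -[y]opprK; apply: fldB => //; exact: fldN. Qed.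
Lemma fldV x : D x -> D x^-1.
Proof. by move=> h; rewrite -div1r; apply: fld_div => //; exact: fld1. Qed.
Lemma fldM x y : D x -> D y -> D (x * y).
Proof. by move=> hx hy; rewrite -[y]invrK; apply: fld_div => //; exact: fldV. Qed.
Lemma fldX x n : D x -> D (x ^+ n).
Proof.
move=> h; elim: n => [|n IHn]; first by rewrite expr0; exact: fld1.
by rewrite exprS; exact: fldM.
Qed.
Lemma fldXz x (i : int) : D x -> D (x ^ i).
Proof. by move=> h; case: i => n; [exact: fldX|exact/fldV/fldX]. Qed.
Lemma fld_sum (I : Type) (r : seq I) (P : pred I) (F : I -> K) :
  (forall i, P i -> D (F i)) -> D (\sum_(i <- r | P i) F i).
Proof. by move=> h; elim/big_ind: _ => //; [exact: fld0|exact: fldD]. Qed.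

End Fld.

Lemma size_quotient_lt a b c : (0 < a -> 0 < b -> a < c -> b < c ->
  (a + b).-1 - c.-1 < c)%N.
Proof. lia. Qed.

Lemma size_divp_lt a b n : (a < n.+1 -> b <= a -> 1 < b -> a - b.-1 < n)%N.
Proof. lia. Qed.

Lemma div_frac6 (K : fieldType) (a b c d e f : K) :
  a / b / (c / d * (e / f)) = a / (c * e) / (b / (d * f)).
Proof. by rewrite !invfM !invrK; ring. Qed.

Section KeyPolynomial.
Variables (E K : fieldType) (iota : {rmorphism E -> K}) (v : valuation E).
Variable w : extension iota v.
Variable ev : {rmorphism {poly E} -> K}.
Hypothesis ev_inj : forall p : {poly E}, p != 0 -> ev p != 0.
Hypothesis evC : forall a : E, ev a%:P = iota a.

Local Notation dv := (dv w).
Local Notation sdv := (sdv w).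
Local Notation eqv := (eqv w).
Local Notation sim := (sim w).
Local Notation res := (res w).
Local Notation good := (@good _ _ _ _ w).
Local Notation alg := (algov (resmap w)).

Lemma ev_eq0 p : (ev p == 0) = (p == 0).
Proof.
have [->|/ev_inj/negbTE //] := eqVneq p 0; by rewrite rmorph0 eqxx.
Qed.

Definition evfrac y := exists p q : {poly E}, q != 0 /\ y = ev p / ev q.

Lemma evfrac_ev p : evfrac (ev p).
Proof. by exists p, 1; rewrite oner_neq0 rmorph1 divr1. Qed.

Lemma evfrac_fld : fld evfrac.
Proof.
split=> [|x y [p [q [q0 ->]]] [p' [q' [q'0 ->]]]|x y [p [q [q0 ->]]] [p' [q' [q'0 ->]]]].
- by rewrite -(rmorph1 ev); exact: evfrac_ev.
- exists (p * q' - p' * q), (q * q'); rewrite mulf_neq0 //.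
  by rewrite rmorphB !rmorphM -[- (_ / _)]mulNr addf_div ?ev_inj // mulNr.
have [->|p'0] := eqVneq p' 0.
  by rewrite rmorph0 mul0r invr0 mulr0 -(rmorph0 ev); exact: evfrac_ev.
exists (p * q'), (q * p'); rewrite mulf_neq0 //.
by rewrite !rmorphM invf_div mulf_div.
Qed.

Variable P : {poly E}.
Hypothesis P_bad : ~ good (ev P).
Hypothesis P_min : forall A : {poly E}, A != 0 -> (size A < size P)%N -> good (ev A).

Local Notation Z := (ev P).

Hypothesis P0 : P != 0.

Lemma key_neq0 : Z != 0. Proof. exact: ev_inj. Qed.

Lemma key_size : (1 < size P)%N.
Proof.
rewrite ltnNge; apply/negP => /size1_polyC eP; apply: P_bad.
rewrite eP evC; apply: good_iota; apply: contraNneq P0 => e.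
by rewrite eP e polyC0.
Qed.

Lemma padic (h : {poly E}) : exists s : seq {poly E},
  (forall i, (size (s`_i)%R < size P)%N) /\ h = \sum_(i < size s) s`_i * P ^+ i.
Proof.
have [n] := ubnP (size h); elim: n h => // n IHn h hn.
have [h0|hP] := ltnP (size h) (size P).
  exists [:: h]; split=> [[|i]|]; rewrite ?nth_nil ?size_poly0 ?size_poly_gt0 //=.
    by rewrite nth_nil size_poly0 size_poly_gt0.
  by rewrite big_ord1 expr0 mulr1.
have [|s [hs e]] := IHn (h %/ P).
  by rewrite size_divp //; exact: size_divp_lt hn hP key_size.
exists ((h %% P) :: s); split=> [[|i] //=|]; first by rewrite ltn_modp.
rewrite big_ord_recl /= expr0 mulr1 addrC {1}(divp_eq h P) {1}e; congr (_ + _).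
by rewrite mulr_suml; apply: eq_bigr => i _; rewrite exprSr mulrA.
Qed.

Lemma small_good_or0 (A : {poly E}) : (size A < size P)%N -> ev A = 0 \/ good (ev A).
Proof.
by move=> h; have [->|A0] := eqVneq A 0; [left; rewrite rmorph0|right; exact: P_min].
Qed.

Lemma gauss_padic (s : seq {poly E}) (k : 'I_(size s)) :
  (forall i, (size (s`_i)%R < size P)%N) ->
  dv (ev (\sum_(i < size s) s`_i * P ^+ i)) (ev s`_k * Z ^+ k).
Proof.
move=> hs; rewrite rmorph_sum /=.
rewrite (eq_bigr (fun i : 'I_(size s) => ev s`_i * Z ^+ i)); last first.
  by move=> i _; rewrite rmorphM rmorphXn.
apply: (gauss (c := fun i : 'I_(size s) => ev s`_i)) => //; first exact: key_neq0.
by move=> i; exact: small_good_or0.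
Qed.

(** Expanding q in powers of P makes [ev R] the constant term of an expansion in powers of Z. Its
    being zero or good is what [gauss] asks for, whatever the degree of R. *)
Lemma gauss_divp (q R : {poly E}) : ev R = 0 \/ good (ev R) ->
  dv (ev (q * P + R)) (ev q * Z) /\ dv (ev (q * P + R)) (ev R).
Proof.
move=> hR; have [s [hs e]] := padic q.
pose c (i : 'I_(size s).+1) := ev (R :: s)`_i.
have key : ev (q * P + R) = \sum_(i < (size s).+1) c i * Z ^+ i.
  rewrite big_ord_recl /c /= expr0 mulr1 rmorphD addrC; congr (_ + _).
  rewrite rmorphM {1}e rmorph_sum mulr_suml; apply: eq_bigr => i _.
  by rewrite rmorphM rmorphXn exprSr mulrA.
have h k : dv (ev (q * P + R)) (c k * Z ^+ k).
  rewrite key; apply: gauss => // [|i]; first exact: key_neq0.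
  by rewrite /c; case: i => -[//|i] /= _; exact: small_good_or0.
split; last by have := h ord0; rewrite expr0 mulr1.
rewrite {2}e rmorph_sum mulr_suml; apply: dv_sum => i _.
have := h (lift ord0 i); rewrite /c /=.
by rewrite rmorphM rmorphXn exprSr mulrA.
Qed.

Definition small (A : {poly E}) := (A != 0) && (size A < size P)%N.

Lemma small_neq0 A : small A -> ev A != 0.
Proof. by move=> /andP[A0 _]; exact: ev_inj. Qed.
Lemma small_good A : small A -> good (ev A).
Proof. by move=> /andP[A0 hA]; exact: P_min. Qed.
Lemma small1 : small 1.
Proof. by rewrite /small oner_neq0 size_poly1 key_size. Qed.
Lemma smallZ a A : a != 0 -> small A -> small (a *: A).
Proof. by move=> a0 /andP[A0 hA]; rewrite /small scaler_eq0 negb_or a0 A0 size_scale. Qed.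

(** Reduction modulo P brings the degree of A B down again. It changes neither value nor leading
    term, because the multiple of P that is dropped is negligible. *)
Lemma smallM A B : small A -> small B ->
  exists2 C, small C & sim (ev A * ev B) (ev C).
Proof.
move=> sA sB; have [A0 hA] := andP sA; have [B0 hB] := andP sB.
set AB := A * B; have AB0 : AB != 0 by rewrite mulf_neq0.
pose R := AB %% P; pose q := AB %/ P.
have eAB : AB = q * P + R := divp_eq _ _.
have hR : ev R = 0 \/ good (ev R) by apply: small_good_or0; rewrite ltn_modp.
have [hq hR'] := gauss_divp q hR; rewrite -eAB in hq hR'.
have evAB0 := ev_inj AB0.
have gAB : good (ev AB) by rewrite rmorphM; apply: goodM; exact: P_min.
have [lt|ge] := boolP (sdv (ev AB) (ev q * Z)).
  have sABR : sim (ev AB) (ev R).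
    have -> : ev R = ev AB - ev q * Z by rewrite eAB rmorphD rmorphM addrC addKr.
    by rewrite simE subKr.
  exists R; last by rewrite -rmorphM.
  rewrite /small ltn_modp P0 andbT -ev_eq0; exact: sim_neq0r sABR.
have {ge} eq1 : eqv (ev AB) (ev q * Z) by rewrite eqvE hq; exact: sdvN ge.
have qZ0 : ev q * Z != 0 by rewrite -(eqv_neq0 eq1).
have q0 : q != 0 by apply: contraNneq qZ0 => ->; rewrite rmorph0 mul0r.
have hsq : (size q < size P)%N.
  rewrite /q size_divp // size_mul //.
  by apply: size_quotient_lt; rewrite ?size_poly_gt0.
(* Otherwise the residue of q P / (A B), which is 1 minus that of R / (A B),
   would be algebraic and P would be good. *)
pose x := ev q * Z / ev AB.
have ux : eqv 1 x by rewrite eqv1_div // eqv_sym.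
have xE : x = 1 - ev R / ev AB.
  by rewrite /x -rmorphM -[q * P](addrK R) -eAB rmorphB mulrBl mulfV.
have hRAB : dv 1 (ev R / ev AB).
  by rewrite -(dvM2r w _ _ evAB0) mul1r divfK.
have gx : good x.
  apply: alg_good => //; rewrite xE resB ?dv_refl // res1.
  apply: algB; first exact: alg1.
  case: hR => [->|gR]; first by rewrite mul0r res0; exact: alg0.
  exact: good_alg (good_div gR gAB) hRAB.
case: P_bad; have -> : Z = x * ev AB / ev q.
  by rewrite /x divfK // mulrC mulKf // ev_inj.
by apply: good_div; [exact: goodM|exact: P_min].
Qed.

Lemma smallX B n : small B -> exists2 C, small C & sim (ev B ^+ n) (ev C).
Proof.
move=> sB; elim: n => [|n [C sC hC]].
  by exists 1; [exact: small1|rewrite expr0 rmorph1 sim_refl ?oner_neq0].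
have [C' sC' hC'] := smallM sB sC; exists C' => //; rewrite exprS.
by apply: sim_trans hC'; rewrite simM ?sim_refl ?small_neq0.
Qed.

(** By [smallM] these elements form a multiplicative group; they are the constants against which
    powers of Z are measured. *)
Definition lowfrac y := exists A B : {poly E}, [/\ small A, small B & sim y (ev A / ev B)].

Lemma lowfrac_sim y z : sim y z -> lowfrac y -> lowfrac z.
Proof.
move=> yz [A [B [sA sB h]]]; exists A, B; split=> //.
exact: sim_trans (sim_sym yz) h.
Qed.
Lemma lowfrac_small A : small A -> lowfrac (ev A).
Proof.
move=> sA; exists A, 1; split=> //; first exact: small1.
by rewrite rmorph1 divr1 sim_refl ?small_neq0.
Qed.
Lemma lowfrac1 : lowfrac 1.
Proof. by rewrite -(rmorph1 ev); apply: lowfrac_small; exact: small1. Qed.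
Lemma lowfracV y : lowfrac y -> lowfrac y^-1.
Proof.
by move=> [A [B [sA sB h]]]; exists B, A; split=> //; rewrite -invf_div simV.
Qed.
Lemma lowfracM y z : lowfrac y -> lowfrac z -> lowfrac (y * z).
Proof.
move=> [A [B [sA sB h]]] [A' [B' [sA' sB' h']]].
have [C sC hC] := smallM sA sA'; have [D sD hD] := smallM sB sB'.
exists C, D; split=> //; apply: sim_trans (simM h h') _.
by rewrite mulf_div simM ?simV.
Qed.
Lemma lowfrac_neq0 y : lowfrac y -> y != 0.
Proof. by move=> [A [B [_ _ h]]]; exact: sim_neq0 h. Qed.
Lemma lowfrac_good y : lowfrac y -> good y.
Proof.
move=> [A [B [sA sB h]]]; apply: sim_good (sim_sym h) _.
by apply: good_div; exact: small_good.
Qed.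
Lemma lowfrac_iota a : a != 0 -> lowfrac (iota a).
Proof.
move=> a0; rewrite -evC; apply: lowfrac_small.
by rewrite /small polyC_eq0 a0 size_polyC a0 key_size.
Qed.

Definition lowres z := exists A : {poly E}, [/\ (size A < size P)%N, dv 1 (ev A) & z = res (ev A)].

Lemma lowres_alg z : lowres z -> alg z.
Proof.
move=> [A [hA dA ->]]; case: (small_good_or0 hA) => [->|gA]; last exact: good_alg.
by rewrite res0; exact: alg0.
Qed.

(** In A / B neither A nor B need be a unit. Multiplying both by B ^ (N - 1), where the value of B ^
    N is that of some a in E, and dividing both by a gives a quotient of two units, each equivalent
    to a polynomial of degree below that of P. *)
Lemma lowfrac_res D y : fld D -> (forall z, lowres z -> D z) ->
  lowfrac y -> eqv 1 y -> D (res y).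
Proof.
move=> fD hD [A [B [sA sB h]]] uy.
have B0 := small_neq0 sB.
have [_ [N [a [N0 a0 ua _]]]] := small_good sB.
have [C sC hC] := smallX N sB.
have [B1 sB1 hB1] := smallX N.-1 sB.
have [A1 sA1 hA1] := smallM sA sB1.
have evZ (b : E) H : ev (b *: H) = iota b * ev H.
  by rewrite -mul_polyC rmorphM /= evC.
have e : sim y (ev (a^-1 *: A1) / ev (a^-1 *: C)).
  rewrite !evZ -mulf_div mulfV ?mul1r; last by rewrite fmorph_eq0 invr_eq0.
  apply: sim_trans h _.
  have -> : ev A / ev B = (ev A * ev B ^+ N.-1) / ev B ^+ N.
    rewrite -{2}(prednK N0) exprS invfM mulrACA mulfV ?mulr1 //.
    exact: expf_neq0.
  by apply: simM; [apply: sim_trans hA1; rewrite simM ?sim_refl ?small_neq0|exact: simV].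
have uC : eqv 1 (ev (a^-1 *: C)).
  rewrite evZ fmorphV mulrC; apply: eqv_trans ua _; rewrite ![_ / _]mulrC.
  by rewrite eqvM2l ?invr_eq0 ?fmorph_eq0 //; exact: sim_eqv.
have uA : eqv 1 (ev (a^-1 *: A1)).
  rewrite -[ev _](divfK (eqv1_neq0 uC)); apply: eqv1M => //.
  by apply: eqv_trans uy _; exact: sim_eqv.
have [dA _] := andP (etrans (esym (eqvE w _ _)) uA).
have [dC _] := andP (etrans (esym (eqvE w _ _)) uC).
rewrite (res_sim e) ?res_div //; last by case/andP: uy.
have a1 : a^-1 != 0 by rewrite invr_eq0.
apply: fld_div => //; apply: hD.
  by exists (a^-1 *: A1); case/andP: (smallZ a1 sA1).
by exists (a^-1 *: C); case/andP: (smallZ a1 sC).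
Qed.

(** Here t is the residue of Z ^ e / g, where e generates the group of exponents i for which Z ^ i
    has the value of a low fraction and g is such a fraction for i = e. A unit m Z ^ i has i = e l,
    so it is m g ^ l times the l-th power of Z ^ e / g. The second clause is the case e = 1, where t
    is a constant times the residue of Z / m. *)
Lemma key_transcendental : exists2 t, t != 0 &
  (forall m (i : int), lowfrac m -> eqv 1 (m * Z ^ i) -> exists m' (l : int),
     [/\ lowfrac m', eqv 1 m' & res (m * Z ^ i) = res m' * t ^ l]) /\
  (forall m, lowfrac m -> eqv m Z -> exists m', [/\ lowfrac m', eqv 1 m'
     & t = res m' * res (Z / m)]).
Proof.
have [e [g [lg hg hi]]] :=
  value_index w lowfrac1 lowfracM lowfracV lowfrac_neq0 key_neq0.
have g0 := lowfrac_neq0 lg.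
set t := Z ^+ e / g.
have ut : eqv 1 t by rewrite eqv1_div // eqv_sym.
exists (res t); first exact: eqv1_res.
have t0 := eqv1_neq0 ut.
have ut1 (l : int) : eqv 1 (t ^ l).
  by case: l => l; [exact: eqv1X|apply: eqv1V; exact: eqv1X].
have rest (l : int) : res (t ^ l) = res t ^ l.
  have dt : dv 1 t by case/andP: ut.
  by case: l => l; rewrite ?NegzE -?exprnP -?exprnN ?resV ?eqv1X ?resX.
split=> [m i lm um|m lm mZ].
  have /dvdzP[l il] := hi i m lm um.
  exists (m * g ^ l), l.
  have mE : m * Z ^ i = m * g ^ l * t ^ l.
    rewrite -mulrA -expfzMl; congr (_ * _).
    by rewrite /t mulrC divfK // il [(l * _)%R]mulrC -exprz_exp -exprnP.
  have lmg : lowfrac (m * g ^ l).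
    apply: lowfracM => //; exact: (closed_exprz lowfrac1 lowfracM lowfracV).
  have umg : eqv 1 (m * g ^ l).
    by rewrite -[m * _](mulfK (expfz_neq0 l t0)) -mE eqv1M ?eqv1V.
  split=> //; rewrite mE resM ?rest //; first by case/andP: umg.
  by case/andP: (ut1 l).
have : (e %| 1)%Z.
  apply: (hi 1 m^-1); first exact: lowfracV.
  by rewrite expr1z mulrC eqv1_div ?(lowfrac_neq0 lm) // eqv_sym.
rewrite dvdz1 /= => /eqP e1; exists (m / g).
have m0 := lowfrac_neq0 lm.
have umg : eqv 1 (m / g).
  rewrite eqv1_div // eqv_sym; apply: eqv_trans hg _.
  by rewrite e1 expr1 eqv_sym.
have uZm : eqv 1 (Z / m) by rewrite eqv1_div // eqv_sym.
split=> //; first by apply: lowfracM => //; exact: lowfracV.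
rewrite -resM; [|by case/andP: umg|by case/andP: uZm].
by rewrite /t e1 expr1; congr (res _); rewrite [RHS]mulrC mulrA divfK.
Qed.

Lemma key_unit D t : fld D -> (forall z, lowres z -> D z) -> D t ->
  (forall m (i : int), lowfrac m -> eqv 1 (m * Z ^ i) -> exists m' (l : int),
     [/\ lowfrac m', eqv 1 m' & res (m * Z ^ i) = res m' * t ^ l]) ->
  forall m (i : int), lowfrac m -> eqv 1 (m * Z ^ i) -> D (res (m * Z ^ i)).
Proof.
move=> fD hD Dt ht m i lm um; have [m' [l [lm' um' ->]]] := ht m i lm um.
by apply: (fldM fD); [exact: lowfrac_res|exact: (fldXz fD)].
Qed.

Lemma good_lowfrac (q : {poly E}) : good (ev q) -> lowfrac (ev q).
Proof.
have [s [hs e]] := padic q => gq.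
(* A zero coefficient is appended so that the index set is nonempty, as [gauss_good] requires. *)
pose c (i : 'I_(size s).+1) := ev s`_i.
have eq : ev q = \sum_(i < (size s).+1) c i * Z ^+ i.
  rewrite big_ord_recr /= /c nth_default // rmorph0 mul0r addr0 e rmorph_sum.
  by apply: eq_bigr => i _; rewrite rmorphM rmorphXn.
have hc i : c i = 0 \/ good (c i) by exact: small_good_or0.
have h : sim (ev q) (c ord0) by rewrite eq; apply: gauss_good; rewrite -?eq //; exact: key_neq0.
apply: (lowfrac_sim (sim_sym h)); apply: lowfrac_small.
by rewrite /small hs -ev_eq0 (sim_neq0r h).
Qed.

Section Residues.
Variables (D : resfield w -> Prop) (fD : fld D).
Hypothesis D_key : forall m (i : int), lowfrac m -> eqv 1 (m * Z ^ i) ->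
  D (res (m * Z ^ i)).

(** A Z ^ i is a dominant term of the P-adic expansion. By [gauss] it has the value of p, and p
    divided by it is a sum of integral terms whose nonzero residues are those of units m Z ^ j. *)
Lemma poly_lead (p : {poly E}) : p != 0 -> exists A (i : nat),
  [/\ small A, eqv 1 (ev p / (ev A * Z ^ i)) & D (res (ev p / (ev A * Z ^ i)))].
Proof.
move=> p0; have [s [hs ep]] := padic p.
pose F (i : 'I_(size s)) := ev s`_i * Z ^+ i.
have eF : ev p = \sum_i F i.
  by rewrite ep rmorph_sum; apply: eq_bigr => i _; rewrite rmorphM rmorphXn.
have exF : exists i, F i != 0.
  apply: contrapT => none; move: (ev_inj p0); rewrite eF big1 ?eqxx // => i _.
  by apply/eqP/negPn/negP => Fi; apply: none; exists i.
have [i0 Fi0 min0] := dv_min w exF.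
exists s`_i0, i0.
have sA i : F i != 0 -> small s`_i.
  move=> Fi; rewrite /small hs andbT; apply: contraNneq Fi => e.
  by rewrite /F e rmorph0 mul0r.
rewrite -exprnP -/(F i0).
have u1 i : dv 1 (F i / F i0) by rewrite -(dvM2r w _ _ Fi0) mul1r divfK.
split; first exact: sA.
  rewrite eqv1_div // eqvE; apply/andP; split.
    by rewrite ep; exact: gauss_padic.
  by rewrite eF; exact: dv_sum.
rewrite eF mulr_suml res_sum //; apply: fld_sum => // i _.
have [->|ui] := eqVneq (res (F i / F i0)) 0; first exact: fld0.
have {}ui := res_neq0 ui.
have Fi : F i != 0.
  by move: (eqv1_neq0 ui); rewrite mulf_eq0 negb_or => /andP[].
have uE : F i / F i0 = ev s`_i / ev s`_i0 * Z ^ (i%:Z - i0%:Z).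
  by rewrite /F invfM mulrACA expfzDr ?key_neq0 // -exprnN.
rewrite uE in ui *; apply: D_key => //; apply: lowfracM.
  exact/lowfrac_small/sA.
exact/lowfracV/lowfrac_small/sA.
Qed.

Lemma evfrac_lead y : evfrac y -> y != 0 -> exists m (i : int),
  [/\ lowfrac m, eqv 1 (y / (m * Z ^ i)) & D (res (y / (m * Z ^ i)))].
Proof.
move=> [p [q [q0 ->]]] y0; have p0 : p != 0.
  by apply: contraNneq y0 => ->; rewrite rmorph0 mul0r.
have [A [i [sA uA DA]]] := poly_lead p0.
have [B [j [sB uB DB]]] := poly_lead q0.
exists (ev A / ev B), (i%:Z - j%:Z).
have -> : ev p / ev q / (ev A / ev B * Z ^ (i%:Z - j%:Z)) =
    ev p / (ev A * Z ^ i) / (ev q / (ev B * Z ^ j)).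
  rewrite expfzDr ?key_neq0 // -exprnN; exact: div_frac6.
split.
- by apply: lowfracM; [exact: lowfrac_small|exact/lowfracV/lowfrac_small].
- by apply: eqv1M => //; exact: eqv1V.
rewrite res_div //; first exact: fld_div.
by case/andP: uA.
Qed.

(** The generation part of the ruled residue theorem: the residues of E(X) are generated by those of
    the units m Z ^ i. *)
Lemma evfrac_res y : evfrac y -> D (res y).
Proof.
move=> ry; have [->|/res_neq0 uy] := eqVneq (res y) 0; first exact: fld0.
have [m [i [lm um Dm]]] := evfrac_lead ry (eqv1_neq0 uy).
have mZ0 : m * Z ^ i != 0 by rewrite mulf_neq0 ?(lowfrac_neq0 lm) ?expfz_neq0 ?key_neq0.
have umZ : eqv 1 (m * Z ^ i).
  have -> : m * Z ^ i = y / (y / (m * Z ^ i)).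
    by rewrite invf_div [RHS]mulrC divfK // (eqv1_neq0 uy).
  by apply: eqv1M => //; exact: eqv1V.
rewrite -[y](divfK mZ0) resM; first by apply: fldM => //; exact: D_key.
  by case/andP: um.
by case/andP: umZ.
Qed.

End Residues.

End KeyPolynomial.

(** * Ruledness criterion *)

Section FiniteExtension.
Variables (k K : fieldType) (rho : {rmorphism k -> K}).

(** The elements are adjoined one at a time, each through a polynomial of least degree over the
    field reached so far, which is therefore irreducible. *)
Lemma finite_ext_containing (s : seq K) : (forall z, z \in s -> algov rho z) ->
  exists (k' : fieldExtType k) (j : {rmorphism k' -> K}),
    (forall a : k, j a%:A = rho a) /\ (forall z, z \in s -> exists a, j a = z).
Proof.
elim: s => [|z s IHs] hs.
  exists (k^o : fieldExtType k).
  exists (rho : {rmorphism k^o -> K}); split=> // a.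
  by rewrite /GRing.scale /= mulr1.
have hs1 y : y \in s -> algov rho y.
  move=> ys; apply: hs; by rewrite inE ys orbT.
have [k1 [j1 [j1E j1s]]] := IHs hs1.
have [p0 p0_neq0 p0z] : exists2 p : {poly k1}, p != 0 & root (map_poly j1 p) z.
  have /algP[p pn0 pz] := hs z (mem_head _ _).
  exists (map_poly (in_alg k1) p); first by rewrite map_poly_eq0.
  by rewrite -map_poly_comp (eq_map_poly (_ : _ =1 rho)).
pose Q n := `[< exists2 p : {poly k1}, p != 0 & root (map_poly j1 p) z && (size p == n) >].
have exQ : exists n, Q n by exists (size p0); apply/asboolP; exists p0; rewrite ?p0z ?eqxx.
have [n /asboolP[p pn0 /andP[pz /eqP sp]] minQ] := ex_minnP exQ.
have irr_p : irreducible_poly p.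
  apply/(subfx_irreducibleP pz pn0) => q qz qn0; rewrite sp; apply: minQ.
  by apply/asboolP; exists q; rewrite ?qz ?eqxx.
exists (baseFieldType (SubFieldExtType pz irr_p)).
exists (subfx_inj : {rmorphism subFExtend j1 z p -> K}); split=> [a|y].
  rewrite -j1E baseField_scaleE.
  exact: (subfx_inj_base pz pn0).
rewrite inE => /orP[/eqP->|/j1s[a <-]].
  by exists (subfx_root j1 z p); exact: subfx_inj_root.
by exists (a%:A : SubFieldExtType pz irr_p); exact: (subfx_inj_base pz pn0).
Qed.

(** The values at x of rational functions over a finite extension containing s form a subfield,
    hence the whole field. *)
Lemma ruled_generated (s : seq K) x : (forall z, z \in s -> algov rho z) ->
  (forall z D, fld D -> (forall a, D (rho a)) -> (forall y, y \in s -> D y) ->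
     D x -> D z) -> ruled rho.
Proof.
move=> hs gen; have [k' [j [jE js]]] := finite_ext_containing hs.
exists k', j, x; split=> // z.
apply: (gen z (fun z => exists p q : {poly k'},
  (map_poly j q).[x] != 0 /\ z = (map_poly j p).[x] / (map_poly j q).[x])).
- split=> [|a b [p [q [q0 ->]]] [p' [q' [q'0 ->]]]|
    a b [p [q [q0 ->]]] [p' [q' [q'0 ->]]]].
  + by exists 1, 1; rewrite rmorph1 hornerC oner_neq0 divr1.
  + exists (p * q' - p' * q), (q * q').
    rewrite rmorphB !rmorphM /= hornerD hornerN !hornerM mulf_neq0 //; split=> //.
    by rewrite -[- (_ / _)]mulNr addf_div // mulNr.
  have [->|p'0] := eqVneq (map_poly j p').[x] 0.
    by exists 0, 1; rewrite rmorph1 rmorph0 !hornerC oner_neq0 !mul0r invr0 mulr0.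
  exists (p * q'), (q * p'); rewrite !rmorphM /= !hornerM mulf_neq0 //; split=> //.
  by rewrite invf_div mulf_div.
- by move=> a; exists (a%:A)%:P, 1; rewrite rmorph1 map_polyC !hornerC oner_neq0 divr1 -jE.
- move=> y /js[a <-]; exists a%:P, 1.
  by rewrite rmorph1 map_polyC !hornerC oner_neq0 divr1.
by exists 'X, 1; rewrite rmorph1 map_polyX hornerX hornerC oner_neq0 divr1.
Qed.

(** A maximal linearly independent family in S generates S. The induction on d finds one for a mere
    predicate S, which need not be a subspace. *)
Lemma finite_span (S : K -> Prop) d :
  (forall x : 'I_d.+1 -> K, (forall i, S (x i)) -> exists2 c : 'I_d.+1 -> k,
     (exists i, c i != 0) & \sum_i rho (c i) * x i = 0) ->
  exists2 s : seq K, (forall z, z \in s -> S z) &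
    forall z D, S z -> fld D -> (forall a, D (rho a)) ->
      (forall y, y \in s -> D y) -> D z.
Proof.
elim: d => [|d IHd] dep.
  exists [::] => // z D Sz fD _ _.
  have [c [i ci]] := dep (fun=> z) (fun=> Sz).
  rewrite big_ord1 => /eqP; rewrite mulf_eq0 fmorph_eq0.
  by rewrite (ord1 i) in ci; rewrite (negPf ci) => /eqP->; exact: fld0.
have [dep'|ndep] := EM (forall x : 'I_d.+1 -> K, (forall i, S (x i)) ->
    exists2 c : 'I_d.+1 -> k, (exists i, c i != 0) & \sum_i rho (c i) * x i = 0).
  exact: IHd.
have [x [Sx ind]] : exists x : 'I_d.+1 -> K, (forall i, S (x i)) /\
    forall c : 'I_d.+1 -> k, \sum_i rho (c i) * x i = 0 -> forall i, c i = 0.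
  apply: contrapT => none; apply: ndep => x Sx.
  apply: contrapT => nd; apply: none; exists x; split=> // c hc i.
  by apply/eqP/negPn/negP => ci; apply: nd; exists c => //; exists i.
exists (codom x) => [z /codomP[i ->] //|z D Sz fD Drho Ds].
have [|c [i0 ci0]] := dep (fun i => if unlift ord0 i is Some j then x j else z).
  by move=> i; case: (unlift ord0 i).
rewrite big_ord_recl unlift_none.
under eq_bigr => i _ do rewrite liftK.
move=> e; have [c0|c0] := eqVneq (c ord0) 0.
  have hc := ind (fun i => c (lift ord0 i)).
  move: e; rewrite c0 rmorph0 mul0r add0r => /hc {}hc.
  by move: ci0; case: (unliftP ord0 i0) => [j|] ->; rewrite ?hc ?c0 eqxx.
have rc0 : rho (c ord0) != 0 by rewrite fmorph_eq0.
have -> : z = - (\sum_i rho (c (lift ord0 i)) * x i) / rho (c ord0).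
  by apply: (mulIf rc0); rewrite divfK // mulrC; apply/eqP; rewrite -addr_eq0 e.
apply: fld_div => //; apply: fldN => //; apply: fld_sum => // i _.
by apply: fldM => //; apply: Ds; exact: codom_f.
Qed.

End FiniteExtension.

(** Division by a coefficient of least value makes a linear relation integral with one coefficient
    equal to 1, so that it stays nontrivial modulo the maximal ideal. This bounds both residue
    degrees and the number of extensions. *)
Lemma scaled_dependence (E : fieldType) (v : valuation E) r d (M : 'M[E]_(r, d)) :
  (d < r)%N -> exists2 c : 'rV[E]_r, c *m M = 0 &
    (exists i, c 0 i = 1) /\ (forall i, dv v 1 (c 0 i)).
Proof.
move=> dr; have kM : kermx M != 0.
  by rewrite -mxrank_eq0 mxrank_ker subn_eq0 -ltnNge (leq_ltn_trans (rank_leq_col M)).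
have [c0 c0M c0n] : exists2 c : 'rV[E]_r, c *m M = 0 & c != 0.
  exists (nz_row (kermx M)); last by rewrite nz_row_eq0.
  exact/sub_kermxP/nz_row_sub.
have [i ci] : exists i, c0 0 i != 0.
  apply: contrapT => none; move: c0n; case/eqP.
  apply/rowP => i; rewrite mxE; apply/eqP/negPn/negP => h; apply: none.
  by exists i.
have [j cj hj] := dv_min v (ex_intro (fun i => c0 0 i != 0) i ci).
exists ((c0 0 j)^-1 *: c0); first by rewrite -scalemxAl c0M scaler0.
split=> [|l]; first by exists j; rewrite mxE mulVf.
by rewrite mxE mulrC -(dvM2r v _ _ cj) mul1r divfK.
Qed.

(** Polynomials of degree below that of P form an E-space of dimension [(size P).-1]; among more of
    them there is an integral relation, which passes to the residues. So these residues span a space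
    of finite dimension over Ev. *)
Lemma lowres_finite (E K : fieldType) (iota : {rmorphism E -> K}) (v : valuation E)
    (w : extension iota v) (ev : {rmorphism {poly E} -> K}) (P : {poly E}) :
  (forall a : E, ev a%:P = iota a) -> P != 0 ->
  exists2 s : seq (resfield w), (forall z, z \in s -> lowres ev P z) &
    forall z D, lowres ev P z -> fld D -> (forall a, D (resmap w a)) ->
      (forall y, y \in s -> D y) -> D z.
Proof.
move=> evC P0; apply: (@finite_span _ _ _ _ (size P).-1) => x hx.
have /boolp.choice[A hA] : forall i, exists A : {poly E},
    [/\ (size A < size P)%N, dv w 1 (ev A) & x i = res w (ev A)] by exact: hx.
pose M := \matrix_(i < (size P).-1.+1) poly_rV (d := (size P).-1) (A i).
have [c cM [[i0 ci0] c1]] := scaled_dependence v M (ltnSn _).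
exists (fun i => res v (c 0 i)).
  by exists i0; rewrite ci0 res1 oner_neq0.
have hc : \sum_i c 0 i *: A i = 0.
  rewrite -[LHS](@poly_rV_K _ (size P).-1).
    rewrite linear_sum /=; transitivity (rVpoly (c *m M)); last by rewrite cM linear0.
    rewrite mulmx_sum_row; congr rVpoly; apply: eq_bigr => i _.
    by rewrite linearZ rowK.
  apply: (big_ind (fun p : {poly E} => size p <= (size P).-1)%N).
  - by rewrite size_poly0.
  - by move=> p q hp hq; apply: leq_trans (size_polyD _ _) _; rewrite geq_max hp.
  move=> i _; apply: leq_trans (size_scale_leq _ _) _.
  by have [h _ _] := hA i; rewrite -ltnS prednK // size_poly_gt0.
have d1 i : dv w 1 (iota (c 0 i)) by rewrite -(rmorph1 iota) dv_iota.
transitivity (res w (\sum_i iota (c 0 i) * ev (A i))).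
  rewrite res_sum => [|i _]; last first.
    by have [_ h _] := hA i; rewrite -[1]mulr1 dvM.
  apply: eq_bigr => i _; have [_ h ->] := hA i.
  by rewrite resM // resmap_res.
have -> : \sum_i iota (c 0 i) * ev (A i) = ev (\sum_i c 0 i *: A i).
  by rewrite rmorph_sum; apply: eq_bigr => i _; rewrite -mul_polyC rmorphM /= evC.
by rewrite hc rmorph0 res0.
Qed.

(** * Residue fields of quadratic extensions *)

Lemma mulf_cancel (K : fieldType) (c g x X : K) : c != 0 -> X != 0 ->
  c * g * (c^-1 / X) = g / X /\ x * X * (c^-1 / X) = c^-1 * x.
Proof. by move=> c0 X0; split; field; rewrite ?c0 ?X0. Qed.

Section Quadratic.
Variables (E K : fieldType) (iota : {rmorphism E -> K}) (v : valuation E).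
Variable w : extension iota v.
Variable ev : {rmorphism {poly E} -> K}.
Hypothesis ev_inj : forall p : {poly E}, p != 0 -> ev p != 0.
Hypothesis evC : forall a : E, ev a%:P = iota a.

Local Notation dv := (dv w).
Local Notation sdv := (sdv w).
Local Notation eqv := (eqv w).
Local Notation sim := (sim w).
Local Notation res := (res w).
Local Notation good := (@good _ _ _ _ w).
Local Notation rho := (resmap w).
Local Notation alg := (algov rho).
Local Notation evfrac := (evfrac ev).

Variable y : K.
Hypothesis y2_rat : evfrac (y ^+ 2).
Hypothesis decomp : forall z, exists a b, [/\ evfrac a, evfrac b & z = a + b * y].
Hypothesis unit2 : eqv 1 2.

Let ratF : fld evfrac := evfrac_fld ev_inj.

(** For z = a + b y without cancellation the residue is taken termwise. If a and b y cancel, z is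
    equivalent to its norm divided by 2 a, and its residue is that of a fraction. *)
Lemma quadratic_residue (D : resfield w -> Prop) z :
  fld D -> (forall x, evfrac x -> D (res x)) ->
  D (res z) \/ exists r A B, [/\ evfrac r, eqv 1 (y * r), D A, D B &
                                res z = A + B * res (y * r)].
Proof.
move=> fD hD; have [->|/res_neq0 uz] := eqVneq (res z) 0; first by left; exact: fld0.
have [dz _] := andP (etrans (esym (eqvE w _ _)) uz).
have [a [b [ra rb zE]]] := decomp z.
have byE : b * y = z - a by rewrite zE addrC addKr.
have [za|az] := boolP (dv z a).
  have d1a : dv 1 a := dv_trans dz za.
  have d1b : dv 1 (b * y) by apply: dv_trans dz _; rewrite byE dvB ?dv_refl.
  have rz : res z = res a + res (b * y) by rewrite zE resD.
  have [b0|/res_neq0 ub] := eqVneq (res (b * y)) 0.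
    by left; rewrite rz b0 addr0; exact: hD.
  right; exists b, (res a), 1; rewrite mul1r mulrC; split=> //; first exact: hD.
  exact: fld1.
left; have {}az : sdv a z by [].
have a0 := sdv_neq0 az; have z0 := eqv1_neq0 uz.
have n20 := eqv1_neq0 unit2.
(* The conjugate z' of z is equivalent to 2 a, and z z' is a fraction. *)
pose z' := a - b * y.
have z'E : z' = 2 * a + - z by rewrite /z' byE mulr_natl mulr2n; ring.
have simz' : sim z' (2 * a).
  rewrite z'E; apply: sim_add; rewrite sdvNr.
  apply: dv_sdv_trans az; rewrite -[X in dv _ X]mul1r dvM ?dv_refl //.
  by case/andP: unit2.
have z'0 := sim_neq0 simz'.
pose c := a ^+ 2 - b ^+ 2 * y ^+ 2.
have rc : evfrac c.
  by apply: (fldB ratF); [exact: (fldX ratF)|apply: (fldM ratF) => //; exact: (fldX ratF)].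
have cE : c = z * z' by rewrite zE /c /z'; ring.
have h : sim z (c / (2 * a)).
  have -> : z = c / z' by rewrite cE mulfK.
  apply: simM; last exact: simV.
  by rewrite sim_refl // cE mulf_neq0.
rewrite (res_sim h dz); apply: hD; apply: (fld_div ratF) => //.
apply: (fldM ratF) => //; exact: (fldD ratF (fld1 ratF) (fld1 ratF)).
Qed.

Lemma alg_fld : fld alg.
Proof.
split; [exact: alg1|move=> a b; exact: algB|].
by move=> a b ha hb; apply: algM => //; exact: algV.
Qed.

(** The source of the key polynomial. If all polynomials were good, residues of fractions would be
    algebraic over Ev, and so would every residue of y r, whose square is one of them; by
    [quadratic_residue] nothing else remains. *)
Lemma transcendental_bad : transcendental_ext rho ->
  exists2 p : {poly E}, p != 0 & ~ good (ev p).
Proof.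
move=> [z tz]; apply: contrapT => none.
have gp (p : {poly E}) : p != 0 -> good (ev p).
  by move=> p0; apply: contrapT => bad; apply: none; exists p.
have gr x : evfrac x -> alg (res x).
  move=> rx; have [->|/res_neq0 ux] := eqVneq (res x) 0; first exact: alg0.
  case: rx ux => p [q [q0 ->]] ux.
  have p0 : p != 0.
    by apply: contraTneq ux => ->; apply/negP => /eqv1_neq0; rewrite rmorph0 mul0r eqxx.
  by apply: good_alg; [apply: good_div; exact: gp|case/andP: ux].
have [x dx ez] := res_surj z; apply: tz; apply/algP; rewrite ez.
case: (quadratic_residue x alg_fld gr) => // -[r [A [B [rr ur hA hB ->]]]].
apply: algD => //; apply: algM => //; apply: (@alg_unX _ _ _ _ 2) => //.
rewrite -resX; last by case/andP: ur.
apply: gr; rewrite exprMn; apply: (fldM ratF) => //; exact: (fldX ratF).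
Qed.

Section Ruled.
Variable P : {poly E}.
Hypothesis P0 : P != 0.
Hypothesis P_bad : ~ good (ev P).
Hypothesis P_min : forall A : {poly E}, A != 0 -> (size A < size P)%N -> good (ev A).
Local Notation Z := (ev P).
Local Notation lowfrac := (lowfrac w ev P).
Local Notation lowres := (lowres ev P).

(** One unit of the form y r suffices: any two differ by a fraction, whose residue is already at
    hand. *)
Lemma ruled_core (s : seq (resfield w)) x : (forall z, z \in s -> alg z) ->
  (forall D : resfield w -> Prop, fld D -> (forall a, D (rho a)) ->
    (forall z, z \in s -> D z) -> D x ->
    (forall r, evfrac r -> D (res r)) /\
    ((exists2 r, evfrac r & eqv 1 (y * r)) ->
      exists2 r, evfrac r & eqv 1 (y * r) /\ D (res (y * r)))) ->
  ruled rho.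
Proof.
move=> sa h; apply: (ruled_generated sa (x := x)) => z D fD Drho Ds Dx.
have [hr hy] := h D fD Drho Ds Dx.
have [z' _ ->] := res_surj z.
case: (quadratic_residue z' fD hr) => // -[r [A [B [rr ur hA hB ->]]]].
have [r1 rr1 [ur1 Dr1]] := hy (ex_intro2 _ _ r rr ur).
have y0 : y != 0.
  by move: (eqv1_neq0 ur); rewrite mulf_eq0 negb_or => /andP[].
have r10 : r1 != 0.
  by move: (eqv1_neq0 ur1); rewrite mulf_eq0 negb_or => /andP[].
apply: (fldD fD) => //; apply: (fldM fD) => //.
have -> : y * r = (y * r1) * (r / r1) by field.
have u : eqv 1 (r / r1).
  have -> : r / r1 = (y * r) / (y * r1) by field; rewrite ?r10 ?y0.
  by apply: eqv1M => //; exact: eqv1V.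
rewrite resM; first by apply: (fldM fD) => //; apply: hr; exact: (fld_div ratF).
  by case/andP: ur1.
by case/andP: u.
Qed.


Let lowM m m' : lowfrac m -> lowfrac m' -> lowfrac (m * m').
Proof. exact: (lowfracM ev_inj evC P_bad P_min P0). Qed.
Let low1 : lowfrac 1 := lowfrac1 ev_inj evC P_bad P0.

(** * Adjoining the residue of a multiple of y to the residue field of E(X) *)

Section KeyResidue.
Variables (t : resfield w) (t0 : t != 0).
Hypothesis tu : forall m (i : int), lowfrac m -> eqv 1 (m * Z ^ i) ->
  exists m' (l : int), [/\ lowfrac m', eqv 1 m' & res (m * Z ^ i) = res m' * t ^ l].
Hypothesis tZ : forall m, lowfrac m -> eqv m Z -> exists m',
  [/\ lowfrac m', eqv 1 m' & t = res m' * res (Z / m)].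
Variables (s : seq (resfield w)) (slow : forall z, z \in s -> lowres z).
Hypothesis sgen : forall z (D : resfield w -> Prop), lowres z -> fld D ->
  (forall a, D (rho a)) -> (forall z', z' \in s -> D z') -> D z.

Let salg z : z \in s -> alg z. Proof. by move=> /slow; exact: lowres_alg. Qed.

Let D_lowfrac (D : resfield w -> Prop) m : fld D ->
  (forall a, D (rho a)) -> (forall z, z \in s -> D z) ->
  lowfrac m -> eqv 1 m -> D (res m).
Proof.
move=> fD Dr Ds; apply: (lowfrac_res ev_inj evC P_bad P_min P0 fD) => z lz.
exact: sgen.
Qed.

Let D_key (D : resfield w -> Prop) m (i : int) : fld D -> (forall a, D (rho a)) ->
  (forall z, z \in s -> D z) -> D t ->
  lowfrac m -> eqv 1 (m * Z ^ i) -> D (res (m * Z ^ i)).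
Proof.
move=> fD Dr Ds Dt.
by apply: (key_unit ev_inj evC P_bad P_min P0 fD _ Dt) => // z lz; exact: sgen.
Qed.

Let D_evfrac (D : resfield w -> Prop) r : fld D ->
  (forall a, D (rho a)) -> (forall z, z \in s -> D z) ->
  D t -> evfrac r -> D (res r).
Proof.
move=> fD Dr Ds Dt; apply: (evfrac_res ev_inj evC P_bad P_min P0 fD) => //.
by move=> m i lm um; exact: D_key.
Qed.

(** A unit y r is brought to the form (y / s0) m Z ^ k by splitting off the leading term of s0 r;
    the remaining unit has its residue in the field generated by s and t. The factor s0 is there to
    divide a square out of y ^ 2. If no y r is a unit, s and t generate everything. *)
Lemma ruled_eta s0 : evfrac s0 -> s0 != 0 ->
  (forall m (i : int), lowfrac m -> eqv 1 (y / s0 * (m * Z ^ i)) ->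
    exists (s' : seq (resfield w)) x, (forall z, z \in s' -> alg z) /\
      forall D : resfield w -> Prop, fld D -> (forall a, D (rho a)) ->
        (forall z, z \in s' -> D z) -> D x ->
        [/\ forall z, z \in s -> D z, D t & D (res (y / s0 * (m * Z ^ i)))]) ->
  ruled rho.
Proof.
move=> rs0 s00 H.
have [[r0 rr0 ur0]|none] := EM (exists2 r, evfrac r & eqv 1 (y * r)); last first.
  apply: (ruled_core salg (x := t)) => D fD Dr Ds Dt; split.
    by move=> r; exact: D_evfrac.
  by move=> h; case: none.
have r00 : r0 != 0.
  by move: (eqv1_neq0 ur0); rewrite mulf_eq0 negb_or => /andP[].
(* The subfield generated by Ev, s and t, as the intersection of all subfields containing them. *)
pose D0 (z : resfield w) := forall D : resfield w -> Prop, fld D -> (forall a, D (rho a)) ->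
  (forall z, z \in s -> D z) -> D t -> D z.
have fD0 : fld D0.
  split=> [|a b ha hb|a b ha hb] D fD Dr Ds Dt; first exact: fld1.
    by apply: fldB => //; [exact: ha|exact: hb].
  by apply: fld_div => //; [exact: ha|exact: hb].
have [m1 [k [lm1 u1 Du1]]] : exists m1 (k : int), [/\ lowfrac m1,
    eqv 1 (s0 * r0 / (m1 * Z ^ k)) & D0 (res (s0 * r0 / (m1 * Z ^ k)))].
  apply: (evfrac_lead ev_inj evC P_bad P_min P0 fD0).
  - by move=> m i lm um D fD Dr Ds Dt; exact: D_key.
  - exact: (fldM ratF).
  exact: mulf_neq0.
have mZ0 : m1 * Z ^ k != 0.
  by rewrite mulf_neq0 ?expfz_neq0 ?(lowfrac_neq0 lm1) ?ev_inj.
have yE : y * r0 = y / s0 * (m1 * Z ^ k) * (s0 * r0 / (m1 * Z ^ k)).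
  by move: (m1 * Z ^ k) mZ0 => M M0; field; rewrite ?M0 ?s00.
have ueta : eqv 1 (y / s0 * (m1 * Z ^ k)).
  rewrite -[_ * (_ * _)](mulfK (eqv1_neq0 u1)) -yE.
  by apply: eqv1M => //; exact: eqv1V.
have [s' [x [s'alg hs']]] := H m1 k lm1 ueta.
apply: (ruled_core s'alg (x := x)) => D fD Dr Ds' Dx.
have [Ds Dt De] := hs' D fD Dr Ds' Dx.
split=> [r|_]; first exact: D_evfrac.
exists r0 => //; split=> //; rewrite yE resM; last 2 first.
- by case/andP: ueta.
- by case/andP: u1.
by apply: fldM => //; exact: Du1.
Qed.

(** The residue of eta has square a constant times t ^ l. After division by a power of t, its square
    is a constant, and an algebraic element joins s, or it is a constant times t, and the square
    root replaces t as generator. *)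
Lemma ruled_monomial s0 m i : evfrac s0 -> s0 != 0 -> lowfrac m ->
  sim ((y / s0) ^+ 2) (m * Z ^+ i) -> ruled rho.
Proof.
move=> rs0 s00 lm hs; apply: (ruled_eta rs0 s00) => m1 k lm1.
set eta := y / s0 * _ => ueta; have Z0 : Z != 0 := ev_inj P0.
have deta : dv 1 eta by case/andP: ueta.
have lm2 : lowfrac (m * m1 ^+ 2).
  by rewrite expr2; apply: lowM => //; apply: lowM.
have hs2 : sim (eta ^+ 2) (m * m1 ^+ 2 * Z ^ (i%:Z + (k + k))).
  rewrite expfzDr // expfzDr // -[Z ^ i%:Z]exprnP.
  have -> : m * m1 ^+ 2 * (Z ^+ i * (Z ^ k * Z ^ k)) = m * Z ^+ i * (m1 * Z ^ k) ^+ 2.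
    by ring.
  rewrite /eta exprMn; apply: simM => //; apply: sim_refl.
  by rewrite expf_neq0 ?mulf_neq0 ?expfz_neq0 ?(lowfrac_neq0 lm1).
have u2 : eqv 1 (m * m1 ^+ 2 * Z ^ (i%:Z + (k + k))).
  by apply: eqv_trans (sim_eqv hs2); exact: eqv1X.
have [m' [l [lm' um' resl]]] := tu lm2 u2.
have re2 : res eta ^+ 2 = res m' * t ^ l.
  by rewrite -resX // -resl; apply: res_sim => //; case/andP: (eqv1X 2 ueta).
pose l' := (l %/ 2)%Z; pose eta0 := res eta / t ^ l'.
have tl0 : t ^ l' != 0 by rewrite expfz_neq0.
have reta : res eta = eta0 * t ^ l' by rewrite /eta0 divfK.
have lE : l = l' + l' + (l %% 2)%Z.
  by rewrite {1}(divz_eq l 2) -/l' mulr_natr mulr2n.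
have e02 : eta0 ^+ 2 = res m' * t ^ (l %% 2)%Z.
  rewrite /eta0 expr_div_n re2 {1}lE expfzDr // expfzDr // mulrCA.
  by rewrite expr2 [X in X / _ = _]mulrC mulfK // mulf_neq0.
have m'0 : res m' != 0 by exact: eqv1_res.
(* eta0 ^ 2 is a constant or a constant times t, according to the parity of l. *)
have : (l %% 2)%Z = 0 \/ (l %% 2)%Z = 1.
  by have := modz_ge0 l (isT : 2%:Z != 0); have := ltz_mod l (isT : 2%:Z != 0); clear; lia.
case=> lm0; rewrite lm0 ?expr0z ?mulr1 ?expr1z in e02.
  exists (eta0 :: s), t; split=> [z|D fD Dr Ds Dt].
    rewrite inE => /orP[/eqP->|]; last exact: salg.
    apply: (@alg_unX _ _ _ _ 2) => //; rewrite e02.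
    by apply: good_alg; [exact: (lowfrac_good P_min lm')|case/andP: um'].
  split=> // [z zs|]; first by apply: Ds; rewrite inE zs orbT.
  rewrite reta; apply: fldM => //; last exact: fldXz.
  by apply: Ds; exact: mem_head.
exists s, eta0; split=> // D fD Dr Ds De.
have Dt : D t.
  have -> : t = eta0 ^+ 2 / res m' by rewrite e02 mulrC mulKf.
  by apply: fld_div => //; [exact: fldX|exact: D_lowfrac].
by split=> //; rewrite reta; apply: fldM => //; exact: fldXz.
Qed.

(** As q P and R have the same value, Z has the value of the low fraction m2 = R / q, and tau = h /
    R = 1 + Z / m2 has a residue linear in t. On residues eta ^ 2 is a constant times tau, so t is
    recovered from [res eta], which becomes the generator. *)
Lemma ruled_linear s0 m (h q R : {poly E}) : evfrac s0 -> s0 != 0 -> lowfrac m ->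
  h = q * P + R -> lowfrac (ev q) -> lowfrac (ev R) -> eqv (ev q * Z) (ev R) ->
  eqv (ev R) (ev h) ->
  sim ((y / s0) ^+ 2) (m * ev h) -> ruled rho.
Proof.
move=> rs0 s00 lm hE lq lR eqR eRh hs; apply: (ruled_eta rs0 s00) => m1 k lm1 ueta.
have Z0 : Z != 0 := ev_inj P0.
have R0 := lowfrac_neq0 lR; have q0 := lowfrac_neq0 lq; have m10 := lowfrac_neq0 lm1.
pose m2 := ev R / ev q.
have lm2 : lowfrac m2 by apply: lowM => //; exact: lowfracV.
have m20 := lowfrac_neq0 lm2.
have m2Z : eqv m2 Z.
  by rewrite /m2 -(eqvM2l w _ _ q0) mulrC divfK // eqv_sym.
have uZm : eqv 1 (Z / m2) by rewrite eqv1_div // eqv_sym.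
have [m' [lm' um' tE]] := tZ lm2 m2Z.
have m'0 : res m' != 0 by exact: eqv1_res.
pose tau := ev h / ev R.
have utau : eqv 1 tau by rewrite eqv1_div // eqv_sym.
have rtau : res tau = 1 + res (Z / m2).
  have -> : tau = 1 + Z / m2.
    by rewrite /tau /m2 hE rmorphD rmorphM /=; field; rewrite ?R0 ?q0.
  by rewrite resD ?dv_refl ?res1 //; case/andP: uZm.
pose eta := y / s0 * (m1 * m2 ^ k).
have etaE : y / s0 * (m1 * Z ^ k) = eta * (Z / m2) ^ k.
  have -> : Z ^ k = m2 ^ k * (Z / m2) ^ k by rewrite -expfzMl mulrC divfK.
  by rewrite /eta !mulrA.
have uk : eqv 1 ((Z / m2) ^ k).
  by case: (k) => n; [exact: eqv1X|apply: eqv1V; exact: eqv1X].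
have ue : eqv 1 eta.
  rewrite -[eta](mulfK (eqv1_neq0 uk)) -etaE.
  by apply: eqv1M => //; exact: eqv1V.
pose m3 := m * ev R * (m1 * m2 ^ k) ^+ 2.
have lm3 : lowfrac m3.
  have h1 : lowfrac (m1 * m2 ^ k).
    apply: lowM => //.
    exact: (closed_exprz low1 lowM (fun x => @lowfracV _ _ _ _ w ev P x)).
  by rewrite /m3 expr2; apply: lowM; apply: lowM.
have hs3 : sim (eta ^+ 2) (m3 * tau).
  have -> : m3 * tau = m * ev h * (m1 * m2 ^ k) ^+ 2.
    by rewrite /m3 /tau; field.
  rewrite /eta exprMn; apply: simM => //; apply: sim_refl.
  by rewrite expf_neq0 ?mulf_neq0 ?expfz_neq0.
have um3 : eqv 1 m3.
  rewrite -[m3](mulfK (eqv1_neq0 utau)); apply: eqv1M; last exact: eqv1V.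
  by apply: eqv_trans (sim_eqv hs3); exact: eqv1X.
have de : dv 1 eta by case/andP: ue.
have e2 : res eta ^+ 2 = res m3 * res tau.
  rewrite -resX // -resM; [|by case/andP: um3|by case/andP: utau].
  by apply: res_sim => //; case/andP: (eqv1X 2 ue).
have m30 : res m3 != 0 by exact: eqv1_res.
exists s, (res eta); split=> // D fD Dr Ds De.
have Dtau : D (res tau).
  have -> : res tau = res eta ^+ 2 / res m3 by rewrite e2 mulrC mulKf.
  by apply: fld_div => //; [exact: fldX|exact: D_lowfrac].
have DZ : D (res (Z / m2)).
  have -> : res (Z / m2) = res tau - 1 by rewrite rtau addrC addKr.
  by apply: fldB => //; exact: fld1.
have Dt : D t by rewrite tE; apply: fldM => //; exact: D_lowfrac.
split=> //; rewrite etaE resM; [|by []|by case/andP: uk].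
apply: fldM => //.
have dZ : dv 1 (Z / m2) by case/andP: uZm.
by case: (k) => n; rewrite ?NegzE -?exprnP -?exprnN ?resV ?eqv1X ?resX //;
   [exact: fldX|apply: fldV => //; exact: fldX].
Qed.

End KeyResidue.
Lemma ruled_even s0 a (r : {poly E}) : evfrac s0 -> s0 != 0 -> a != 0 ->
  good (ev r) -> sim ((y / s0) ^+ 2) (iota a * ev r) -> ruled rho.
Proof.
move=> rs0 s00 a0 gr hs.
have [t t0 [tu _]] := key_transcendental ev_inj evC P_bad P_min P0.
have [s slow sgen] := lowres_finite w evC P0.
apply: (ruled_monomial t0 tu slow sgen rs0 s00 (m := iota a * ev r) (i := 0)).
  apply: lowM; last exact: (good_lowfrac ev_inj evC P_bad P_min P0).
  exact: (lowfrac_iota ev_inj evC P_bad P0 a0).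
by rewrite expr0 mulr1.
Qed.

(** In h = q P + R the remainder cannot dominate, since h would then be good. If q P dominates, h is
    a monomial in Z; if both have the same value, h is linear. *)
Lemma ruled_odd s0 a (h : {poly E}) : evfrac s0 -> s0 != 0 -> a != 0 ->
  ~ good (ev h) -> good (ev (h %/ P)) ->
  sim ((y / s0) ^+ 2) (iota a * ev h) -> ruled rho.
Proof.
move=> rs0 s00 a0 bh gq hs.
have [t t0 [tu tZ]] := key_transcendental ev_inj evC P_bad P_min P0.
have [s slow sgen] := lowres_finite w evC P0.
set q := h %/ P in gq; pose R := h %% P.
have hE : h = q * P + R := divp_eq h P.
have gR : ev R = 0 \/ good (ev R).
  by apply: (small_good_or0 P_min); rewrite ltn_modp.
have := gauss_divp ev_inj evC P_bad P_min P0 q gR; rewrite -hE => -[hq hR].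
have evh : ev h = ev q * Z + ev R by rewrite hE rmorphD rmorphM.
have lq : lowfrac (ev q) := good_lowfrac ev_inj evC P_bad P_min P0 gq.
have la : lowfrac (iota a) := lowfrac_iota ev_inj evC P_bad P0 a0.
have qh : dv (ev q * Z) (ev h).
  apply: sdvN; apply/negP => h1; apply: bh.
  have hsR : sim (ev h) (ev R) by rewrite simE evh addrK -evh.
  case: gR => [e|gR]; first by move: (sim_neq0r hsR); rewrite e eqxx.
  exact: sim_good (sim_sym hsR) gR.
have [h1|h1] := boolP (sdv (ev q * Z) (ev R)).
  apply: (ruled_monomial t0 tu slow sgen rs0 s00 (m := iota a * ev q) (i := 1)).
    exact: lowM.
  apply: sim_trans hs _; rewrite expr1 -mulrA; apply: simM.
    by apply: sim_refl; rewrite fmorph_eq0.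
  by rewrite evh; exact: sim_add.
have {}h1 := sdvN h1.
have R0 : ev R != 0.
  by apply: dv_neq0 h1 _; rewrite mulf_neq0 ?(lowfrac_neq0 lq) ?ev_inj.
have lR : lowfrac (ev R).
  case: gR => [e|gR]; first by rewrite e eqxx in R0.
  exact: (good_lowfrac ev_inj evC P_bad P_min P0).
apply: (ruled_linear tu tZ slow sgen rs0 s00 la hE lq lR _ _ hs).
  by rewrite eqvE h1 andbT; exact: dv_trans qh hR.
by rewrite eqvE hR; apply/andP; split=> //; exact: dv_trans h1 qh.
Qed.

(** Dividing by the largest even power of h / r leaves r for even m, and r (h / r) = h for odd m. *)
Lemma ruled_shape (f h r : {poly E}) m N : y ^+ 2 = ev f -> (0 < m)%N -> N != 0 ->
  good (ev r) -> ~ good (ev h) ->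
  sim (iota N * ev f) (ev r * (ev h / ev r) ^+ m) ->
  good (ev (h %/ P)) -> ruled rho.
Proof.
move=> y2 m0 N0 gr bh hs gq; have r0 := good_neq0 gr.
have h0 : ev h != 0.
  apply/negP => /eqP e; move/negP: (sim_neq0r hs); apply.
  by rewrite e mul0r expr0n gtn_eqF // mulr0.
have cN0 : iota N != 0 by rewrite fmorph_eq0.
have hr0 : ev h / ev r != 0 by rewrite mulf_neq0 ?invr_eq0.
have hrf : evfrac (ev h / ev r) by apply: (fld_div ratF); exact: evfrac_ev.
have hrX j : evfrac ((ev h / ev r) ^+ j) by exact: (fldX ratF).
have hrX0 j : (ev h / ev r) ^+ j != 0 by exact: expf_neq0.
have Na : N^-1 != 0 by rewrite invr_eq0.
have base j x : x != 0 -> sim (iota N * ev f) (x * (ev h / ev r) ^+ (j * 2)) ->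
    sim ((y / (ev h / ev r) ^+ j) ^+ 2) (iota N^-1 * x).
  move=> x0 s; rewrite expr_div_n y2 fmorphV -exprM.
  have t0 : (iota N)^-1 / (ev h / ev r) ^+ (j * 2) != 0.
    by apply: mulf_neq0; rewrite invr_eq0.
  have := simM s (sim_refl w t0).
  by have [-> ->] := mulf_cancel (ev f) x cN0 (hrX0 (j * 2)%N).
have [mo|me] := boolP (odd m).
  apply: (ruled_odd (hrX m./2) (hrX0 _) Na bh gq); apply: base => //.
  move: hs; rewrite -{1}(odd_double_half m) mo add1n -muln2.
  by rewrite exprS mulrA [ev r * _]mulrC divfK.
apply: (ruled_even (hrX m./2) (hrX0 _) Na gr); apply: base => //.
by move: hs; rewrite -{1}(odd_double_half m) (negPf me) add0n -muln2.
Qed.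

End Ruled.
End Quadratic.

(** * The valuation of a valuation ring *)

Definition valring (K : fieldType) (O : set K) := [/\ O 1,
  forall x y, O x -> O y -> O (x - y), forall x y, O x -> O y -> O (x * y) &
  forall x, O x \/ O x^-1].

Section OfValuationRing.
Variables (K : fieldType) (O : set K) (hO : valring O).

Let O1 : O 1. Proof. by case: hO. Qed.
Let OB x y : O x -> O y -> O (x - y). Proof. by case: hO => _ h _ _; exact: h. Qed.
Let OM x y : O x -> O y -> O (x * y). Proof. by case: hO => _ _ h _; exact: h. Qed.
Let OV x : O x \/ O x^-1. Proof. by case: hO. Qed.
Let O0 : O 0. Proof. by rewrite -(subrr 1); exact: OB. Qed.
Let OD x y : O x -> O y -> O (x + y).
Proof. by move=> hx hy; rewrite -[y]opprK -[- y]sub0r; apply: OB => //; exact: OB. Qed.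

Definition vassoc x : pred K := [pred y | [&& y != 0, `[< O (x / y) >] & `[< O (y / x) >]]].
Definition vcanon x : K := choose (vassoc x) x.

Lemma vassocP x y : x != 0 -> vassoc x y -> [/\ y != 0, O (x / y) & O (y / x)].
Proof. by move=> x0 /and3P[y0 /asboolP h1 /asboolP h2]. Qed.
Lemma vassocI x y : y != 0 -> O (x / y) -> O (y / x) -> vassoc x y.
Proof. by move=> y0 h1 h2; apply/and3P; split=> //; exact/asboolP. Qed.
Lemma vassoc_refl x : x != 0 -> vassoc x x.
Proof. by move=> x0; apply: vassocI; rewrite ?mulfV. Qed.
Lemma vassoc_eq x y : x != 0 -> vassoc x y -> vassoc x =1 vassoc y.
Proof.
move=> x0 /(vassocP x0)[y0 xy yx] z; apply/idP/idP.
  move=> /(vassocP x0)[z0 xz zx]; apply: vassocI => //.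
    by rewrite -[y](divfK x0) -mulrA; exact: OM.
  by rewrite -[z](divfK x0) -mulrA; exact: OM.
move=> /(vassocP y0)[z0 yz zy]; apply: vassocI => //.
  by rewrite -[x](divfK y0) -mulrA; exact: OM.
by rewrite -[z](divfK y0) -mulrA; exact: OM.
Qed.
Lemma vcanonP x : x != 0 -> vassoc x (vcanon x).
Proof. by move=> x0; apply: chooseP; exact: vassoc_refl. Qed.
Lemma vcanon_eq x y : x != 0 -> vassoc x y -> vcanon x = vcanon y.
Proof.
move=> x0 xy; have [y0 _ _] := vassocP x0 xy.
rewrite /vcanon (eq_choose (vassoc_eq x0 xy)).
by apply: choose_id; [rewrite -(vassoc_eq x0 xy) vassoc_refl|exact: vassoc_refl].
Qed.
Lemma vcanon_neq0 x : x != 0 -> vcanon x != 0.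
Proof. by move=> x0; case: (vassocP x0 (vcanonP x0)). Qed.
Lemma vcanonK x : x != 0 -> vcanon (vcanon x) = vcanon x.
Proof. by move=> x0; rewrite -(vcanon_eq x0) // vcanonP. Qed.

Definition vcanonical x := (x != 0) && (vcanon x == x).
(** The value group, nonzero elements modulo units of O, carried by one canonical representative of
    each class. The proof [hO] is a parameter of the type because the group and order structures
    depend on it. *)
Definition vclass (_ : valring O) : Type := {x : K | vcanonical x}.
Local Notation G := (vclass hO).
HB.instance Definition _ := Choice.on G.

Fact vcls_subproof x : x != 0 -> vcanonical (vcanon x).
Proof. by move=> x0; rewrite /vcanonical vcanon_neq0 // vcanonK ?eqxx. Qed.
Definition vone : G := exist (fun x => is_true (vcanonical x)) _ (vcls_subproof (oner_neq0 K)).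
Definition vcls x : G := insubd (vone : {x : K | vcanonical x}) (vcanon x).
Definition vrep (g : G) : K := val (g : {x : K | vcanonical x}).

Lemma vrep_neq0 g : vrep g != 0. Proof. by case: g => x h; case/andP: (h). Qed.
Lemma vrep_cls x : x != 0 -> vrep (vcls x) = vcanon x.
Proof. by move=> x0; rewrite /vrep /vcls val_insubd (vcls_subproof x0). Qed.
Lemma vclsK g : vcls (vrep g) = g.
Proof.
apply: (@val_inj _ _ {x : K | vcanonical x}).
rewrite -[LHS]/(vrep _) vrep_cls ?vrep_neq0 //.
by case: g => x h; case/andP: (h) => _ /eqP.
Qed.
Lemma vrepP x : x != 0 -> O (x / vrep (vcls x)) /\ O (vrep (vcls x) / x).
Proof. by move=> x0; rewrite vrep_cls //; case: (vassocP x0 (vcanonP x0)). Qed.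
Lemma vcls_eq x y : x != 0 -> y != 0 -> O (x / y) -> O (y / x) -> vcls x = vcls y.
Proof.
move=> x0 y0 xy yx.
apply: (@val_inj _ _ {x : K | vcanonical x}).
rewrite -[LHS]/(vrep _) -[RHS]/(vrep _).
by rewrite !vrep_cls //; apply: vcanon_eq => //; exact: vassocI.
Qed.

Definition vadd (g h : G) := vcls (vrep g * vrep h).
Definition vopp (g : G) := vcls (vrep g)^-1.
Definition vle (g h : G) := `[< O (vrep h / vrep g) >].

Lemma vaddE x y : x != 0 -> y != 0 -> vadd (vcls x) (vcls y) = vcls (x * y).
Proof.
move=> x0 y0; have [xr rx] := vrepP x0; have [yr ry] := vrepP y0.
apply: vcls_eq; rewrite ?mulf_neq0 ?vrep_neq0 //.
  by rewrite -mulf_div; exact: OM.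
by rewrite -mulf_div; exact: OM.
Qed.
Lemma vleE x y : x != 0 -> y != 0 -> vle (vcls x) (vcls y) <-> O (y / x).
Proof.
move=> x0 y0; have [xr rx] := vrepP x0; have [yr ry] := vrepP y0.
have a0 := vrep_neq0 (vcls x); have b0 := vrep_neq0 (vcls y).
split=> [/asboolP h|h].
  have -> : y / x = (y / vrep (vcls y)) * ((vrep (vcls y) / vrep (vcls x)) *
     (vrep (vcls x) / x)) by rewrite mulrA mulrA !divfK.
  by apply: OM => //; exact: OM.
apply/asboolP.
have -> : vrep (vcls y) / vrep (vcls x) = (vrep (vcls y) / y) * ((y / x) *
     (x / vrep (vcls x))) by rewrite mulrA mulrA !divfK.
by apply: OM => //; exact: OM.
Qed.
Lemma vclsP g : exists2 x, x != 0 & g = vcls x.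
Proof. by exists (vrep g); [exact: vrep_neq0|rewrite vclsK]. Qed.

Fact vaddA : associative vadd.
Proof.
move=> g h k; have [x x0 ->] := vclsP g; have [y y0 ->] := vclsP h.
by have [z z0 ->] := vclsP k; rewrite !vaddE ?mulf_neq0 // mulrA.
Qed.
Fact vaddC : commutative vadd.
Proof. by move=> g h; rewrite /vadd mulrC. Qed.
Fact vadd0 : left_id (vcls 1) vadd.
Proof. by move=> g; have [x x0 ->] := vclsP g; rewrite vaddE ?oner_neq0 // mul1r. Qed.
Fact vaddN : left_inverse (vcls 1) vopp vadd.
Proof.
move=> g; rewrite -{2}[g]vclsK /vopp vaddE ?invr_eq0 ?vrep_neq0 //.
by rewrite mulVf // vrep_neq0.
Qed.
HB.instance Definition _ := GRing.isZmodule.Build G vaddA vaddC vadd0 vaddN.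

Fact vle_refl : reflexive vle.
Proof. by move=> g; apply/asboolP; rewrite mulfV ?vrep_neq0. Qed.
Fact vle_anti : antisymmetric vle.
Proof.
move=> g h /andP[/asboolP gh /asboolP hg]; rewrite -[g]vclsK -[h]vclsK.
by apply: vcls_eq; rewrite ?vrep_neq0.
Qed.
Fact vle_trans : transitive vle.
Proof.
move=> h g k /asboolP gh /asboolP hk; apply/asboolP.
have -> : vrep k / vrep g = (vrep k / vrep h) * (vrep h / vrep g).
  by rewrite mulrA divfK ?vrep_neq0.
exact: (OM hk gh).
Qed.
HB.instance Definition _ := Order.Le_isPOrder.Build ring_display G
  vle_refl vle_anti vle_trans.

Fact vle_le (g h : G) : (g <= h) = vle g h. Proof. by []. Qed.
Fact vle_add (k g h : G) : g <= h -> k + g <= k + h.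
Proof.
have [x x0 ->] := vclsP g; have [y y0 ->] := vclsP h; have [z z0 ->] := vclsP k.
move=> le; have {}le : vle (vcls x) (vcls y) by exact: le.
suff : vle (vadd (vcls z) (vcls x)) (vadd (vcls z) (vcls y)) by [].
rewrite !vaddE //; apply/vleE; rewrite ?mulf_neq0 //.
by rewrite -mulf_div mulfV // mul1r; exact/vleE.
Qed.
Fact vle_total : total (<=%R : rel G).
Proof.
move=> g h; have [x x0 ->] := vclsP g; have [y y0 ->] := vclsP h.
rewrite !vle_le; case: (OV (y / x)) => e; apply/orP; [left|right]; apply/vleE => //.
by rewrite -invf_div.
Qed.
HB.instance Definition _ := isOrderedGroup.Build G vle_add vle_total.

Fact valuation_of_M x y : x != 0 -> y != 0 -> vcls (x * y) = vcls x + vcls y.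
Proof. by move=> x0 y0; rewrite -vaddE. Qed.
Fact valuation_of_D x y : x != 0 -> y != 0 -> x + y != 0 ->
  (Order.min (vcls x) (vcls y) <= vcls (x + y)).
Proof.
move=> x0 y0 xy0; rewrite minEle !vle_le; case: ifP => le; rewrite ?vle_le; apply/vleE => //.
  by rewrite mulrDl mulfV //; apply: OD => //; exact/vleE.
rewrite mulrDl mulfV //; apply: OD => //; apply/vleE => //.
have h : vle (vcls x) (vcls y) || vle (vcls y) (vcls x) := vle_total _ _.
by rewrite le in h.
Qed.
Fact valuation_of_surj (g : G) : exists2 x, x != 0 & vcls x = g.
Proof. by have [x x0 e] := vclsP g; exists x. Qed.

Definition valuation_of : valuation K :=
  Valuation valuation_of_M valuation_of_D valuation_of_surj.

Lemma valuation_ofE x : (x \in vring valuation_of) <-> O x.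
Proof.
rewrite inE /=; have [->|x0] := eqVneq x 0; first by split.
have e : (0 <= vcls x) = vle (vcls 1) (vcls x) by [].
rewrite /= e; split=> [/vleE h|h]; first by rewrite -[x]divr1; apply: h; rewrite ?oner_neq0.
by apply/vleE; rewrite ?oner_neq0 // divr1.
Qed.

Section Extends.
Variables (E : fieldType) (iota : {rmorphism E -> K}) (v : valuation E).
Hypothesis hv : forall a, O (iota a) <-> a \in vring v.

(** The embedding of value groups sends v a to the class of [iota a]; it is well defined because v a
    determines a up to a unit. *)
Lemma valuation_of_extends : extends iota v valuation_of.
Proof.
pose s g := sval (cid2 (valuation_surj (v := v) g)).
have sP g : s g != 0 /\ v (s g) = g by rewrite /s; case: cid2.
pose e (g : vgroup v) : vgroup valuation_of := vcls (iota (s g)).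
have leO a b : a != 0 -> b != 0 -> (v a <= v b) <-> O (iota b / iota a).
  move=> a0 b0; rewrite -fmorph_div hv inE mulf_eq0 invr_eq0 (negPf a0) (negPf b0) /=.
  rewrite valuationM ?invr_eq0 // valuationV //; split=> h.
    by have := vgroup_leD2l (- v a) h; rewrite addNr addrC.
  by have := vgroup_leD2l (v a) h; rewrite addr0 addrCA subrr addr0.
have eE a : a != 0 -> vcls (iota a) = e (v a).
  move=> a0; have [s0 sv] := sP (v a).
  by apply: vcls_eq; rewrite ?fmorph_eq0 //; apply/leO; rewrite ?sv ?lexx.
have e_add : zmod_morphism e.
  move=> g h; have [g0 gv] := sP g; have [h0 hv'] := sP h.
  have d0 : s g / s h != 0 by rewrite mulf_neq0 ?invr_eq0.
  have -> : g - h = v (s g / s h) by rewrite valuationM ?invr_eq0 // valuationV ?gv ?hv'.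
  rewrite -eE // fmorph_div /e.
  rewrite -[LHS]/(valuation_of _) valuationM ?invr_eq0 ?fmorph_eq0 //.
  by rewrite valuationV ?fmorph_eq0.
pose e_isadd := GRing.isZmodMorphism.Build _ _ e e_add.
pose e' : {additive vgroup v -> vgroup valuation_of} := HB.pack e e_isadd.
exists e'; split=> [g h|x x0]; last exact: eE.
have [g0 gv] := sP g; have [h0 hv'] := sP h.
rewrite -[e' g]/(e g) -[e' h]/(e h) /e; apply/idP/idP => [le|le].
  rewrite -gv -hv'; apply/leO => //.
  by apply/vleE; rewrite ?fmorph_eq0.
apply/vleE; rewrite ?fmorph_eq0 //; apply/leO => //.
by rewrite gv hv'.
Qed.

Definition extension_of : extension iota v := Extension valuation_of_extends.

End Extends.

End OfValuationRing.

(** * Extension of valuation rings *)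

Section Chevalley.
Variables (K1 K2 : fieldType) (i : {rmorphism K1 -> K2}) (O0 : set K1).
Hypothesis hO0 : valring O0.

Let O1 : O0 1. Proof. by case: hO0. Qed.
Let OB x y : O0 x -> O0 y -> O0 (x - y). Proof. by case: hO0 => _ h _ _; exact: h. Qed.
Let OM x y : O0 x -> O0 y -> O0 (x * y). Proof. by case: hO0 => _ _ h _; exact: h. Qed.
Let OV x : O0 x \/ O0 x^-1. Proof. by case: hO0. Qed.
Let OO : O0 0. Proof. by rewrite -(subrr 1); exact: OB. Qed.

Definition subring_over (A : set K2) := [/\ A 1, forall x y, A x -> A y -> A (x - y),
  forall x y, A x -> A y -> A (x * y) & forall x, A (i x) <-> O0 x].

Lemma subring_over_max : exists2 A, subring_over A &
  forall B, subring_over B -> (A `<=` B)%classic -> (B `<=` A)%classic.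
Proof.
pose P (A : set K2) := A = set0 \/ subring_over A.
have [F FP tot|A [PA maxA]] := @Zorn_bigcup K2 P.
  have [[X0 FX0 okX0]|none] := EM (exists2 X, F X & subring_over X); last first.
    left; apply/seteqP; split=> // x [X FX Xx].
    case: (FP X FX) => [e|ok]; first by rewrite e in Xx.
    by case: none; exists X.
  have F_ok X x : F X -> X x -> subring_over X.
    by move=> FX Xx; case: (FP X FX) => // e; rewrite e in Xx.
  have common x y : (\bigcup_(X in F) X)%classic x -> (\bigcup_(X in F) X)%classic y ->
      exists X, [/\ F X, X x, X y & subring_over X].
    move=> [X FX Xx] [Y FY Yy]; case: (tot X Y FX FY) => h.
      by exists Y; split=> //; [exact: h|exact: F_ok Yy].
    by exists X; split=> //; [exact: h|exact: F_ok Xx].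
  right; split.
  - by exists X0 => //; case: okX0.
  - move=> x y /common h /h[X [FX Xx Xy [_ XB _ _]]]; exists X => //; exact: XB.
  - move=> x y /common h /h[X [FX Xx Xy [_ _ XM _]]]; exists X => //; exact: XM.
  - move=> x; split=> [[X FX Xx]|Ox].
      by have [_ _ _ /(_ x)[h _]] := F_ok _ _ FX Xx; exact: h.
    by exists X0 => //; case: okX0 => _ _ _ /(_ x)[_ h]; exact: h.
pose A0 : set K2 := [set i x | x in O0]%classic.
have okA0 : subring_over A0.
  split; first by exists 1; rewrite ?rmorph1.
  - by move=> _ _ [x Ox <-] [y Oy <-]; exists (x - y); rewrite ?rmorphB //; exact: OB.
  - by move=> _ _ [x Ox <-] [y Oy <-]; exists (x * y); rewrite ?rmorphM //; exact: OM.
  - by move=> x; split=> [[y Oy /fmorph_inj <-]|Ox] //; exists x.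
have okA : subring_over A.
  case: PA => // eA; case: (maxA A0); last by right.
  by rewrite eA; split=> // /(_ 1); case: okA0 => h _ _ _ /(_ h).
exists A => // B okB AB; apply: contrapT => BA.
by apply: (maxA B); [split|right].
Qed.

(** * A maximal subring over a valuation ring is a valuation ring *)

Section Maximal.
Variables (A : set K2) (okA : subring_over A).
Hypothesis maxA : forall B, subring_over B -> (A `<=` B)%classic -> (B `<=` A)%classic.

Let A1 : A 1. Proof. by case: okA. Qed.
Let AB x y : A x -> A y -> A (x - y). Proof. by case: okA => _ h _ _; exact: h. Qed.
Let AM x y : A x -> A y -> A (x * y). Proof. by case: okA => _ _ h _; exact: h. Qed.
Let AO x : A (i x) <-> O0 x. Proof. by case: okA => _ _ _; exact. Qed.
Let A0 : A 0. Proof. by rewrite -(subrr 1); exact: AB. Qed.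
Let AN x : A x -> A (- x).
Proof. by move=> h; rewrite -sub0r; exact: AB. Qed.
Let AD x y : A x -> A y -> A (x + y).
Proof. by move=> hx hy; rewrite -[y]opprK; apply: AB => //; exact: AN. Qed.

Let m0 mu := mu = 0 \/ ~ O0 mu^-1.
(* The ideal of A generated by the maximal ideal of O0. *)
Let M x := exists mu b, [/\ m0 mu, A b & x = b * i mu].

Let m0O mu : m0 mu -> O0 mu.
Proof. by case=> [->|h]; [exact: OO|by case: (OV mu)]. Qed.
Let M0 : M 0. Proof. by exists 0, 0; rewrite mul0r; split=> //; left. Qed.
Let MA x : M x -> A x.
Proof. by move=> [mu [b [h1 h2 ->]]]; apply: AM => //; exact/AO/m0O. Qed.
Let MM x a : A a -> M x -> M (a * x).
Proof.
by move=> ha [mu [b [h1 h2 ->]]]; exists mu, (a * b); rewrite mulrA; split=> //; exact: AM.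
Qed.
(** A single product b mu is enough to describe the ideal: of two elements of a valuation ring one
    divides the other. *)
Let MD x y : M x -> M y -> M (x + y).
Proof.
move=> [mu [b [h1 h2 ->]]] [nu [c [h3 h4 ->]]].
have [->|mu0] := eqVneq mu 0.
  by exists nu, c; rewrite rmorph0 mulr0 add0r.
have [->|nu0] := eqVneq nu 0.
  by exists mu, b; rewrite rmorph0 mulr0 addr0.
case: (OV (mu / nu)) => h.
  exists nu, (b * i (mu / nu) + c); split=> //.
    by apply: AD => //; apply: AM => //; exact/AO.
  by rewrite mulrDl -mulrA -rmorphM divfK.
rewrite invf_div in h.
exists mu, (b + c * i (nu / mu)); split=> //.
  by apply: AD => //; apply: AM => //; exact/AO.
by rewrite mulrDl -mulrA -rmorphM divfK.
Qed.
Let M1 : ~ M 1.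
Proof.
move=> [mu [b [h1 h2 e]]].
have mu0 : mu != 0.
  by apply/eqP => mu0; move: e; rewrite mu0 rmorph0 mulr0 => /eqP; rewrite oner_eq0.
case: h1 => [/eqP|]; first by rewrite (negPf mu0).
apply; apply/AO; rewrite fmorphV.
by have -> : (i mu)^-1 = b by rewrite -[LHS]mul1r e mulfK // fmorph_eq0.
Qed.
Let M1B x : M x -> 1 - x != 0.
Proof. by move=> Mx; rewrite subr_eq0; apply: contraPneq Mx => <-. Qed.

(** Localising A at the elements 1 - x with x in M does not enlarge its trace on K1, because 1 is
    not in M; by maximality the inverses are in A already. *)
Let max_inv x : M x -> A (1 - x)^-1.
Proof.
move=> Mx.
pose B : set K2 := fun z => exists a x, [/\ A a, M x & z = a / (1 - x)].
have BA : (A `<=` B)%classic.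
  by move=> a ha; exists a, 0; rewrite subr0 divr1.
have comp u v : M u -> M v -> exists2 w, M w & (1 - u) * (1 - v) = 1 - w.
  move=> Mu Mv; exists (u + v + (- u) * v); last by ring.
  by apply: MD; [exact: MD|apply: MM => //; exact/AN/MA].
suff okB : subring_over B by apply: (maxA okB BA); exists 1, x; rewrite div1r.
split; first exact: BA.
- move=> _ _ [a [u [ha Mu ->]]] [b [u' [hb Mu' ->]]].
  have [w Mw e] := comp _ _ Mu Mu'.
  exists (a * (1 - u') - b * (1 - u)), w; split=> //.
    by apply: AB; apply: AM => //; apply: AB => //; exact: MA.
  rewrite -e; have := M1B Mu; have := M1B Mu'.
  by move: (1 - u) (1 - u') => c d d0 c0; field; rewrite c0 d0.
- move=> _ _ [a [u [ha Mu ->]]] [b [u' [hb Mu' ->]]].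
  have [w Mw e] := comp _ _ Mu Mu'.
  by exists (a * b), w; split=> //; [exact: AM|rewrite -e mulf_div].
move=> z; split=> [[a [u [ha Mu e]]]|Oz]; last by apply: BA; exact/AO.
apply: contrapT => nz; apply: M1.
have z0 : z != 0 by apply: contraPneq nz => -> ; apply.
have iz0 : i z != 0 by rewrite fmorph_eq0.
have -> : 1 = u + a * i z^-1.
  have <- : i z * (1 - u) = a by rewrite e divfK // M1B.
  by rewrite fmorphV mulrAC mulfV // mul1r addrC subrK.
apply: MD => //; exists z^-1, a; split=> //; right; rewrite invrK; exact: nz.
Qed.

(** By maximality A[x] contains some z of K1 outside O0. The inverse of z is in the maximal ideal,
    and multiplying the expression of z by it gives 1 with coefficients in M. *)
Let max_poly x : ~ A x -> exists p : {poly K2}, (forall j, M p`_j) /\ p.[x] = 1.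
Proof.
move=> nx; apply: contrapT => none; apply: nx.
pose B : set K2 := fun z => exists p : {poly K2}, (forall j, A p`_j) /\ z = p.[x].
have BA : (A `<=` B)%classic.
  move=> a ha; exists a%:P; rewrite hornerC; split=> // j.
  by rewrite coefC; case: ifP.
suff okB : subring_over B.
  apply: (maxA okB BA); exists 'X; rewrite hornerX; split=> // j.
  by rewrite coefX; case: (_ == _).
split; first exact: BA.
- move=> _ _ [p [hp ->]] [q [hq ->]]; exists (p - q); rewrite hornerD hornerN.
  by split=> // j; rewrite coefB; exact: AB.
- move=> _ _ [p [hp ->]] [q [hq ->]]; exists (p * q); rewrite hornerM.
  split=> // j; rewrite coefM.
  by elim/big_ind: _ => [|a b ha hb|k _]; [exact: A0|exact: AD|exact: AM].
move=> z; split=> [[p [hp e]]|Oz]; last by apply: BA; exact/AO.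
apply: contrapT => nz; apply: none.
have z0 : z != 0 by apply: contraPneq nz => -> ; apply.
exists ((i z)^-1 *: p); split=> [j|].
  rewrite coefZ mulrC -fmorphV; exists z^-1, p`_j; split=> //; right.
  by rewrite invrK.
by rewrite hornerZ -e mulVf // fmorph_eq0.
Qed.

Let Q x n := exists p : {poly K2}, [/\ forall j, M p`_j, p.[x] = 1 & (size p <= n.+1)%N].

(* The relation for 1/x expresses x^(n+1) by lower powers of x, because
   1 - q_0 is invertible in A. *)
Let Q_reduce x n m : x != 0 -> Q x n -> Q x^-1 m -> (m <= n)%N ->
  exists2 n', (n' < n)%N & Q x n'.
Proof.
move=> x0 [p [Mp px sp]] [q [Mq qx sq]] mn.
case: n sp mn => [|n] sp mn.
  case: M1; rewrite -px; have -> : p.[x] = p`_0; last exact: Mp.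
  by rewrite (size1_polyC sp) hornerC coefC.
exists n => //; pose u := (1 - q`_0)^-1; pose c := p`_n.+1.
have Au : A u := max_inv (Mq 0%N).
exists (\poly_(j < n.+1) (p`_j + c * u * q`_(n.+1 - j))); split.
- move=> j; rewrite coef_poly; case: ifP => // _.
  apply: MD => //; apply: MM => //; apply: AM => //; exact/MA/Mp.
- rewrite horner_poly.
  under eq_bigr => j _ do rewrite mulrDl.
  rewrite big_split /= -[RHS]px (horner_coef_wide _ sp) [RHS]big_ord_recr /=.
  congr (_ + _); rewrite -/c.
  have -> : \sum_(j < n.+1) c * u * q`_(n.+1 - j) * x ^+ j =
      c * (u * \sum_(j < n.+1) q`_(n.+1 - j) * x ^+ j).
    by rewrite !mulr_sumr; apply: eq_bigr => j _; rewrite !mulrA.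
  congr (_ * _).
  have -> : \sum_(j < n.+1) q`_(n.+1 - j) * x ^+ j = x ^+ n.+1 * (1 - q`_0).
    have e : x ^+ n.+1 = \sum_(j < n.+2) q`_j * x ^+ (n.+1 - j).
      rewrite -[LHS]mulr1 -qx (horner_coef_wide _ (leq_trans sq _ : size q <= n.+2)%N) //.
      rewrite mulr_sumr; apply: eq_bigr => j _; rewrite mulrCA exprVn; congr (_ * _).
      have jn : (j <= n.+1)%N by rewrite -ltnS.
      by rewrite -{1}(subnK jn) exprD mulfK // expf_neq0.
    rewrite big_ord_recl in e; have {}e : x ^+ n.+1 = q`_0 * x ^+ n.+1 +
      \sum_(j < n.+1) q`_j.+1 * x ^+ (n - j) := e.
    rewrite mulrBr mulr1 [x ^+ n.+1 * q`_0]mulrC {1}e [X in X - _]addrC addrK.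
    rewrite (reindex_inj rev_ord_inj) /=; apply: eq_bigr => j _.
    by rewrite subSS subSn ?leq_subr // subKn // -ltnS.
  by rewrite mulrCA mulVf ?mulr1 // M1B.
exact: size_poly.
Qed.

Let exQmin x : ~ A x -> exists2 n, Q x n & forall m, Q x m -> (n <= m)%N.
Proof.
move=> nx; have [p [Mp px]] := max_poly nx.
have ex : exists n, `[< Q x n >].
  by exists (size p); apply/asboolP; exists p; split=> //; exact: leqnSn.
have [n /asboolP Qn hn] := ex_minnP ex; exists n => // m Qm.
by apply: hn; apply/asboolP.
Qed.

(** If x and 1 / x both lay outside A, each would satisfy a relation of least degree, and the one of
    smaller degree would shorten the other. *)
Lemma maximal_valring : valring A.
Proof.
split=> // x; apply: contrapT => /not_orP[nx nVx].
have x0 : x != 0 by apply: contraPneq nx => ->; apply.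
have [n Qn minn] := exQmin nx; have [m Qm minm] := exQmin nVx.
have [mn|/ltnW nm] := leqP m n.
  by have [n' lt /minn] := Q_reduce x0 Qn Qm mn; rewrite leqNgt lt.
have Vx0 : x^-1 != 0 by rewrite invr_eq0.
have Qn' : Q x^-1^-1 n by rewrite invrK.
by have [n' lt /minm] := Q_reduce Vx0 Qm Qn' nm; rewrite leqNgt lt.
Qed.

End Maximal.

Theorem valring_extension : exists2 O : set K2, valring O & forall x, O (i x) <-> O0 x.
Proof.
have [A okA maxA] := subring_over_max; exists A; first exact: maximal_valring maxA.
by case: okA.
Qed.

End Chevalley.

(** * Valuation rings in a finite extension *)

(** For x not good, [gauss] applied to an algebraic equation of x makes every term vanish, the
    leading one included. *)
Lemma algebraic_good (E K : fieldType) (iota : {rmorphism E -> K}) (v : valuation E)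
    (w : extension iota v) x :
  x != 0 -> algebraicOver iota x -> good w x.
Proof.
move=> x0 [p p0 px]; apply: contrapT => bx.
have hc (i : 'I_(size p)) : iota p`_i = 0 \/ good w (iota p`_i).
  have [->|pi0] := eqVneq p`_i 0; first by left; rewrite rmorph0.
  by right; exact: good_iota.
have e : \sum_(i < size p) iota p`_i * x ^+ i = 0.
  rewrite -[RHS](rootP px) horner_coef size_map_poly.
  by apply: eq_bigr => i _; rewrite coef_map.
have lt : ((size p).-1 < size p)%N by rewrite ltn_predL size_poly_gt0.
have := gauss x0 bx hc (Ordinal lt); rewrite e dv0l /= mulf_eq0 fmorph_eq0.
by rewrite -lead_coefE lead_coef_eq0 (negPf p0) expf_eq0 (negPf x0) andbF.
Qed.

(** * Approximation for pairwise incomparable valuation rings *)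

Section Approximation.
Variables (L : fieldType) (r : nat) (ws : 'I_r -> valuation L).
Hypothesis unit2 : forall k, eqv (ws k) 1 2.

(* As 2 is a unit, z^N / (1 + z^N) works as soon as z^N has residue 1 wherever
   the residue of z is a root of unity. *)
Lemma approx_power z : z != 0 -> exists e, forall k,
  [/\ dv (ws k) 1 e, sdv (ws k) 1 z -> sdv (ws k) 1 e &
      sdv (ws k) 1 z^-1 -> sim (ws k) 1 e].
Proof.
move=> z0.
have /boolp.choice[n hn] : forall k, exists n, (0 < n)%N /\
    (res (ws k) z ^+ n = 1 \/ forall m, (0 < m)%N -> res (ws k) z ^+ m <> 1).
  move=> k; have [[n [n0 h]]|none] := EM (exists n, (0 < n)%N /\ res (ws k) z ^+ n = 1).
    by exists n; split=> //; left.
  by exists 1%N; split=> //; right=> m m0 h; apply: none; exists m.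
pose N := (\prod_k n k)%N.
have N0 : (0 < N)%N by apply: prodn_gt0 => k; case: (hn k).
have u k : dv (ws k) 1 z -> eqv (ws k) 1 (1 + z ^+ N).
  move=> zk; apply: res_neq0.
  have zN : dv (ws k) 1 (z ^+ N) by rewrite -[X in dv _ X _](expr1n _ N) dvX.
  rewrite resD ?dv_refl // res1 resX //.
  have [_ [h|h]] := hn k.
    rewrite /N (bigD1 k) //= exprM h expr1n -res1 -resD ?dv_refl //.
    exact/eqv1_res/unit2.
  apply/eqP => /eqP; rewrite addrC addr_eq0 => /eqP hN.
  by apply: (h (N * 2)%N); rewrite ?muln_gt0 ?N0 // exprM hN sqrrN expr1n.
exists (z ^+ N / (1 + z ^+ N)) => k.
have [zk|zk] := boolP (dv (ws k) 1 z).
  have uk := u k zk; have /andP[duk _] := eqv1V uk.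
  have zN : dv (ws k) 1 (z ^+ N) by rewrite -[X in dv _ X _](expr1n _ N) dvX.
  split.
  - by rewrite -[X in dv _ X _]mulr1 dvM.
  - move=> sz; apply: sdv1M => //.
    rewrite -(prednK N0) exprS; apply: sdv1M => //.
    by rewrite -[X in dv _ X _](expr1n _ N.-1) dvX.
  by rewrite sdvE -[X in dv _ _ X]invr1 dvV ?oner_neq0 // zk.
have sz : sdv (ws k) 1 z^-1.
  by rewrite sdvE -[X in dv _ _ X]invr1 dvV ?oner_neq0.
have sN : sdv (ws k) 1 (z^-1 ^+ N).
  rewrite -(prednK N0) exprS; apply: sdv1M => //.
  by rewrite -[X in dv _ X _](expr1n _ N.-1) dvX // sdvW.
have zN0 : z ^+ N != 0 by rewrite expf_neq0.
have h1 := sim_add sN.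
have s1 : sim (ws k) 1 (z ^+ N / (1 + z ^+ N)).
  have -> : z ^+ N / (1 + z ^+ N) = (1 + z^-1 ^+ N)^-1.
    by rewrite -invf_div mulrDl mul1r mulfV // exprVn addrC.
  by rewrite -[X in sim _ X _]invr1; apply: simV; exact: sim_sym.
split=> //; first by rewrite -(sim_dvr _ s1) dv_refl.
by move=> sz'; case/negP: zk; exact: sdvW.
Qed.

Hypothesis incomp : forall i j, i != j ->
  exists a, a \in vring (ws i) /\ a \notin vring (ws j).

(** With a in the j-th ring but not in the i-th, and b the other way round, a / b is in the j-th
    maximal ideal and its inverse in the i-th. [approx_power] turns it into an element integral
    everywhere, and the product over j is the required one. *)
Lemma approx_delta i : exists x,
  sim (ws i) 1 x /\ forall j, dv (ws j) 1 x /\ (j != i -> sdv (ws j) 1 x).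
Proof.
have sep j : j != i -> exists e, (forall k, dv (ws k) 1 e) /\
    sdv (ws j) 1 e /\ sim (ws i) 1 e.
  move=> ji; have [a [aj ai]] := incomp ji.
  have [b [bi bj]] : exists b, b \in vring (ws i) /\ b \notin vring (ws j).
    by apply: incomp; rewrite eq_sym.
  have a0 : a != 0 by apply: contraNneq ai => ->; rewrite rpred0.
  have b0 : b != 0 by apply: contraNneq bj => ->; rewrite rpred0.
  have sV k c : c != 0 -> c \notin vring (ws k) -> sdv (ws k) 1 c^-1.
    by move=> c0; rewrite sdvE -[X in dv _ _ X]invr1 dvV ?oner_neq0 // dv1.
  have [|e he] := @approx_power (a / b); first by rewrite mulf_neq0 ?invr_eq0.
  exists e; split; first by move=> k; case: (he k).
  have [_ h _] := he j; have [_ _ h'] := he i; split.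
    by apply: h; rewrite mulrC; apply: sdv1M; [exact: sV|rewrite dv1].
  by apply: h'; rewrite invf_div mulrC; apply: sdv1M; [exact: sV|rewrite dv1].
have /boolp.choice[e he] : forall j, exists e, j != i -> (forall k, dv (ws k) 1 e) /\
    sdv (ws j) 1 e /\ sim (ws i) 1 e.
  move=> j; have [->|ji] := eqVneq j i; first by exists 0.
  by have [e h] := sep j ji; exists e.
exists (\prod_(j | j != i) e j); split.
  elim/big_rec: _ => [|j x ji hx]; first by rewrite sim_refl ?oner_neq0.
  by rewrite -[X in sim _ X _]mulr1; apply: simM => //; case: (he j ji) => _ [].
move=> j; have d1 (P : pred 'I_r) : (forall k, P k -> k != i) ->
    dv (ws j) 1 (\prod_(k | P k) e k).
  move=> hP; elim/big_rec: _ => [|k x Pk hx]; first exact: dv_refl.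
  by rewrite -[X in dv _ X _]mulr1 dvM //; case: (he k (hP k Pk)).
split=> [|ji]; first exact: d1.
rewrite (bigD1 j) //=; apply: sdv1M; first by case: (he j ji) => _ [].
by apply: d1 => k /andP[].
Qed.

End Approximation.

Section Count.
Variables (K : fieldType) (L : fieldExtType K) (V : set K).

Lemma fieldExt_algebraic (x : L) : algebraicOver (in_alg L) x.
Proof.
have /polyOver1P[p e] := minPolyOver 1 x.
exists p; last by rewrite -e root_minPoly.
by rewrite -(map_poly_eq0 (in_alg L)) -e monic_neq0 ?monic_minPoly.
Qed.

(* Elements that are 1 modulo one maximal ideal and lie in all the others are
   linearly independent over K, so there are at most [L : K] extensions. *)
Lemma finite_valring_extensions : V 2^-1 -> (2 != 0 :> K) ->
  finite_set [set O : set L | valring O /\ forall a, O a%:A <-> V a].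
Proof.
move=> V2 n20; set S := [set O | _]%classic; apply: contrapT => infS.
have /infiniteP/pcard_leP[f] : infinite_set S by exact: infS.
have fS n : S (f n) by apply: funS.
have f_inj n m : f n = f m -> n = m by apply: inj; rewrite in_setT.
have hV : valring V.
  have [[h1 h2 h3 h4] hV] := fS 0%N.
  split=> [|x y /hV hx /hV hy|x y /hV hx /hV hy|x].
  - by apply/hV; rewrite scale1r.
  - by apply/hV; rewrite scalerBl; exact: h2.
  - by apply/hV; rewrite -[_ *: _]/(in_alg L (x * y)) rmorphM; exact: h3.
  by case: (h4 x%:A) => h; [left|right]; apply/hV; rewrite -?[_ *: _]/(in_alg L x^-1) ?fmorphV.
pose v := valuation_of hV.
have vr n : valring (f n) by case: (fS n).
have hv n a : f n (in_alg L a) <-> a \in vring v.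
  have [_ h] := fS n; split=> [/h fa|/valuation_ofE fa]; last exact/h.
  exact/valuation_ofE.
pose w n : extension (in_alg L) v := extension_of (vr n) (hv n).
have wE n x : (x \in vring (w n)) <-> f n x by exact: valuation_ofE.
(* Two extensions of V, one inside the other, are equal: a power of x is an element a of K times a
   unit of the smaller ring. If x is in the larger ring then so is a, which is thus in V, and x is
   in the smaller ring. *)
have incomp n m : n != m -> exists a, a \in vring (w n) /\ a \notin vring (w m).
  move=> nm; apply: contrapT => none.
  have sub x : x \in vring (w n) -> x \in vring (w m).
    by move=> xn; apply/negPn/negP => xm; apply: none; exists x.
  have sub' x : x \in vring (w m) -> x \in vring (w n).
    move=> xm; have [->|x0] := eqVneq x 0; first exact: rpred0.
    have [_ [N [a [N0 a0 ua _]]]] : good (w n) x.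
      by apply: algebraic_good => //; exact: fieldExt_algebraic.
    have u'm : dv (w m) 1 (x ^+ N / in_alg L a)^-1.
      by rewrite dv1; apply: sub; rewrite -dv1; case/andP: (eqv1V ua).
    have am : dv (w m) 1 (in_alg L a).
      have -> : in_alg L a = x ^+ N / (x ^+ N / in_alg L a).
        by rewrite invf_div mulrC divfK // expf_neq0.
      rewrite -[X in dv _ X _]mulr1; apply: dvM => //.
      by rewrite dv1 rpredX.
    have an : dv (w n) 1 (in_alg L a).
      by move: am; rewrite !dv1 !extension_vring.
    apply: contraT => xn.
    have : dv (w n) 1 (x ^+ N).
      rewrite -[x ^+ N](divfK (_ : in_alg L a != 0)) ?fmorph_eq0 //.
      by rewrite -[X in dv _ X _]mulr1 dvM //; case/andP: ua.
    have sx : sdv (w n) x 1 by rewrite sdvE dv1.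
    have := sdvM (c := x ^+ N.-1) (d := 1) sx; rewrite mulr1 -exprS prednK //.
    rewrite sdvE => h /negPn; rewrite h ?expf_neq0 //.
    by rewrite -[X in dv _ _ X](expr1n _ N.-1) dvX // sdvW.
  case/eqP: nm; apply: f_inj; apply/seteqP; split=> x /wE h; apply/wE.
    exact: sub.
  exact: sub'.
pose d := \dim {:L}; pose B := vbasis {:L}; pose ws (k : 'I_d.+1) : valuation L := w k.
have u2 k : eqv (ws k) 1 2.
  have e : (2 : L) = in_alg L 2 by rewrite rmorph_nat.
  rewrite e -[X in eqv _ X _](rmorph1 (in_alg L)) eqvE !dv_iota.
  apply/andP; split; first by rewrite dv1; exact: rpred_nat.
  by rewrite dvE oner_eq0 n20 /= div1r; exact/valuation_ofE.
have inc (i j : 'I_d.+1) : i != j -> exists a, a \in vring (ws i) /\ a \notin vring (ws j).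
  by move=> ij; exact: incomp.
have /boolp.choice[x hx] := approx_delta u2 inc.
pose M := \matrix_(i < d.+1, j < d) coord B j (x i).
have [c cM [[i0 ci0] c1]] := scaled_dependence v M (ltnSn _).
have hc : \sum_i c 0 i *: x i = 0.
  rewrite [LHS](coord_vbasis (memvf _)) big1 // => j _.
  have -> : coord B j (\sum_i c 0 i *: x i) = (c *m M) 0 j.
    rewrite linear_sum mxE; apply: eq_bigr => i _.
    by rewrite linearZ mxE.
  by rewrite cM mxE scale0r.
have [s0 _] := hx i0.
(* Read at the place i0, the relation expresses x_i0 by integral multiples of elements of the
   maximal ideal, although its residue is 1. *)
have : sdv (ws i0) 1 (x i0).
  have -> : x i0 = - \sum_(i | i != i0) c 0 i *: x i.
    by apply/eqP; rewrite -addr_eq0; apply/eqP; rewrite -[RHS]hc [RHS](bigD1 i0) //= ci0 scale1r.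
  rewrite sdvNr; apply: sdv_sum; first exact: oner_neq0.
  move=> i ii0; have [_ /(_ i0)[_ h]] := hx i.
  rewrite -mulr_algl mulrC; apply: sdv1M; first by apply: h; rewrite eq_sym.
  by rewrite -[X in dv _ X _](rmorph1 (in_alg L)) -[_ *: _]/(in_alg L (c 0 i)) dv_iota.
by rewrite sdvE; case/andP: (sim_eqv s0) => _ ->.
Qed.

End Count.

(** * Split polynomials *)

Section SplitLevel.
Variables (E : fieldType) (L : fieldExtType E) (M : fieldType).
Variables (iota : {rmorphism E -> M}) (v : valuation E) (w : extension iota v).
Variable ev : {rmorphism {poly L} -> M}.
Hypothesis ev_inj : forall p : {poly L}, p != 0 -> ev p != 0.
Hypothesis evC : forall a : E, ev (a%:A)%:P = iota a.

Local Notation dv := (dv w).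
Local Notation sdv := (sdv w).
Local Notation eqv := (eqv w).
Local Notation sim := (sim w).
Local Notation good := (@good _ _ _ _ w).
Local Notation lin a := (ev ('X - a%:P)).
Local Notation cst a := (ev a%:P).

Lemma cst_good (a : L) : a != 0 -> good (cst a).
Proof.
move=> a0; apply: algebraic_good; first by rewrite ev_inj // polyC_eq0.
have [p p0 pa] := fieldExt_algebraic a; exists p => //.
have -> : map_poly iota p = map_poly (ev \o polyC) (map_poly (in_alg L) p).
  by rewrite -map_poly_comp; apply: eq_map_poly => b /=; rewrite evC.
by rewrite -[cst a]/((ev \o polyC) a) rootE horner_map /= (rootP pa) rmorph0.
Qed.

Lemma cst_good0 (a : L) : cst a = 0 \/ good (cst a).
Proof. by have [->|/cst_good] := eqVneq a 0; [left; rewrite rmorph0|right]. Qed.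

Lemma lin_neq0 (a : L) : lin a != 0. Proof. by rewrite ev_inj ?polyXsubC_eq0. Qed.

Lemma natr_dv n : dv 1 n%:R.
Proof. by rewrite dv1; exact: rpred_nat. Qed.

(** * Taylor expansion at a center a with X - a not good *)

Section Center.
Variables (a : L) (bad : ~ good (lin a)).
Local Notation Z := (lin a).

Definition taylor (p : {poly L}) := p \Po ('X + a%:P).
Local Notation tc p i := (cst (taylor p)`_i * Z ^+ i).

Lemma ev_taylor N (p : {poly L}) : (size p <= N)%N -> ev p = \sum_(i < N) tc p i.
Proof.
move=> sp; have e : p = taylor p \Po ('X - a%:P).
  by rewrite /taylor -comp_polyA comp_polyD comp_polyX comp_polyC subrK comp_polyXr.
have st : (size (taylor p) <= N)%N by rewrite size_comp_poly2 // size_XaddC.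
rewrite {1}e comp_polyE (big_ord_widen N (fun i => (taylor p)`_i *: ('X - a%:P) ^+ i)) //.
rewrite rmorph_sum big_mkcond /=; apply: eq_bigr => i _.
case: ltnP => h; first by rewrite -mul_polyC rmorphM rmorphXn.
by rewrite nth_default // polyC0 rmorph0 mul0r.
Qed.

Lemma dv_taylor (p : {poly L}) i : dv (ev p) (tc p i).
Proof.
have lt : (i < maxn (size p) i.+1)%N by rewrite leq_max ltnSn orbT.
rewrite (ev_taylor (leq_maxl (size p) i.+1)).
have := gauss (lin_neq0 a) bad (c := fun i : 'I_(maxn (size p) i.+1) => cst (taylor p)`_i).
by move=> /(_ (fun j => cst_good0 _))/(_ (Ordinal lt)).
Qed.

(** A good polynomial is equivalent to its constant Taylor coefficient. Subtracting that leaves a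
    polynomial of strictly larger value with the same higher coefficients. *)
Lemma good_taylor (p : {poly L}) i : good (ev p) -> (0 < i)%N -> sdv (ev p) (tc p i).
Proof.
move=> gp i0; set c0 := (taylor p)`_0.
have h0 : sim (ev p) (cst c0).
  have e := ev_taylor (leqnSn (size p)); rewrite {1}e.
  apply: (gauss_good (c := fun i : 'I_(size p).+1 => cst (taylor p)`_i)) => //.
  - exact: lin_neq0.
  - by move=> j; exact: cst_good0.
  by rewrite -e.
have := dv_taylor (p - c0%:P) i.
rewrite rmorphB /= /taylor comp_polyB comp_polyC coefB coefC -[i == 0%N]negbK -lt0n i0 /=.
by rewrite subr0; apply: sdv_dv_trans; rewrite -simE.
Qed.

(** The last dominant Taylor index, which plays the role of the number of zeros in the disc around a
    (the Weierstrass degree). *)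
Lemma top_index (p : {poly L}) : p != 0 -> exists r,
  eqv (ev p) (tc p r) /\ forall i, (r < i)%N -> sdv (ev p) (tc p i).
Proof.
move=> p0; pose Q i := dv (tc p i) (ev p).
have exQ : exists i, Q i.
  apply: contrapT => none.
  have : sdv (ev p) (ev p); last by rewrite sdvE dv_refl.
  rewrite {2}(ev_taylor (leqnn _)); apply: sdv_sum; first exact: ev_inj.
  by move=> i _; rewrite sdvE; apply/negP => h; apply: none; exists i.
have bQ i : Q i -> (i <= size p)%N.
  move=> Qi; rewrite leqNgt; apply/negP => lt; move: Qi; rewrite /Q nth_default.
    by rewrite polyC0 rmorph0 mul0r dv0l (negPf (ev_inj p0)).
  by rewrite /taylor size_comp_poly2 ?size_XaddC // ltnW.
have [r Qr hr] := ex_maxnP exQ bQ; exists r; split; first by rewrite eqvE dv_taylor.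
by move=> i lt; rewrite sdvE; apply/negP => /hr; rewrite leqNgt lt.
Qed.

Lemma bad_top_gt0 (p : {poly L}) r : ~ good (ev p) -> p != 0 ->
  (forall i, (r < i)%N -> sdv (ev p) (tc p i)) -> (0 < r)%N.
Proof.
move=> bp p0 hr; rewrite lt0n; apply/eqP => r0; apply: bp; subst r.
have e : ev p - cst (taylor p)`_0 = \sum_(i < size p) tc p i.+1.
  by rewrite (ev_taylor (leqnSn _)) big_ord_recl expr0 mulr1 addrC addKr.
have h : sim (ev p) (cst (taylor p)`_0).
  rewrite simE e; apply: sdv_sum; first exact: ev_inj.
  by move=> i _; exact: hr.
apply: sim_good (sim_sym h) _; case: (cst_good0 (taylor p)`_0) => // e0.
by move: (sim_neq0r h); rewrite e0 eqxx.
Qed.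

Lemma taylorM (p q : {poly L}) n :
  tc (p * q) n = \sum_(i < n.+1) tc p i * tc q (n - i).
Proof.
rewrite /taylor comp_polyM coefM rmorph_sum rmorph_sum mulr_suml /=.
apply: eq_bigr => i _; rewrite !rmorphM /= mulrACA -exprD subnKC //.
by rewrite -ltnS.
Qed.

(* A polynomial dominated by its linear Taylor term cannot be, up to a good
   summand, a product of two bad factors: top indices add up. *)
Lemma linear_factor_good (h q P R : {poly L}) c : h = q * P + R ->
  dv (ev h) (ev R) -> R = 0 \/ good (ev R) -> sim (ev h) (cst c * Z) ->
  ~ good (ev P) -> P != 0 -> q != 0 -> good (ev q).
Proof.
move=> hE hR gR hs bP P0 q0; apply: contrapT => bq.
have bh : ~ good (ev h).
  move=> gh; apply: bad; have := sim_good hs gh.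
  have cz0 : cst c * Z != 0 := sim_neq0r hs.
  have c0 : c != 0 by apply: contraNneq cz0 => ->; rewrite polyC0 rmorph0 mul0r.
  move=> g; have -> : Z = (cst c * Z) / cst c.
    by rewrite mulrAC mulfV ?mul1r // ev_inj // polyC_eq0.
  by apply: good_div => //; exact: cst_good.
have [r [qr hr]] := top_index q0; have [s [Ps hs']] := top_index P0.
have r0 := bad_top_gt0 bq q0 hr; have s0 := bad_top_gt0 bP P0 hs'.
have n2 : (1 < r + s)%N by rewrite -addn1 leq_add.
have rs_le : (r < (r + s).+1)%N by rewrite ltnS leq_addr.
have qP0 : ev q * ev P != 0 by rewrite mulf_neq0 // ev_inj.
have main : eqv (ev q * ev P) (tc (q * P) (r + s)).
  rewrite taylorM (bigD1 (Ordinal rs_le)) //= addKn.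
  have e1 : eqv (ev q * ev P) (tc q r * tc P s) by exact: eqvM.
  apply: (eqv_trans e1); rewrite eqv_sym; apply: sim_eqv; apply: sim_add.
  have t0 : tc q r * tc P s != 0 by rewrite -(eqv_neq0 e1).
  apply: sdv_sum => // i ir.
  apply: (@dv_sdv_trans _ _ (ev q * ev P)); first by case/andP: e1.
  have [lt|ge] := ltnP r i.
    by apply: sdvM (hr i lt) (dv_taylor _ _) (ev_inj P0).
  have {}lt : (i < r)%N.
    rewrite ltn_neqAle ge andbT; apply: contraNneq ir => e.
    exact/eqP/val_inj.
  rewrite mulrC [X in sdv _ X]mulrC; apply: sdvM (dv_taylor _ _) (ev_inj q0).
  by apply: hs'; rewrite ltn_subRL ltn_add2r.
(* Subtracting c (X - a) from h strictly increases its value and leaves the coefficients of index at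
   least 2 unchanged. *)
have hn : sdv (ev h) (tc h (r + s)).
  have := dv_taylor (h - c *: ('X - a%:P)) (r + s).
  have e : tc (h - c *: ('X - a%:P)) (r + s) = tc h (r + s).
    rewrite /taylor comp_polyB comp_polyZ comp_polyB comp_polyX comp_polyC addrK.
    by rewrite coefB coefZ coefX gtn_eqF // mulr0 subr0.
  rewrite e; apply: sdv_dv_trans.
  by rewrite rmorphB -mul_polyC rmorphM /= -simE.
have Rn : sdv (ev h) (tc R (r + s)).
  case: gR => [->|gR].
    rewrite /taylor comp_poly0 coef0 polyC0 rmorph0 mul0r sdvr0.
    exact: sim_neq0 hs.
  by apply: dv_sdv_trans hR _; apply: good_taylor => //; exact: ltnW.
(* The term of index r + s in q P is a difference of negligible terms of h and R, yet it has the
   value of q P. So q P is negligible and h is equivalent to R, a contradiction since h is not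
   good. *)
have hqP : sdv (ev h) (ev q * ev P).
  apply: (@sdv_dv_trans _ _ (tc (q * P) (r + s))); last by rewrite eqv_sym in main; case/andP: main.
  have -> : tc (q * P) (r + s) = tc h (r + s) - tc R (r + s).
    by rewrite -mulrBl -rmorphB -polyCB -coefB -comp_polyB hE addrK.
  exact: sdvB.
have hsR : sim (ev h) (ev R) by rewrite simE -rmorphB {2}hE addrK rmorphM.
apply: bh; case: gR => [e|gR].
  by move: (sim_neq0r hsR); rewrite e rmorph0 eqxx.
exact: sim_good (sim_sym hsR) gR.
Qed.

Lemma taylor_derivn (p : {poly L}) k : taylor p^`(k) = (taylor p)^`(k).
Proof.
elim: k => [|k IHk]; first by rewrite !derivn0.
rewrite !derivnS -IHk /taylor deriv_comp derivD derivX derivC addr0 mulr1.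
by [].
Qed.

(** Differentiation multiplies Taylor coefficients by integers, which are integral, so strictly
    dominated terms stay dominated; the leading term survives because [m ^_ k] is a unit. *)
Lemma sim_derivn (p : {poly L}) c m k : sim (ev p) (cst c * Z ^+ m) -> (k <= m)%N ->
  eqv 1 (m ^_ k)%:R ->
  sim (ev p^`(k) * Z ^+ k) ((m ^_ k)%:R * (cst c * Z ^+ m)).
Proof.
move=> hs km um; set C := cst c * Z ^+ m in hs *.
have C0 := sim_neq0r hs.
have coef i : sdv C (cst ((taylor p)`_i - (i == m)%:R * c) * Z ^+ i).
  have := dv_taylor (p - c *: ('X - a%:P) ^+ m) i.
  rewrite /taylor comp_polyB comp_polyZ rmorphXn /= comp_polyB comp_polyX comp_polyC addrK.
  rewrite coefB coefZ coefXn [c * _]mulrC; apply: sdv_dv_trans.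
  rewrite rmorphB -mul_polyC rmorphM rmorphXn /= -/C.
  by have := sim_sym hs; rewrite simE -sdvNr opprB.
pose N := maxn (size p) m.+1.
have mN : (m - k < N)%N by rewrite (leq_ltn_trans (leq_subr _ _)) // leq_max ltnSn orbT.
have sN : (size p^`(k) <= N)%N.
  apply: leq_trans (leq_maxl _ _); apply/leq_sizeP => j hj.
  by rewrite coef_derivn nth_default ?mul0rn // (leq_trans hj) // leq_addl.
have uC : eqv C ((m ^_ k)%:R * C).
  by rewrite -{1}[C]mul1r; apply: eqvM => //; exact: eqv_refl.
apply: sim_sym; rewrite simE -sdvNr opprB.
apply: dv_sdv_trans (_ : dv _ C) _; first by rewrite eqv_sym in uC; case/andP: uC.
have -> : ev p^`(k) * Z ^+ k - (m ^_ k)%:R * C = \sum_(j < N)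
    ((k + j) ^_ k)%:R * (cst ((taylor p)`_(k + j) - (k + j == m)%N%:R * c) * Z ^+ (k + j)).
  under [RHS]eq_bigr => j _ do rewrite rmorphB rmorphB /= mulrBl mulrBr.
  rewrite sumrB; congr (_ - _).
    rewrite (ev_taylor sN) mulr_suml; apply: eq_bigr => j _.
    rewrite taylor_derivn coef_derivn -[_ *+ _ in LHS]mulr_natr polyCM rmorphM /=.
    by rewrite polyC_natr rmorph_nat exprD; ring.
  rewrite (bigD1 (Ordinal mN)) //= subnKC // eqxx mul1r big1 ?addr0 // => j jm.
  rewrite (_ : (k + j == m)%N = false) ?mul0r ?polyC0 ?rmorph0 ?mul0r ?mulr0 //.
  apply: contraNF jm => /eqP e; apply/eqP/val_inj => /=.
  by rewrite -e addKn.
apply: sdv_sum => // j _; rewrite mulrC -[C]mulr1; apply: sdvM; rewrite ?oner_neq0 //.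
exact: natr_dv.
Qed.

End Center.

(** * The leading form of f at a non-exceptional valuation *)

Section Roots.
Variable rs : seq L.

(** In X - b = (X - a) + (a - b) the two summands have different values, so each factor is
    equivalent to X - a or to a constant; m counts the former. *)
Lemma single_class a : ~ good (lin a) ->
  (forall b, b \in rs -> b != a -> ~~ eqv (lin a) (cst (a - b))) ->
  exists m c, [/\ (m <= size rs)%N, c != 0 &
    sim (ev (\prod_(b <- rs) ('X - b%:P))) (cst c * lin a ^+ m)].
Proof.
move=> bad; elim: rs => [|b s IHs] hs.
  exists 0%N, 1; rewrite big_nil oner_neq0 polyC1 rmorph1 expr0 mulr1.
  by split=> //; apply: sim_refl; exact: oner_neq0.
have [|m [c [ms c0 hm]]] := IHs.
  by move=> b' b's; apply: hs; rewrite inE b's orbT.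
have linb : lin b = lin a + cst (a - b).
  by rewrite -rmorphD polyCB addrA subrK.
have [e|ba] := eqVneq b a.
  exists m.+1, c; rewrite ltnS ms c0 big_cons rmorphM /= e exprS mulrCA.
  by split=> //; apply: simM => //; apply: sim_refl; exact: lin_neq0.
have d0 : a - b != 0 by rewrite subr_eq0 eq_sym.
have [h|h] := orP (eqvN (hs b (mem_head _ _) ba)).
  exists m.+1, c; rewrite ltnS ms c0 big_cons rmorphM /= exprS mulrCA.
  by split=> //; apply: simM => //; rewrite linb; exact: sim_add.
exists m, ((a - b) * c); rewrite (leqW ms) mulf_neq0 // big_cons rmorphM /=.
rewrite polyCM rmorphM /= -mulrA; split=> //; apply: simM => //.
by rewrite linb addrC; exact: sim_add.
Qed.

Variables (f : {poly E}) (lc : L).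
Local Notation mp p := (map_poly (in_alg L) p).
Hypothesis lc0 : lc != 0.
Hypothesis f_split : mp f = lc *: \prod_(b <- rs) ('X - b%:P).
Hypothesis fact_unit : forall m, (m <= size rs)%N -> eqv 1 (m`!)%:R.
Hypothesis nonexc : forall a b, a \in rs -> b \in rs -> b != a ->
  ~ good (lin a) -> ~~ eqv (lin a) (cst (a - b)).

(** The root a and the leading constant lie in L, but the statement mentions only f and its
    derivatives and can be carried back to E. Its last clause, [linear_factor_good] for polynomials
    over E, is what the odd case needs about the division of f^(m-1) by the key polynomial. *)
Lemma nonexceptional_shape : good (ev (mp f)) \/ exists m,
  [/\ (0 < m <= size rs)%N, good (ev (mp f^`(m))), ~ good (ev (mp f^`(m.-1))),
      sim ((m`!)%:R * ev (mp f))
        (ev (mp f^`(m)) * (ev (mp f^`(m.-1)) / ev (mp f^`(m))) ^+ m) &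
      forall q P R : {poly E}, f^`(m.-1) = q * P + R ->
        dv (ev (mp f^`(m.-1))) (ev (mp R)) -> R = 0 \/ good (ev (mp R)) ->
        ~ good (ev (mp P)) -> P != 0 -> good (ev (mp q))].
Proof.
have evf : ev (mp f) = cst lc * ev (\prod_(b <- rs) ('X - b%:P)).
  by rewrite f_split -mul_polyC rmorphM.
have [gf|bf] := EM (good (ev (mp f))); first by left.
have [a ars bad] : exists2 a, a \in rs & ~ good (lin a).
  apply: contrapT => none; apply: bf; rewrite evf; apply: goodM; first exact: cst_good.
  rewrite rmorph_prod big_seq; elim/big_rec: _ => [|b x brs gx]; first exact: good1.
  by apply: goodM => //; apply: contrapT => bb; apply: none; exists b.
right; have [m [c [ms c0 hm]]] := single_class bad (fun b brs ba => nonexc ars brs ba bad).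
have hf : sim (ev (mp f)) (cst (lc * c) * lin a ^+ m).
  rewrite evf polyCM rmorphM /= -mulrA; apply: simM => //.
  by apply: sim_refl; rewrite ev_inj // polyC_eq0.
have lcc0 : lc * c != 0 by rewrite mulf_neq0.
have Z0 := lin_neq0 a; have u := fact_unit ms.
set C := cst (lc * c) in hf; have gC : good C by exact: cst_good.
have C0 := good_neq0 gC.
have m_gt0 : (0 < m)%N.
  rewrite lt0n; apply/eqP => m0; apply: bf; apply: sim_good (sim_sym hf) _.
  by rewrite m0 expr0 mulr1.
have um : eqv 1 (m ^_ m)%:R by rewrite ffactnn.
have fm1 : m ^_ m.-1 = m`!.
  by case: (m) m_gt0 => // k _; rewrite -ffactnn ffactnSr subSnn muln1.
have um1 : eqv 1 (m ^_ m.-1)%:R by rewrite fm1.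
have := sim_derivn bad hf (leqnn m) um; have := sim_derivn bad hf (leq_pred m) um1.
rewrite fm1 ffactnn !derivn_map; set h := ev (mp f^`(m.-1)); set rho := ev (mp f^`(m)).
set Z := lin a in Z0 hf *; set N := (m`!)%:R; rewrite -/N in u.
move=> hh hrho; have N0 := eqv1_neq0 u.
have gN : good N.
  rewrite /N -(rmorph_nat iota); apply: good_iota.
  by move: N0; rewrite /N -(rmorph_nat iota) fmorph_eq0.
have srho : sim rho (N * C).
  have := simM hrho (sim_refl w (_ : (Z ^+ m)^-1 != 0)); rewrite mulrA !mulfK ?expf_neq0 //.
  by apply; rewrite invr_eq0 expf_neq0.
have sh : sim h (N * C * Z).
  have := simM hh (sim_refl w (_ : (Z ^+ m.-1)^-1 != 0)).
  rewrite mulfK ?expf_neq0 // -{2}(prednK m_gt0) exprS !mulrA mulfK ?expf_neq0 //.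
  by apply; rewrite invr_eq0 expf_neq0.
have grho : good rho by apply: sim_good (sim_sym srho) _; exact: goodM.
have bh : ~ good h.
  move=> gh; apply: bad; have g := sim_good sh gh.
  have -> : lin a = (N * C * Z) / (N * C) by rewrite mulrAC mulfV ?mul1r // mulf_neq0.
  by apply: good_div => //; exact: goodM.
exists m; rewrite m_gt0 ms; split=> //.
  have rho0 := good_neq0 grho.
  have s1 : sim (rho * (h / rho) ^+ m) (N * C * (Z ^+ m)).
    apply: simM => //; apply: simX; have := simM sh (simV srho).
    by rewrite mulrAC mulfV ?mul1r // mulf_neq0.
  by apply: sim_trans (sim_sym s1); rewrite -mulrA; apply: simM => //; exact: sim_refl.
move=> q P R hE hR gR bP P0.
have q0 : q != 0.
  apply/eqP => q0; move: hE; rewrite q0 mul0r add0r => e; rewrite -e in gR.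
  case: gR => [e0|//]; move: (sim_neq0 sh).
  by rewrite /h e0 !rmorph0 eqxx.
have hE' : mp f^`(m.-1) = mp q * mp P + mp R by rewrite hE rmorphD rmorphM.
apply: (linear_factor_good bad (c := (m`!)%:R * (lc * c)) hE' hR _ _ bP).
- by case: gR => [->|]; [left; rewrite rmorph0|right].
- by rewrite polyCM rmorphM /= polyC_natr rmorph_nat.
- by rewrite map_poly_eq0.
by rewrite map_poly_eq0.
Qed.

End Roots.
End SplitLevel.

(** * Splitting fields and fraction fields *)

(** Induction on the degree: a factor of least degree among the nonconstant ones is irreducible, and
    one of its roots is adjoined and split off. *)
Lemma splitting_ext (E : fieldType) (f : {poly E}) : f != 0 ->
  exists (L : fieldExtType E) (rs : seq L) (lc : L), [/\ lc != 0,
    map_poly (in_alg L) f = lc *: \prod_(b <- rs) ('X - b%:P) &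
    size rs = (size f).-1].
Proof.
have [n] := ubnP (size f); elim: n E f => // n IHn E f sf f0.
have [s1|s1] := leqP (size f) 1.
  exists (E^o : fieldExtType E), [::], (in_alg E^o f`_0).
  rewrite big_nil fmorph_eq0; split.
  - by move: f0; rewrite [f](size1_polyC s1) polyC_eq0 coefC.
  - by rewrite [f](size1_polyC s1) coefC map_polyC -mul_polyC mulr1.
  by move: s1; case: (size f) => [|[]].
pose Q k := `[< exists2 p : {poly E}, p %| f & (1 < size p)%N && (size p == k) >].
have exQ : exists k, Q k by exists (size f); apply/asboolP; exists f; rewrite ?dvdpp ?s1 ?eqxx.
have [k /asboolP[p pf /andP[p1 /eqP pk]] mink] := ex_minnP exQ.
have p0 : p != 0 by rewrite -size_poly_gt0 ltnW.
have irr : irreducible_poly p.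
  split=> // q q1 qp; have q0 : q != 0 by apply: contraNneq p0 => e; rewrite e dvd0p in qp.
  rewrite -dvdp_size_eqp // eqn_leq dvdp_leq //= pk; apply: mink; apply/asboolP; exists q.
    exact: dvdp_trans qp pf.
  by rewrite eqxx andbT ltn_neqAle eq_sym q1 size_poly_gt0.
have [L1 _ [z pz _]] := irredp_FAdjoin irr.
have fz : root (map_poly (in_alg L1) f) z.
  by apply: root_dvdp pz; rewrite dvdp_map.
have /factor_theorem[g eg] := fz.
have g0 : g != 0.
  by apply: contraNneq f0 => e; rewrite -(map_poly_eq0 (in_alg L1)) eg e mul0r.
have sg : (size g).+1 = size f.
  by rewrite -(size_map_poly (in_alg L1) f) eg size_Mmonic ?monicXsubC // size_XsubC addn2.
have [|L2 [rs [lc [lc0 e2 srs]]]] := IHn L1 g _ g0; first by rewrite -ltnS sg.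
exists (baseFieldType L2), (in_alg L2 z :: rs), lc; split=> //.
  have -> : map_poly (in_alg (baseFieldType L2)) f =
      map_poly (in_alg L2) (map_poly (in_alg L1) f) :> {poly L2}.
    by rewrite -map_poly_comp.
  rewrite eg rmorphM /= e2 rmorphB /= map_polyX map_polyC big_cons.
  by rewrite -scalerAl mulrC.
by rewrite /= srs -sg /= prednK // size_poly_gt0.
Qed.

Section FractionMap.
Local Open Scope quotient_scope.

Lemma frac_decomp (T : idomainType) (z : {fraction T}) :
  exists p q : T, q != 0 /\ z = tofrac p / tofrac q.
Proof.
elim/quotW: z => x; exists \n_x, \d_x; split; first exact: denom_ratioP.
have d0 : tofrac \d_x != 0 :> {fraction T} by rewrite tofrac_eq0 denom_ratioP.
apply: (mulIf d0); rewrite divfK //.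
rewrite -[LHS]/(FracField.mul _ _) -[RHS]/(FracField.tofrac _) !piE.
apply/eqmodP; rewrite /= FracField.equivfE /FracField.mulf.
by rewrite !numden_Ratio ?mulf_neq0 ?oner_eq0 ?denom_ratioP // !mulr1 mulrC.
Qed.

Variables (R S : idomainType) (phi : {rmorphism R -> S}).
Hypothesis phi_inj : injective phi.

Lemma frac_map : exists i : {rmorphism {fraction R} -> {fraction S}},
  forall p, i (tofrac p) = tofrac (phi p).
Proof.
have phi0 p : p != 0 -> tofrac (phi p) != 0.
  by move=> p0; rewrite tofrac_eq0 -(rmorph0 phi) (inj_eq phi_inj).
have /boolp.choice[h hP] : forall z : {fraction R}, exists z' : {fraction S},
    forall p q, q != 0 -> z = tofrac p / tofrac q -> z' = tofrac (phi p) / tofrac (phi q).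
  move=> z; have [p0 [q0 [q00 e0]]] := frac_decomp z.
  exists (tofrac (phi p0) / tofrac (phi q0)) => p q qn0.
  rewrite e0 => /eqP; rewrite eqr_div ?tofrac_eq0 // -!tofracM tofrac_eq => /eqP e.
  by apply/eqP; rewrite eqr_div ?phi0 // -!tofracM -!rmorphM e.
have hz z : exists p q, [/\ q != 0, z = tofrac p / tofrac q &
    h z = tofrac (phi p) / tofrac (phi q)].
  have [p [q [q0 e]]] := frac_decomp z; exists p, q; split=> //; exact: hP.
have h_add : zmod_morphism h.
  move=> x y; have [p [q [q0 ex ->]]] := hz x; have [p' [q' [q'0 ey ->]]] := hz y.
  rewrite (hP _ (p * q' - p' * q) (q * q')) ?mulf_neq0 //.
    rewrite !rmorphB !rmorphM /= ?rmorphM /= -[RHS]/(_ + - _) -[- (_ / _)]mulNr.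
    by rewrite addf_div ?phi0 // mulNr.
  rewrite ex ey rmorphB !rmorphM /= -[LHS]/(_ + - _) -[- (_ / _)]mulNr.
  by rewrite addf_div ?tofrac_eq0 // mulNr.
have h_mul : monoid_morphism h.
  split; first by rewrite (hP _ 1 1) ?oner_neq0 // ?rmorph1 ?divr1.
  move=> x y; have [p [q [q0 ex ->]]] := hz x; have [p' [q' [q'0 ey ->]]] := hz y.
  rewrite (hP _ (p * p') (q * q')) ?mulf_neq0 //.
    by rewrite !rmorphM /= mulf_div.
  by rewrite ex ey !rmorphM /= mulf_div.
pose ha := GRing.isZmodMorphism.Build _ _ h h_add.
pose hm := GRing.isMonoidMorphism.Build _ _ h h_mul.
exists (HB.pack_for {rmorphism {fraction R} -> {fraction S}} h ha hm) => p /=.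
by rewrite (hP _ p 1) ?oner_neq0 // ?rmorph1 ?divr1 //.
Qed.

End FractionMap.

(** * Transfer and exceptional discs *)

Section Transfer.
Variables (E K0 : fieldType) (c : {rmorphism E -> K0}) (v : valuation E).

Lemma res_horner (K : fieldType) (iota : {rmorphism E -> K}) (w : extension iota v)
    n (a : 'I_n -> E) u : (forall i, dv v 1 (a i)) -> dv w 1 u ->
  dv w 1 (\sum_i iota (a i) * u ^+ i) /\
  res w (\sum_i iota (a i) * u ^+ i) = \sum_i resmap w (res v (a i)) * res w u ^+ i.
Proof.
move=> ha hu.
have h1 i : dv w 1 (iota (a i)) by rewrite -[X in dv _ X _](rmorph1 iota) dv_iota.
have h2 i : dv w 1 (u ^+ i) by rewrite -[X in dv _ X _](expr1n _ i) dvX.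
have h3 (i : 'I_n) : dv w 1 (iota (a i) * u ^+ i) by rewrite -[X in dv _ X _]mulr1 dvM.
split; first exact: dv_sum.
rewrite res_sum //; apply: eq_bigr => i _.
by rewrite resM // resmap_res // resX.
Qed.

Variables (K1 K2 : fieldType) (j1 : {rmorphism K0 -> K1}) (j2 : {rmorphism K0 -> K2}).
Variables (iota1 : {rmorphism E -> K1}) (iota2 : {rmorphism E -> K2}).
Hypothesis iota1E : forall a, iota1 a = j1 (c a).
Hypothesis iota2E : forall a, iota2 a = j2 (c a).
Variables (w1 : extension iota1 v) (w2 : extension iota2 v).
Hypothesis same : forall z, (j1 z \in vring w1) = (j2 z \in vring w2).

Lemma dv_transfer x y : dv w1 (j1 x) (j1 y) = dv w2 (j2 x) (j2 y).
Proof. by rewrite !dvE !fmorph_eq0 -!fmorph_div same. Qed.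

Lemma sim_transfer x y : sim w1 (j1 x) (j1 y) = sim w2 (j2 x) (j2 y).
Proof. by rewrite !simE !sdvE -!rmorphB dv_transfer. Qed.

Lemma eqv_transfer x y : eqv w1 (j1 x) (j1 y) = eqv w2 (j2 x) (j2 y).
Proof. by rewrite !eqvE !dv_transfer. Qed.

(** An algebraic equation for the residue of u lifts to coefficients in E, and then says that a
    certain element of K0 lies in the maximal ideal. On K0 both valuations agree. *)
Lemma good_transfer x : good w1 (j1 x) -> good w2 (j2 x).
Proof.
move=> [x0 [N [a [N0 a0 ua /algP[r r0 hr]]]]].
split; first by move: x0; rewrite !fmorph_eq0.
exists N, a; pose u := x ^+ N / c a.
have e1 : j1 x ^+ N / iota1 a = j1 u by rewrite /u fmorph_div rmorphXn iota1E.
have e2 : j2 x ^+ N / iota2 a = j2 u by rewrite /u fmorph_div rmorphXn iota2E.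
rewrite e1 in ua hr; rewrite e2; have u2 : eqv w2 1 (j2 u).
  by rewrite -[X in eqv _ X _](rmorph1 j2) -eqv_transfer rmorph1.
split=> //; apply/algP; exists r => //.
have [l hl] := boolp.choice (fun i : 'I_(size r) =>
  let: ex_intro2 x h1 h2 := res_surj r`_i in ex_intro
   (fun x => dv v 1 x /\ r`_i = res v x) x (conj h1 h2)).
have [d1 s1] := res_horner (fun i => proj1 (hl i)) (proj1 (andP (etrans (esym (eqvE _ _ _)) ua))).
have [d2 s2] := res_horner (fun i => proj1 (hl i)) (proj1 (andP (etrans (esym (eqvE _ _ _)) u2))).
have horner_r (kw : fieldType) (rho : {rmorphism resfield v -> kw}) (t : kw) :
    (map_poly rho r).[t] = \sum_i rho (res v (l i)) * t ^+ i.
  rewrite horner_coef size_map_poly; apply: eq_bigr => i _.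
  by rewrite coef_map (proj2 (hl i)).
have e (K : fieldType) (iota : {rmorphism E -> K}) (j : {rmorphism K0 -> K}) :
    (forall b, iota b = j (c b)) ->
    \sum_i iota (l i) * j u ^+ i = j (\sum_i c (l i) * u ^+ i).
  by move=> ij; rewrite rmorph_sum; apply: eq_bigr => i _; rewrite rmorphM rmorphXn ij.
apply/rootP; rewrite horner_r -s2; apply/eqP; rewrite res_eq0 //.
move/rootP: hr; rewrite horner_r -s1 => /eqP; rewrite res_eq0 //.
rewrite (e _ _ _ iota1E) (e _ _ _ iota2E) !sdvE.
by rewrite -(rmorph1 j1) -(rmorph1 j2) dv_transfer.
Qed.

End Transfer.

Section Exceptional.
Variables (E : fieldType) (v : valuation E) (L : fieldExtType E).

Definition const_ext : {rmorphism E -> {fraction {poly L}}} :=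
  @tofrac {poly L} \o polyC \o in_alg L.

(* w is the Gauss valuation of the disc with center a and radius v (a - b). *)
Definition exceptional (w : extension const_ext v) (a b : L) :=
  ~ good w (tofrac ('X - a%:P)) /\
  eqv w (tofrac ('X - a%:P)) (tofrac (a - b)%:P).

Lemma tofrac_neq0 (p : {poly L}) : p != 0 -> tofrac p != 0.
Proof. by rewrite tofrac_eq0. Qed.

(** The value of a polynomial is the least value of its Taylor terms, and in each of them a - b may
    stand for X - a. Comparisons of polynomials become comparisons of constants: w is known from a,
    b and its restriction to L. *)
Lemma exceptional_dv (w : extension const_ext v) a b (p q : {poly L}) :
  exceptional w a b -> q != 0 ->
  dv w (tofrac q) (tofrac p) <-> exists i : nat, forall j : nat,
    dv w (tofrac ((taylor a q)`_i * (a - b) ^+ i)%:P)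
         (tofrac ((taylor a p)`_j * (a - b) ^+ j)%:P).
Proof.
move=> [bad eab] q0.
pose ev : {rmorphism {poly L} -> {fraction {poly L}}} := @tofrac {poly L}.
have evC (x : E) : ev (x%:A)%:P = const_ext x by [].
have term (r : {poly L}) i : eqv w (ev ((taylor a r)`_i)%:P * ev ('X - a%:P) ^+ i)
    (tofrac ((taylor a r)`_i * (a - b) ^+ i)%:P).
  rewrite polyCM rmorphM /= polyC_exp rmorphXn /=.
  by apply: eqvM; [exact: eqv_refl|exact: eqvX].
split=> [qp|[i hi]].
  have [i [qi _]] := top_index tofrac_neq0 evC bad q0; exists i => j.
  apply: dv_trans (eqv_dvr (eqv_trans qi (term q i))) _.
  apply: dv_trans qp _.
  exact: dv_trans (dv_taylor tofrac_neq0 evC bad p j) (eqv_dv (term p j)).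
apply: dv_trans (dv_taylor tofrac_neq0 evC bad q i) _.
apply: dv_trans (eqv_dv (term q i)) _.
rewrite -[tofrac p]/(ev p) (ev_taylor ev a (leqnn (size p))).
apply: dv_sum => j _; exact: dv_trans (hi j) (eqv_dvr (term p j)).
Qed.

Lemma exceptional_inj (w1 w2 : extension const_ext v) a b :
  exceptional w1 a b -> exceptional w2 a b ->
  (forall x : L, (tofrac x%:P \in vring w1) = (tofrac x%:P \in vring w2)) ->
  forall z, z \in vring w1 -> z \in vring w2.
Proof.
move=> x1 x2 same z; have [p [q [q0 ->]]] := frac_decomp z.
have q0' := tofrac_neq0 q0.
have dvz (w : extension const_ext v) :
    (tofrac p / tofrac q \in vring w) = dv w (tofrac q) (tofrac p).
  by rewrite -dv1 -(dvM2r w _ _ q0') mul1r divfK.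
have dvC x y : dv w1 (tofrac x%:P) (tofrac y%:P) = dv w2 (tofrac x%:P) (tofrac y%:P).
  rewrite !dvE; case: (eqVneq y 0) => [->|y0]; first by rewrite polyC0 rmorph0 eqxx.
  case: (eqVneq x 0) => [->|x0]; first by rewrite polyC0 rmorph0 eqxx.
  have e : tofrac y%:P / tofrac x%:P = tofrac (y / x)%:P :> {fraction {poly L}}.
    have cx0 : tofrac x%:P != 0 :> {fraction {poly L}}.
      by rewrite tofrac_eq0 polyC_eq0.
    by apply: (mulIf cx0); rewrite divfK // -tofracM -polyCM divfK.
  by rewrite e same.
rewrite !dvz => /(exceptional_dv _ x1 q0)[i hi]; apply/(exceptional_dv _ x2 q0).
by exists i => j; rewrite -dvC.
Qed.

End Exceptional.

Lemma finite_set_fibers (T U : Type) (g : T -> U) (A : set T) :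
  finite_set [set g x | x in A]%classic ->
  (forall x, A x -> finite_set [set y | A y /\ g y = g x]%classic) ->
  finite_set A.
Proof.
move=> fg ff.
apply: (@sub_finite_set _ _ (\bigcup_(u in [set g x | x in A]) [set y | A y /\ g y = u])%classic).
  by move=> x Ax; exists (g x) => //; exists x.
by apply: bigcup_finite => // _ [x Ax <-]; exact: ff.
Qed.

(** * Residually transcendental extensions to the curve *)

Section Hyperelliptic.
Variables (E : fieldType) (v : valuation E) (n : nat) (f : {poly E}).
Variables (F : fieldExtType {fraction {poly E}}) (y : F).
Hypothesis f0 : f != 0.
Hypothesis y2 : y ^+ 2 = (tofrac f)%:A.
Hypothesis y_gen : <<1; y>>%VS = fullv.
Hypothesis unit_nat : forall m, (0 < m <= n)%N -> eqv v 1 m%:R.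
Hypothesis n2 : (2 <= n)%N.

Definition eval_curve : {rmorphism {poly E} -> F} :=
  GRing.in_alg F \o @tofrac {poly E}.
Local Notation evF := eval_curve.

Lemma eval_curve_eq0 (p : {poly E}) : (evF p == 0) = (p == 0).
Proof. by rewrite -[evF p]/(in_alg F (tofrac p)) fmorph_eq0 tofrac_eq0. Qed.

Lemma eval_curve_inj (p : {poly E}) : p != 0 -> evF p != 0.
Proof. by rewrite eval_curve_eq0. Qed.

Lemma evfrac_curve (x : {fraction {poly E}}) : evfrac evF x%:A.
Proof.
have [p [q [q0 ->]]] := frac_decomp x; exists p, q; split=> //.
by rewrite -[LHS]/(in_alg F _) fmorph_div.
Qed.

Lemma curve_decomp z : exists a b, [/\ evfrac evF a, evfrac evF b & z = a + b * y].
Proof.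
have : z \in <<1; y>>%VS by rewrite y_gen memvf.
move=> /Fadjoin_polyP[p0 /polyOver1P[p ->] ->].
pose D : {poly {fraction {poly E}}} := 'X^2 - (tofrac f)%:P.
have sD : size D = 3 by rewrite size_XnsubC.
have Dy : (map_poly (in_alg F) D).[y] = 0.
  by rewrite rmorphB /= map_polyXn map_polyC hornerD hornerN hornerXn hornerC y2 subrr.
pose r := p %% D; have sr : (size (map_poly (in_alg F) r) <= 2)%N.
  have : (size r < size D)%N by rewrite ltn_modp -size_poly_gt0 sD.
  by rewrite size_map_poly sD.
exists (r`_0)%:A, (r`_1)%:A; split; [exact: evfrac_curve|exact: evfrac_curve|].
rewrite (divp_eq p D) rmorphD rmorphM hornerD hornerM Dy mulr0 add0r.
by rewrite (horner_coef_wide _ sr) big_ord_recr big_ord1 /= !coef_map expr0 mulr1.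
Qed.

Lemma fact_unit_base m : (m <= n)%N -> eqv v 1 (m`!)%:R.
Proof.
elim: m => [|m IHm] mn; first by rewrite eqv_refl.
by rewrite factS natrM; apply: eqv1M; [exact: unit_nat|apply: IHm; exact: ltnW].
Qed.

Lemma eqv_iota (K : fieldType) (iota : {rmorphism E -> K}) (w : extension iota v) a b :
  eqv w (iota a) (iota b) = eqv v a b.
Proof. by rewrite !eqvE !dv_iota. Qed.

Variables (L : fieldExtType E) (rs : seq L) (lc : L) (lc0 : lc != 0).
Hypothesis f_split : map_poly (in_alg L) f = lc *: \prod_(b <- rs) ('X - b%:P).
Hypothesis size_rs : size rs = n.
Variable i : {rmorphism {fraction {poly E}} -> {fraction {poly L}}}.
Hypothesis iE : forall p, i (tofrac p) = tofrac (map_poly (in_alg L) p).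

(** The key polynomial P is taken over E for w, the shape of f is read off over L from w', and
    goodness and equivalence are exchanged on E(X), where the two valuations agree. *)
Lemma nonexceptional_ruled (w : extension (const_embedding F) v)
    (w' : extension (const_ext L) v) :
  (forall z, (z%:A \in vring w) = (i z \in vring w')) ->
  transcendental_ext (resmap w) ->
  (forall a b, a \in rs -> b \in rs -> b != a -> ~ exceptional w' a b) ->
  ruled (resmap w).
Proof.
move=> same tr nonexc.
pose ev : {rmorphism {poly L} -> {fraction {poly L}}} := @tofrac {poly L}.
have ev_inj (p : {poly L}) : p != 0 -> ev p != 0 by exact: tofrac_neq0.
have evC (x : E) : ev (x%:A)%:P = const_ext L x by [].
have evFC (a : E) : evF a%:P = const_embedding F a by [].
have u2 : eqv w 1 2.
  rewrite -(rmorph_nat (const_embedding F) 2) -[X in eqv _ X _](rmorph1 (const_embedding F)).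
  by rewrite eqv_iota; exact: unit_nat.
have ry2 : evfrac evF (y ^+ 2) by rewrite y2; exact: evfrac_curve.
have [p0 p00 bp0] := transcendental_bad eval_curve_inj ry2 curve_decomp u2 tr.
pose Q k := `[< exists2 p : {poly E}, p != 0 & ~ good w (evF p) /\ size p = k >].
have exQ : exists k, Q k by exists (size p0); apply/asboolP; exists p0.
have [k /asboolP[P P0 [bP sP]] mink] := ex_minnP exQ.
have P_min (A : {poly E}) : A != 0 -> (size A < size P)%N -> good w (evF A).
  move=> A0 lt; apply: contrapT => bA; move: lt; rewrite ltnNge sP => /negP; apply.
  by apply: mink; apply/asboolP; exists A.
have R_even := ruled_even eval_curve_inj evFC ry2 curve_decomp u2 P0 bP P_min.
have R_odd := ruled_odd eval_curve_inj evFC ry2 curve_decomp u2 P0 bP P_min.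
have i1E (a : E) : const_embedding F a = in_alg F (tofrac a%:P) by [].
have i2E (a : E) : const_ext L a = i (tofrac a%:P).
  by rewrite iE map_polyC.
have evE (p : {poly E}) : ev (map_poly (in_alg L) p) = i (tofrac p) by rewrite iE.
have same1 z : (in_alg F z \in vring w) = (i z \in vring w') by exact: same.
have same2 z : (i z \in vring w') = (in_alg F z \in vring w) by [].
have dvT x z : dv w (in_alg F x) (in_alg F z) = dv w' (i x) (i z).
  exact: (dv_transfer same1).
have simT x z : sim w (in_alg F x) (in_alg F z) = sim w' (i x) (i z).
  exact: (sim_transfer same1).
have goodT x : good w (in_alg F x) -> good w' (i x).
  exact: (good_transfer (c := @tofrac {poly E} \o polyC) i1E i2E same1).
have goodT' x : good w' (i x) -> good w (in_alg F x).
  exact: (good_transfer (c := @tofrac {poly E} \o polyC) i2E i1E same2).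
have fu m : (m <= size rs)%N -> eqv w' 1 (m`!)%:R.
  move=> mn; rewrite -(rmorph_nat (const_ext L)) -[X in eqv _ X _](rmorph1 (const_ext L)).
  by rewrite eqv_iota; apply: fact_unit_base; rewrite -size_rs.
have ne a b : a \in rs -> b \in rs -> b != a -> ~ good w' (ev ('X - a%:P)) ->
    ~~ eqv w' (ev ('X - a%:P)) (ev (a - b)%:P).
  by move=> ars brs ba bad; apply/negP => e; exact: (nonexc a b).
have one_frac : evfrac evF 1 by rewrite -(rmorph1 evF); exact: evfrac_ev.
have oneE : (1 : E) != 0 := oner_neq0 E.
have y2F : y ^+ 2 = evF f by [].
have evf0 : evF f != 0 := eval_curve_inj f0.
case: (nonexceptional_shape ev_inj evC lc0 f_split fu ne) => [gf|].
  apply: (R_even 1 1 f one_frac (oner_neq0 F) oneE); first by apply: goodT'; rewrite -evE.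
  by rewrite divr1 y2F rmorph1 mul1r; exact: sim_refl.
move=> [m [/andP[m0 mn] grho bh hs hq]].
set h := f^`(m.-1) in bh hs hq; set rho := f^`(m) in grho hs.
have grhoF : good w (evF rho) by apply: goodT'; rewrite -evE.
have bhF : ~ good w (evF h) by move=> /goodT; rewrite -evE.
have N0 : (m`!)%:R != 0 :> E.
  by apply: eqv1_neq0 (fact_unit_base _); rewrite -size_rs.
have hsF : sim w (const_embedding F (m`!)%:R * evF f) (evF rho * (evF h / evF rho) ^+ m).
  have e1 : const_embedding F (m`!)%:R * evF f =
      in_alg F (tofrac ((m`!)%:R)%:P * tofrac f) by rewrite [RHS]rmorphM.
  have e2 : evF rho * (evF h / evF rho) ^+ m =
      in_alg F (tofrac rho * (tofrac h / tofrac rho) ^+ m).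
    by rewrite [RHS]rmorphM rmorphXn fmorph_div.
  have e3 : i (tofrac ((m`!)%:R)%:P * tofrac f) = (m`!)%:R * ev (map_poly (in_alg L) f).
    by rewrite rmorphM -i2E -evE rmorph_nat.
  have e4 : i (tofrac rho * (tofrac h / tofrac rho) ^+ m) = ev (map_poly (in_alg L) rho) *
      (ev (map_poly (in_alg L) h) / ev (map_poly (in_alg L) rho)) ^+ m.
    by rewrite rmorphM rmorphXn fmorph_div -!evE.
  by rewrite e1 e2 simT e3 e4.
apply: (ruled_shape eval_curve_inj evFC ry2 curve_decomp u2 P0 bP P_min y2F m0 N0 grhoF bhF hsF).
(* What remains is that the quotient is good. As P is the key polynomial, the remainder is zero or
   good and never dominates h, so the last clause of the shape applies. *)
set q := h %/ P; pose R := h %% P; have e : h = q * P + R := divp_eq h P.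
have gR : evF R = 0 \/ good w (evF R).
  by apply: (small_good_or0 P_min); rewrite ltn_modp.
have [_] := gauss_divp eval_curve_inj evFC bP P_min P0 q gR; rewrite -e => dR.
apply: (goodT' _); rewrite -evE; apply: (hq q P R e _ _ _ P0).
- by rewrite !evE -dvT; exact: dR.
- case: gR => [/eqP|gR]; last by right; rewrite evE; exact: goodT gR.
  by rewrite eval_curve_eq0 => /eqP; left.
by rewrite evE => /goodT' /bP.
Qed.

End Hyperelliptic.

Lemma vring_valring (K : fieldType) (w : valuation K) : valring [set` vring w]%classic.
Proof.
split=> [|x y|x y|x].
- exact: rpred1.
- exact: rpredB.
- exact: rpredM.
by case/orP: (vring_total w x) => h; [left|right].
Qed.

(** For fixed a and b an exceptional ring is determined by its trace on L, and the traces are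
    extensions of the ring of v to the finite extension L. *)
Lemma finite_exceptional (E : fieldType) (v : valuation E) (L : fieldExtType E)
    (rs : seq L) : eqv v 1 2 ->
  finite_set [set O : set {fraction {poly L}} |
    exists w : extension (const_ext L) v, O = [set` vring w]%classic /\
      exists a b, [/\ a \in rs, b \in rs & exceptional w a b] ]%classic.
Proof.
move=> u2; set T := [set O | _]%classic.
pose Tab (ab : L * L) : set (set {fraction {poly L}}) := [set O |
  exists w : extension (const_ext L) v, O = [set` vring w]%classic /\
    exceptional w ab.1 ab.2]%classic.
apply: (@sub_finite_set _ _ (\bigcup_(ab in [set` [seq (a, b) | a <- rs, b <- rs]]) Tab ab)%classic).
  move=> O [w [eO [a [b [ars brs ex]]]]]; exists (a, b); last by exists w.
  by apply/allpairsP; exists (a, b).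
apply: bigcup_finite; first exact: finite_seq.
move=> [a b] _; pose g (O : set {fraction {poly L}}) : set L := [set x | O (tofrac x%:P)]%classic.
apply: (@finite_set_fibers _ _ g).
  have n20 : (2 : E) != 0 := eqv1_neq0 u2.
  have V2 : [set` vring v]%classic 2^-1.
    by have := eqv_dv (eqv1V u2); rewrite dv1.
  apply: sub_finite_set (@finite_valring_extensions E L [set` vring v]%classic V2 n20).
  move=> _ [_ [w [-> _]] <-]; have [h1 h2 h3 h4] := vring_valring w; split.
    split=> [|x y hx hy|x y hx hy|x].
    - by rewrite /g /= polyC1 rmorph1; exact: rpred1.
    - by rewrite /g /= polyCB rmorphB; exact: rpredB.
    - by rewrite /g /= polyCM rmorphM; exact: rpredM.
    have [->|x0] := eqVneq x 0; first by left; rewrite /g /= polyC0 rmorph0 rpred0.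
    have e : tofrac x^-1%:P = (tofrac x%:P)^-1 :> {fraction {poly L}}.
      have cx0 : tofrac x%:P != 0 :> {fraction {poly L}}.
        by rewrite tofrac_eq0 polyC_eq0.
      by apply: (mulIf cx0); rewrite mulVf // -tofracM -polyCM mulVf // polyC1 tofrac1.
    by case: (h4 (tofrac x%:P)) => h; [left|right]; rewrite /g /= ?e.
  move=> x; rewrite /g /=; split=> h.
    by rewrite -(extension_vring w).
  by rewrite -(extension_vring w) in h.
move=> _ [w [-> ex]].
apply: (@sub_finite_set _ _ [set [set` vring w]]%classic); last exact: finite_set1.
move=> _ [[w' [-> ex']] eg]; apply/seteqP.
have same x : (tofrac x%:P \in vring w') = (tofrac x%:P \in vring w).
  have e : g [set` vring w']%classic x = g [set` vring w]%classic x by rewrite eg.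
  apply/idP/idP => h; last by have : g [set` vring w']%classic x by rewrite e.
  by have : g [set` vring w]%classic x by rewrite -e.
split=> z /= h; first exact: (exceptional_inj ex' ex same).
by apply: (exceptional_inj ex ex' _ h) => x; rewrite same.
Qed.

Lemma residue_unit_nat (K : fieldType) (v : valuation K) n :
  [pchar (residue v)] =i pred0 \/
    (exists2 p, p \in [pchar (residue v)] & (n < p)%N) ->
  forall m, (0 < m <= n)%N -> eqv v 1 m%:R.
Proof.
move=> hchar m /andP[m0 mn].
have dm : dv v 1 m%:R by rewrite dv1; exact: rpred_nat.
rewrite eqvE dm /=; apply: sdvN; rewrite -residue_natr.
case: hchar => [h|[p pc np]].
  by move/pcharf0P: h => ->; rewrite -lt0n.
rewrite -(dvdn_pcharf pc); apply/negP => /(dvdn_leq m0).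
by rewrite leqNgt (leq_ltn_trans mn np).
Qed.

Theorem theorem6p4 (E : fieldType) (v : valuation E)
  (n : nat) (f : {poly E})
  (hn : (2 <= n)%N) (hdeg : size f = n.+1) (hsq : square_free f)
  (hchar : [pchar (residue v)] =i pred0 \/
           exists2 p, p \in [pchar (residue v)] & (n < p)%N)
  (F : fieldExtType {fraction {poly E}}) (y : F)
  (hy : y ^+ 2 = (tofrac f)%:A) (hF : <<1; y>>%VS = fullv) :
  finite_set [set O : set F |
    exists w : extension (const_embedding F) v,
      [/\ residually_transcendental w,
          ~ ruled (residue_map w) &
          O = [set` vring w] ] ]%classic.
Proof.
have f0 : f != 0 by rewrite -size_poly_gt0 hdeg.
have unit_nat := residue_unit_nat hchar.
have u2 : eqv v 1 2 by exact: unit_nat.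
have [L [rs [lc [lc0 f_split srs]]]] := splitting_ext f0.
have size_rs : size rs = n by rewrite srs hdeg.
have [i iE0] := frac_map (map_poly_inj (in_alg L)).
have iE p : i (tofrac p) = tofrac (map_poly (in_alg L) p) := iE0 p.
set S := [set O | _]%classic.
(* The trace on E(X). Its fibers are finite because F is finite over E(X); it remains to bound the
   set of traces. *)
pose g (O : set F) : set {fraction {poly E}} := [set z | O z%:A]%classic.
apply: (@finite_set_fibers _ _ g); last first.
  move=> _ [w [_ _ ->]]; have hw := vring_valring w.
  have u2w : eqv w 1 2.
    rewrite -(rmorph_nat (const_embedding F) 2) -[X in eqv _ X _](rmorph1 (const_embedding F)).
    by rewrite eqv_iota.
  have n20 : (2 : {fraction {poly E}}) != 0.
    by have := eqv1_neq0 u2w; rewrite -(rmorph_nat (in_alg F)) fmorph_eq0.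
  have V2 : g [set` vring w]%classic 2^-1.
    have := eqv_dv (eqv1V u2w).
    by rewrite dv1 -(rmorph_nat (in_alg F)) -fmorphV.
  apply: (sub_finite_set _ (finite_valring_extensions F V2 n20)).
  move=> _ [[w' [_ _ ->]] eg]; split; first exact: vring_valring.
  by move=> z; rewrite -eg.
(* Every trace is shown to be the trace of an exceptional ring of L(X). *)
apply: (@sub_finite_set _ _ [set [set z | O' (i z)]%classic | O' in
  [set O : set {fraction {poly L}} | exists w : extension (const_ext L) v,
    O = [set` vring w]%classic /\
    exists a b, [/\ a \in rs, b \in rs & exceptional w a b] ] ]%classic); last first.
  by apply: finite_image; exact: finite_exceptional.
move=> _ [_ [w [tr nr ->]] <-].
have hO0 : valring (g [set` vring w]%classic).
  have [h1 h2 h3 h4] := vring_valring w.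
  split=> [|a b ha hb|a b ha hb|a].
  - by rewrite /g /= scale1r.
  - by rewrite /g /= scalerBl; exact: h2.
  - by rewrite /g /= -[_ *: _]/(in_alg F (a * b)) rmorphM; exact: h3.
  rewrite /g /= -[_^-1 *: _]/(in_alg F a^-1) fmorphV.
  by case: (h4 a%:A) => h; [left|right].
(* Any extension of the trace to L(X) will do: if it were not exceptional for two roots of f, w
   would be ruled. *)
have [O' vO' hO'] := valring_extension i hO0.
have hv a : O' (const_ext L a) <-> a \in vring v.
  rewrite -(extension_vring w); have -> : const_ext L a = i (tofrac a%:P).
    by rewrite iE map_polyC.
  exact: hO'.
pose w' := extension_of vO' hv.
have same z : (z%:A \in vring w) = (i z \in vring w').
  by apply/idP/idP => [h|/valuation_ofE/hO'//]; apply/valuation_ofE/hO'.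
exists O'; last by apply/seteqP; split=> z /hO'.
exists w'; split; first by apply/seteqP; split=> z /= /valuation_ofE.
apply: contrapT => none; apply: nr; apply: ruled_resmap.
apply: (nonexceptional_ruled f0 hy hF unit_nat hn lc0 f_split size_rs iE same).
  exact: transcendental_resmap.
by move=> a b ars brs _ ex; apply: none; exists a, b.
Qed.
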